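(* Consider the linearized controller system, with state $\hat z=(\hat h,\hat q)^T$, disturbance input $d(t)$ and $(t,x)\in[0,+\infty)\times[0,L]$, $$\hat h_t+\hat q_x=0,\qquad \hat q_t+a(x)\hat h_x+b(x)\hat q_x+\big(a_x(x)+\tilde a(x)\big)\hat h+\big(b_x(x)+\tilde b(x)\big)\hat q=0,$$ with the boundary conditions $$\alpha_h\hat h(t,0)+\alpha_q\hat q(t,0)=d(t),\qquad \hat h(t,L)=0.$$ If there exist two functions $p_i\in C^1([0,L],(0,+\infty))$ $(i=1,2)$ such that $$\left(\frac{\alpha_h-\alpha_q\lambda_2(0)}{\alpha_h+\alpha_q\lambda_1(0)}\right)^{2}<\frac{p_2(0)}{p_1(0)}\frac{\lambda_2(0)}{\lambda_1(0)},\qquad \frac{p_2(L)\lambda_2(L)}{p_1(L)\lambda_1(L)}<1,$$ and such that the matrix $-M_x(x)+B^T(x)P(x)+P(x)B(x)$ is positive definite for all $x\in[0,L]$, then this system is $L^2$-input-to-state stable, that is, there exist three positive constants $C_1$, $C_2$ and $\nu$ such that, for every bounded disturbance $d$ and from any initial condition $\hat z(0,\cdot)\in L^2([0,L],\mathbb{R}^2)$, the system solution satisfies $$\|\hat z(t,\cdot)\|_{L^2}\leqslant C_1\|\hat z(0,\cdot)\|_{L^2}e^{-\nu t}+C_2\sup_{t\geqslant 0}|d(t)|,\qquad t\in[0,+\infty).$$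
   Context: Let $L>0$ and let $f,g,\alpha,\beta:\mathbb{R}^2\to\mathbb{R}$ be sufficiently smooth functions of $(H,Q)$. Fix a set point $H^*_L$ and a steady state $(H^*(x),Q^* )$, where $Q^*$ is a constant and $H^*:[0,L]\to\mathbb{R}$ solves $$\big(f(H^*,Q^* )\big)_x+g(H^*,Q^* )=0,\qquad H^*(L)=H^*_L,\qquad x\in[0,L].$$ The coefficients are $$a(x)=\frac{\partial f}{\partial H}(H^*(x),Q^* ),\quad b(x)=\frac{\partial f}{\partial Q}(H^*(x),Q^* ),\quad \tilde a(x)=\frac{\partial g}{\partial H}(H^*(x),Q^* ),\quad \tilde b(x)=\frac{\partial g}{\partial Q}(H^*(x),Q^* ),$$ $$\alpha_h=\frac{\partial\alpha}{\partial H}(H^*(0),Q^* ),\qquad \alpha_q=\frac{\partial\alpha}{\partial Q}(H^*(0),Q^* ),$$ where $\alpha_h$ and $\alpha_q$ are not both zero. Subscripts $t,x$ denote derivatives. Standing hyperbolicity assumption: $b^2(x)+4a(x)>0$ for all $x\in[0,L]$, and the functions $$\lambda_1(x)=\frac{b(x)+\sqrt{b^2(x)+4a(x)}}{2},\qquad -\lambda_2(x)=\frac{b(x)-\sqrt{b^2(x)+4a(x)}}{2}$$ satisfy $\lambda_1(x)>0$ and $\lambda_2(x)>0$ for all $x\in[0,L]$. Define the matrices $$A(x)=\begin{pmatrix} 0 & 1 \\ a(x) & b(x) \end{pmatrix},\quad B(x)=\begin{pmatrix} 0 & 0 \\ {a_x(x)+\tilde a(x)} & {b_x(x)+\tilde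 b(x)} \end{pmatrix},\quad N(x)=\begin{pmatrix} \lambda_2(x) & 1 \\ -\lambda_1(x) & 1 \end{pmatrix},$$ $$P(x)=N^T(x)\begin{pmatrix} p_1(x) & 0 \\ 0 & p_2(x) \end{pmatrix}N(x),\qquad M(x)=P(x)A(x)$$ (the matrix $M(x)$ is symmetric), and let $M_x$ be the derivative of $M$ with respect to $x$. The disturbance $d:[0,+\infty)\to\mathbb{R}$ is a bounded measurable function. For initial data in $L^2$, solutions are understood in the standard (weak) $L^2$ sense for linear hyperbolic systems. *)

(* Defs.v *)
From HB Require Import structures.
From mathcomp Require Export all_boot all_order all_algebra.
From mathcomp Require Export all_classical all_reals all_analysis.

Set Implicit Arguments.
Unset Strict Implicit.
Unset Printing Implicit Defensive.

Import Order.TTheory GRing.Theory Num.Theory.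
Import numFieldNormedType.Exports.

Local Open Scope classical_set_scope.
Local Open Scope ring_scope.

Section Calculus.
Context {R : realType}.

Definition D1 (f : R * R -> R) : R * R -> R := 'D_((1, 0) : R * R) f.
Definition D2 (f : R * R -> R) : R * R -> R := 'D_((0, 1) : R * R) f.

Fixpoint Ck (k : nat) (f : R * R -> R) : Prop :=
  if k is k'.+1 then
    [/\ continuous f,
        forall z : R * R, derivable f z ((1, 0) : R * R)
                  /\ derivable f z ((0, 1) : R * R),
        Ck k' (D1 f) & Ck k' (D2 f)]
  else continuous f.

(* Functions on [0, L] are represented by functions on R of which only the
   values on [0, L] matter; at 0 and L the derivative is one-sided. *)
Definition diff_quot (L : R) (p : R -> R) (x : R) :=
  (y - x)^-1 * (p y - p x) @[y --> within `[0, L] x^'].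

Definition derivable_seg (L : R) (p : R -> R) (x : R) : Prop :=
  cvg (diff_quot L p x).

Definition dseg (L : R) (p : R -> R) (x : R) : R := lim (diff_quot L p x).

Definition C1_seg (L : R) (p : R -> R) : Prop :=
  (forall x : R, x \in `[0, L] -> derivable_seg L p x)
  /\ {within `[0, L], continuous (dseg L p)}.

Definition dseg_mx (L : R) m n (K : R -> 'M[R]_(m, n)) (x : R) : 'M[R]_(m, n) :=
  \matrix_(i, j) dseg L (fun y => K y i j) x.

End Calculus.

Section Matrices.
Context {R : realType}.

Definition mx2 (a b c d : R) : 'M[R]_2 :=
  \matrix_(i, j) (if i == 0 then (if j == 0 then a else b)
                  else (if j == 0 then c else d)).

(* Applied below only to symmetric matrices. *)
Definition posdef n (K : 'M[R]_n) : Prop :=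
  forall v : 'cV[R]_n, v != 0 -> 0 < (v^T *m K *m v) 0 0.

Definition lambda1 (a b : R -> R) (x : R) : R :=
  (b x + Num.sqrt (b x ^+ 2 + 4 * a x)) / 2.

Definition lambda2 (a b : R -> R) (x : R) : R :=
  - ((b x - Num.sqrt (b x ^+ 2 + 4 * a x)) / 2).

Definition Amx (a b : R -> R) (x : R) : 'M[R]_2 := mx2 0 1 (a x) (b x).

Definition Bmx (L : R) (a b ta tb : R -> R) (x : R) : 'M[R]_2 :=
  mx2 0 0 (dseg L a x + ta x) (dseg L b x + tb x).

Definition Nmx (a b : R -> R) (x : R) : 'M[R]_2 :=
  mx2 (lambda2 a b x) 1 (- lambda1 a b x) 1.

Definition Pmx (a b p1 p2 : R -> R) (x : R) : 'M[R]_2 :=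
  (Nmx a b x)^T *m mx2 (p1 x) 0 0 (p2 x) *m Nmx a b x.

Definition Mmx (a b p1 p2 : R -> R) (x : R) : 'M[R]_2 :=
  Pmx a b p1 p2 x *m Amx a b x.

End Matrices.

Section L2Solutions.
Context {R : realType}.
Local Notation mu := (@lebesgue_measure R).

Definition L2_seg (L : R) (u : R -> R) : Prop :=
  measurable_fun `[0, L] u
  /\ mu.-integrable `[0, L] (fun x => (u x ^+ 2)%:E).

Definition L2norm (L : R) (u v : R -> R) : R :=
  Num.sqrt (\int[mu]_(x in `[0, L]) (u x ^+ 2 + v x ^+ 2)).

(* Weak L^2 solutions, (h, q) in C^0([0, +oo); L^2(0, L)), of
     h_t + q_x = 0,   q_t + a h_x + b q_x + c h + e q = 0,
     alh h(t,0) + alq q(t,0) = d(t),   h(t,L) = 0,   (h, q)(0, .) = (h0, q0).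
   The integral identity is obtained by multiplying the two equations by the
   test functions phi1, phi2 and integrating by parts on [0, tau] x [0, L].
   This produces the boundary terms
     [ a phi2 h + (phi1 + b phi2) q ]  at x = 0 (sign +) and x = L (sign -).
   Test functions satisfy the adjoint boundary conditions: phi1 + b phi2 = 0
   at x = L, which together with h(t,L) = 0 cancels the term at L, and
   (a phi2, phi1 + b phi2) = m (alh, alq) at x = 0, so that the term at 0 is
   m (alh h + alq q) = m d.  The function m is determined by the test functions
   whenever (alh, alq) <> (0, 0).
   In phi1 and phi2 the first variable is t and the second is x. *)
Definition adjoint_test (L : R) (a b : R -> R) (alh alq tau : R)
    (phi1 phi2 : R * R -> R) (m : R -> R) : Prop :=
  [/\ Ck 1 phi1, Ck 1 phi2,
      forall t : R, t \in `[0, tau] -> phi1 (t, L) + b L * phi2 (t, L) = 0 &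
      forall t : R, t \in `[0, tau] ->
        a 0 * phi2 (t, 0) = m t * alh
        /\ phi1 (t, 0) + b 0 * phi2 (t, 0) = m t * alq].

Definition L2_solution (L : R) (a b c e : R -> R) (alh alq : R)
    (d h0 q0 : R -> R) (h q : R -> R -> R) : Prop :=
  [/\ forall t : R, 0 <= t -> L2_seg L (h t) /\ L2_seg L (q t),
      forall t : R, 0 <= t ->
        L2norm L (fun x => h s x - h t x) (fun x => q s x - q t x)
          @[s --> within `[0, +oo[ (nbhs t)] --> (0 : R),
      {ae mu, forall x : R, x \in `[0, L] -> h 0 x = h0 x /\ q 0 x = q0 x} &
      forall (tau : R) (phi1 phi2 : R * R -> R) (m : R -> R), 0 <= tau ->
        adjoint_test L a b alh alq tau phi1 phi2 m ->
        \int[mu]_(x in `[0, L])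
            (h tau x * phi1 (tau, x) + q tau x * phi2 (tau, x))
        - \int[mu]_(x in `[0, L]) (h0 x * phi1 (0, x) + q0 x * phi2 (0, x))
        = \int[mu]_(t in `[0, tau]) \int[mu]_(x in `[0, L])
            (h t x * (D1 phi1 (t, x) + dseg L (fun y => a y * phi2 (t, y)) x
                      - c x * phi2 (t, x))
             + q t x * (D1 phi2 (t, x) + D2 phi1 (t, x)
                        + dseg L (fun y => b y * phi2 (t, y)) x
                        - e x * phi2 (t, x)))
          + \int[mu]_(t in `[0, tau]) (m t * d t)].

(* Input-to-state stability of the system above; the constants do not depend on
   the disturbance, the initial condition or the solution. *)
Definition L2_ISS (L : R) (a b c e : R -> R) (alh alq : R) : Prop :=
  exists C1 C2 nu : R, [/\ 0 < C1, 0 < C2, 0 < nu &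
    forall (d h0 q0 : R -> R) (h q : R -> R -> R),
      measurable_fun (`[0, +oo[ : set R) d ->
      (exists K : R, forall t : R, 0 <= t -> `|d t| <= K) ->
      L2_seg L h0 -> L2_seg L q0 ->
      L2_solution L a b c e alh alq d h0 q0 h q ->
      forall t : R, 0 <= t ->
        L2norm L (h t) (q t) <=
          C1 * L2norm L h0 q0 * expR (- nu * t)
          + C2 * sup [set `|d s| | s in `[0, +oo[ ]].

End L2Solutions.

(* Main.v *)
(** The quadratic functional V(t) = int_0^L z^T P z dx satisfies V' <= -2 nu V + C d^2 along
    classical solutions: its derivative is the boundary term of the form with matrix M = PA,
    controlled by the two boundary inequalities, minus the integral of the positive definite
    form -M_x + B^T P + P B.

    A weak solution is not regular enough for this computation, but the coefficients do not
    depend on t, so averaging twice in time gives again a solution. Test functions independent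
    of t already suffice to see that int_0^t z is continuous in (t, x) and solves the system
    integrated in x, with the boundary conditions in the classical sense; hence the doubly
    averaged solution is C^1 in t and solves the system pointwise, the derivatives in x being
    given by the equations since a <> 0. Its boundary data are an average of d, so they
    are bounded by sup |d|. The resulting estimate passes to the limit of vanishing averaging
    length by duality with continuous test functions. *)

From HB Require Import structures.
Require Import Defs.
From mathcomp Require Import ring lra measurable_realfun.

Set Implicit Arguments.
Unset Strict Implicit.
Unset Printing Implicit Defensive.

Import Order.TTheory GRing.Theory Num.Theory.
Import numFieldNormedType.Exports.
Local Open Scope classical_set_scope.
Local Open Scope ring_scope.

(** The functions [h] and [q] are not known to be jointly measurable in (t, x), so Fubini is never
    applied to them. Only their pairings with fixed functions and their primitives in x are
    integrated in t; both are continuous, and orders of integration are exchanged for jointly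
    continuous functions alone.

    The boundary form is diagonal in the characteristic variables: the rows of N are left
    eigenvectors of A for lambda_1 and -lambda_2, so M = N^T diag(p1 lambda_1, -p2 lambda_2) N. The
    condition at L makes it nonnegative on vectors with h = 0; the strict condition at 0 leaves room
    to absorb the disturbance by completing a square.

    One primitive in t makes a solution continuous, a second one makes it C^1 in t. Averages look
    forward, over [t, t + 2e], so that only times t >= 0 occur. The initial data enter the twice
    integrated equations linearly in t and are killed by second differences; they come back only
    through the norm of the averaged solution at time 0, which is bounded by testing that solution
    against itself. *)

Section RealDerivatives.
Context {R : realType}.
Implicit Types (f g : R -> R) (x df dg : R).

Lemma drv_eq f x df dg : is_derive x 1 f df -> df = dg -> is_derive x 1 f dg.
Proof. by move=> ? <-. Qed.

Lemma drvD f g x df dg : is_derive x 1 f df -> is_derive x 1 g dg ->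
  is_derive x 1 (fun y => f y + g y) (df + dg).
Proof. by move=> *; exact: (@is_deriveD _ _ _ f g). Qed.

Lemma drvB f g x df dg : is_derive x 1 f df -> is_derive x 1 g dg ->
  is_derive x 1 (fun y => f y - g y) (df - dg).
Proof. by move=> *; exact: (@is_deriveB _ _ _ f g). Qed.

Lemma drvM f g x df dg : is_derive x 1 f df -> is_derive x 1 g dg ->
  is_derive x 1 (fun y => f y * g y) (df * g x + f x * dg).
Proof.
move=> Df Dg; apply: drv_eq (@is_deriveM _ _ f g x 1 df dg Df Dg) _.
suff : f x * dg + g x * df = df * g x + f x * dg by [].
by ring.
Qed.

Lemma drvC k x : is_derive x 1 (fun=> k : R) 0.
Proof. exact: is_derive_cst. Qed.

Lemma drv_id x : is_derive x 1 (fun y : R => y) 1.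
Proof. exact: is_derive_id. Qed.

Lemma drvZ f k x df : is_derive x 1 f df -> is_derive x 1 (fun y => k * f y) (k * df).
Proof. by move=> Df; have := @is_deriveZ _ _ _ f k x 1 df Df. Qed.

Lemma drv_comp f g x df dg : is_derive x 1 f df -> is_derive (f x) 1 g dg ->
  is_derive x 1 (fun y => g (f y)) (dg * df).
Proof.
by move=> Df Dg; have := @is_derive1_comp _ g f x dg df Dg Df.
Qed.

Lemma is_derive1_continuous f (df : R -> R) :
  (forall x, is_derive x 1 f (df x)) -> continuous f.
Proof. by move=> dF x; apply: differentiable_continuous; apply/derivable1_diffP; have [] := dF x. Qed.

End RealDerivatives.

(* The integral from a to b, of opposite sign when b < a; locked so that it is not unfolded
   to a difference of Lebesgue integrals by unification. *)
HB.lock Definition sint {R : realType} (f : R -> R) (a b : R) : R :=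
  \int[@lebesgue_measure R]_(x in `[a, b]) f x - \int[@lebesgue_measure R]_(x in `[b, a]) f x.

(** * Integrals with oriented bounds and the fundamental theorem of calculus *)

Section SignedIntegral.
Context {R : realType}.
Local Notation mu := (@lebesgue_measure R).
Implicit Types (f g : R -> R) (a b c x : R).

Definition locint f := forall a b, mu.-integrable `[a, b] (EFin \o f).

Lemma sint_itv f a b : a <= b -> sint f a b = \int[mu]_(x in `[a, b]) f x.
Proof.
rewrite sint.unlock le_eqVlt => /predU1P[->|ab].
  by rewrite set_itv1 Rintegral_set1 subr0.
by rewrite [X in _ - X](_ : _ = 0) ?subr0// set_itv_ge ?Rintegral_set0// bnd_simp -ltNge.
Qed.

Lemma sintC f a b : sint f a b = - sint f b a.
Proof. by rewrite sint.unlock opprB. Qed.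

Lemma sintxx f a : sint f a a = 0.
Proof. by rewrite sint_itv// set_itv1 Rintegral_set1. Qed.

Lemma sint_base f c a b : locint f -> c <= a -> c <= b ->
  sint f a b = \int[mu]_(x in `[c, b]) f x - \int[mu]_(x in `[c, a]) f x.
Proof.
move=> lf; wlog ab : a b / a <= b => [H|] ca cb.
  have [ab|/ltW ba] := leP a b; first exact: H.
  by rewrite sintC H// opprB.
rewrite (sint_itv _ ab) Rintegral_itvB//.
rewrite Rintegral_itv_obnd_cbnd//; apply: integrableS (lf a b) => //.
by apply: subset_itvr; rewrite bnd_simp.
Qed.

Lemma sint_chasles f a b c : locint f -> sint f a b + sint f b c = sint f a c.
Proof.
move=> lf; set m := Num.min a (Num.min b c).
have ma : m <= a by rewrite /m ge_min lexx.
have mb : m <= b by rewrite /m !ge_min lexx orbT.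
have mc : m <= c by rewrite /m !ge_min lexx !orbT.
by rewrite !(sint_base lf (c := m))//; ring.
Qed.

Lemma sintD f g a b : locint f -> locint g ->
  sint (fun x => f x + g x) a b = sint f a b + sint g a b.
Proof.
by move=> lf lg; rewrite sint.unlock !RintegralD//; try apply: lf; try apply: lg; ring.
Qed.

Lemma sintZ f k a b : locint f -> sint (fun x => k * f x) a b = k * sint f a b.
Proof. by move=> lf; rewrite sint.unlock !RintegralZl//; [ring|exact: lf..]. Qed.

Lemma locintZ f k : locint f -> locint (fun x => k * f x).
Proof. by move=> lf a b; have := integrableZl (mu := mu) _ k (lf a b); apply. Qed.

Lemma locintD f g : locint f -> locint g -> locint (fun x => f x + g x).
Proof.
move=> lf lg a b.
have := integrableD (mu := mu) _ (lf a b) (lg a b).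
by apply.
Qed.

Lemma locintN f : locint f -> locint (fun x => - f x).
Proof.
by move=> /(locintZ (-1)); congr locint; apply/funext => x; rewrite mulN1r.
Qed.

Lemma locintB f g : locint f -> locint g -> locint (fun x => f x - g x).
Proof. by move=> lf /locintN lg; exact: locintD. Qed.

Lemma sintN f a b : locint f -> sint (fun x => - f x) a b = - sint f a b.
Proof.
move=> lf; rewrite -mulN1r -sintZ//; congr sint.
by apply/funext => x; rewrite mulN1r.
Qed.

Lemma sintB f g a b : locint f -> locint g ->
  sint (fun x => f x - g x) a b = sint f a b - sint g a b.
Proof. by move=> lf lg; rewrite sintD ?sintN//; exact: locintN. Qed.

Lemma eq_sint f g a b : a <= b -> (forall x, a <= x <= b -> f x = g x) ->
  sint f a b = sint g a b.
Proof.
move=> ab fg; rewrite !sint_itv//; apply: eq_Rintegral => x.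
by rewrite inE/= in_itv/= => /fg.
Qed.

Lemma continuous_locint f : continuous f -> locint f.
Proof.
move=> cf a b; apply: continuous_compact_integrable; first exact: segment_compact.
exact: continuous_subspaceT.
Qed.

Lemma sint_cst k a b : sint (fun=> k) a b = k * (b - a).
Proof.
wlog ab : a b / a <= b => [H|].
  have [|/ltW ba] := leP a b; first exact: H.
  by rewrite sintC H//; ring.
rewrite sint_itv// Rintegral_cst//; congr (_ * _).
suff E : fine (mu `[a, b]) = b - a by exact: E.
rewrite lebesgue_measure_itv/= lte_fin.
by case: ltgtP ab => // -> _; rewrite subrr.
Qed.

Lemma le_sint f g a b : a <= b -> locint f -> locint g ->
  (forall x, a <= x <= b -> f x <= g x) -> sint f a b <= sint g a b.
Proof.
move=> ab lf lg fg; rewrite !sint_itv//; apply: le_Rintegral => //.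
Qed.

Lemma sint_ge0 f a b : a <= b -> (forall x, a <= x <= b -> 0 <= f x) ->
  0 <= sint f a b.
Proof.
move=> ab f0; rewrite sint_itv//; apply: Rintegral_ge0 => x /=.
by rewrite in_itv/=; exact: f0.
Qed.

Lemma locint_norm f : locint f -> locint (fun x => `|f x|).
Proof. by move=> lf a b; have := integrable_norm (lf a b). Qed.

Lemma sint_norm f a b : a <= b -> locint f ->
  `|sint f a b| <= sint (fun x => `|f x|) a b.
Proof. by move=> ab lf; rewrite !sint_itv//; apply: le_normr_Rintegral => //; exact: lf. Qed.

Lemma sint_norm_le f a b K : a <= b -> locint f ->
  (forall x, a <= x <= b -> `|f x| <= K) -> `|sint f a b| <= K * (b - a).
Proof.
move=> ab lf fK; apply: le_trans (sint_norm ab lf) _.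
rewrite -sint_cst; apply: le_sint => //; first exact: locint_norm.
by apply: continuous_locint => x; exact: cvg_cst.
Qed.

Lemma sint_derive f a x : continuous f -> is_derive x 1 (sint f a) (f x).
Proof.
move=> cf; have lf := continuous_locint cf.
(* A base point strictly to the left of [a] and [x] makes [x] interior to [m, x + 1], where the
   primitive from [m] can be differentiated. *)
set m := Num.min a x - 1.
have mx : m < x by rewrite /m ltrBlDr (le_lt_trans (y := x))// ?ge_min ?lexx ?orbT// ltrDl.
have ma : m < a by rewrite /m ltrBlDr (le_lt_trans (y := a))// ?ge_min ?lexx ?orbT// ltrDl.
pose F y := \int[mu]_(t in `[m, y]) f t.
have [dF F'] : derivable F x 1 /\ derive1 F x = f x.
  apply: (@continuous_FTC1_closed _ f m x (x + 1)) => //; first by rewrite ltrDl.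
  exact: cf.
have DF : is_derive x 1 F (f x) by have := derivableP dF; rewrite -derive1E F'.
have := drv_eq (drvB DF (drvC (F a) x)) (subr0 _).
apply: near_eq_is_derive.
near=> y; rewrite (@sint_base f m)//; first exact: ltW.
by apply/ltW; near: y; exact: lt_nbhsr.
Unshelve. all: by end_near. Qed.

Lemma sint_cont f a : continuous f -> continuous (sint f a).
Proof. by move=> cf; apply: (@is_derive1_continuous _ _ f) => x; exact: sint_derive. Qed.

Lemma sint_FTC2 f F a b : (forall x, is_derive x 1 F (f x)) -> continuous f ->
  sint f a b = F b - F a.
Proof.
move=> dF cf.
have d0 x : is_derive x 1 (fun y => sint f a y - F y) 0.
  by apply: drv_eq (drvB (sint_derive a x cf) (dF x)) _; rewrite subrr.
have := is_derive_0_is_cst b a d0.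
by rewrite sintxx; lra.
Qed.

Lemma sint_locint_cont f a : locint f -> continuous (sint f a).
Proof.
move=> lf x; set m := Num.min a x - 1.
have mx : m < x by rewrite /m ltrBlDr (le_lt_trans (y := x))// ?ge_min ?lexx ?orbT// ltrDl.
have ma : m < a by rewrite /m ltrBlDr (le_lt_trans (y := a))// ?ge_min ?lexx ?orbT// ltrDl.
have mx1 : m <= x + 1 by rewrite ltW// (lt_trans mx)// ltrDl.
have := parameterized_integral_continuous mx1 (lf m (x + 1)).
have xI : x \in `](m : R), x + 1[%R by rewrite in_itv/= mx ltrDl ltr01.
have mx1' : m < x + 1 by rewrite (lt_trans mx)// ltrDl ltr01.
move=> /(continuous_within_itvP _ mx1')[+ _ _] => /(_ x xI) cx.
rewrite /continuous_at [X in _ --> X](sint_base lf (ltW ma) (ltW mx)).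
have : (fun y => parameterized_integral mu m y f - parameterized_integral mu m a f) @ x
   --> parameterized_integral mu m x f - parameterized_integral mu m a f.
  by apply: cvgB => //; exact: cvg_cst.
apply: cvg_trans; apply: near_eq_cvg; near=> y.
rewrite /= (@sint_base f m)//; first exact: ltW.
by apply/ltW; near: y; exact: lt_nbhsr.
Unshelve. all: by end_near. Qed.

End SignedIntegral.

(** * Jointly continuous functions and integrals depending on a parameter *)

Section TwoVariables.
Context {R : realType}.
Local Notation mu := (@lebesgue_measure R).
Implicit Types (G : R -> R -> R) (a b t x : R).

Definition cont2 G := continuous (fun z : R * R => G z.1 z.2).

Lemma cont2_cvg (T : Type) (F : set_system T) (FF : Filter F) G (f g : T -> R) (a b : R) :
  cont2 G -> f x @[x --> F] --> a -> g x @[x --> F] --> b ->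
  G (f x) (g x) @[x --> F] --> G a b.
Proof. by move=> cG; apply: continuous2_cvg; exact: (cG (a, b)). Qed.

Lemma cont2_snd G t : cont2 G -> continuous (G t).
Proof. by move=> cG x; apply: (@cont2_cvg _ _ _ G (fun=> t) id t x cG) => //; exact: cvg_cst. Qed.

Lemma cont2_fst G x : cont2 G -> continuous (G ^~ x).
Proof. by move=> cG t; apply: (@cont2_cvg _ _ _ G id (fun=> x) t x cG) => //; exact: cvg_cst. Qed.

Lemma cont2_swap G : cont2 G -> cont2 (fun x t => G t x).
Proof. by move=> cG z; apply: (@cont2_cvg _ _ _ G snd fst z.2 z.1 cG); [exact: cvg_snd|exact: cvg_fst]. Qed.

Lemma cont2D G G' : cont2 G -> cont2 G' -> cont2 (fun t x => G t x + G' t x).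
Proof. by move=> cG cG' z; apply: cvgD; [exact: cG|exact: cG']. Qed.

Lemma cont2B G G' : cont2 G -> cont2 G' -> cont2 (fun t x => G t x - G' t x).
Proof. by move=> cG cG' z; apply: cvgB; [exact: cG|exact: cG']. Qed.

Lemma cont2M G G' : cont2 G -> cont2 G' -> cont2 (fun t x => G t x * G' t x).
Proof. by move=> cG cG' z; apply: cvgM; [exact: cG|exact: cG']. Qed.

Lemma cont2_of1 (f : R -> R) : continuous f -> cont2 (fun t _ => f t).
Proof.
move=> cf z; apply: (cvg_comp fst f (@cvg_fst _ _ _ _ _)); exact: cf.
Qed.

Lemma cont2_of2 (f : R -> R) : continuous f -> cont2 (fun _ x => f x).
Proof. by move=> /cont2_of1 /cont2_swap. Qed.

Lemma cont2_cst (k : R) : cont2 (fun _ _ => k).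
Proof. by move=> z; exact: cvg_cst. Qed.

Lemma cont2_comp1 G (f : R -> R) : cont2 G -> continuous f -> cont2 (fun t x => G (f t) x).
Proof.
move=> cG cf z; apply: (@cont2_cvg (R * R) (nbhs z) _ G (fun z => f z.1) (fun z => z.2) (f z.1) z.2 cG); last exact: cvg_snd.
exact: (@cont2_of1 f cf z).
Qed.

Lemma cont2_bounded G t1 t2 a b : cont2 G ->
  exists2 C, 0 < C & forall t x, t1 <= t <= t2 -> a <= x <= b -> `|G t x| <= C.
Proof.
move=> cG.
have cK : compact (`[t1, t2] `*` `[a, b] : set (R * R)).
  by apply: compact_setX; exact: segment_compact.
have := @continuous_compact _ _ (fun z : R * R => G z.1 z.2) _ (continuous_subspaceT cG) cK.
move=> /compact_bounded [M [_ HM]].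
exists (`|M| + 1); first by rewrite ltr_wpDl.
move=> t x tI xI; apply: HM.
  by rewrite (le_lt_trans (ler_norm _))// ltrDl.
by exists (t, x) => //=; rewrite !in_itv.
Qed.

Lemma sint_param_cont G a b : cont2 G -> continuous (fun t => sint (G t) a b).
Proof.
move=> cG; wlog ab : a b / a <= b => [H|].
  have [|/ltW ba] := leP a b; first exact: H.
  move=> t; have -> : (fun t => sint (G t) a b) = (fun t => - sint (G t) b a).
    by apply/funext => s; rewrite sintC.
  by apply: cvgN; exact: H.
move=> t; have [C C0 GC] := cont2_bounded (t - 1) (t + 1) a b cG.
have -> : (fun t => sint (G t) a b) = (fun t => \int[mu]_(x in `[a, b]) G t x).
  by apply/funext => s; rewrite sint_itv.
apply: (@continuity_under_integral _ _ _ mu G `[a, b] _ (t - 1) (t + 1) _ _ (fun=> C)) => //.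
- by move=> s _; apply: continuous_locint; exact: cont2_snd.
- by apply: aeW => x _ s _; exact: cont2_fst.
- by apply: continuous_locint => x; exact: cvg_cst.
- move=> s /=; rewrite in_itv/= => /andP[/ltW s1 /ltW s2]; apply: aeW => x /=.
  by rewrite in_itv/= => xI; apply: GC => //; apply/andP.
- by rewrite inE/= in_itv/= ltrBlDr !ltrDl ltr01.
Qed.

Lemma sint_cont2 G a : cont2 G -> cont2 (fun t b => sint (G t) a b).
Proof.
move=> cG [t0 b0]; rewrite /continuous_at.
have [C C0 GC] := cont2_bounded (t0 - 1) (t0 + 1) (b0 - 1) (b0 + 1) cG.
have lG t : locint (G t) by apply: continuous_locint; exact: cont2_snd.
(* Splitting at [b0] separates the variables: the first integral has fixed bounds, and the second is
   at most [C] times the distance from the upper bound to [b0], locally uniformly in t. *)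
rewrite (_ : (fun z => _) = (fun z : R * R => sint (G z.1) a b0 + sint (G z.1) b0 z.2)); last first.
  by apply/funext => z; rewrite sint_chasles.
rewrite -[X in _ --> X]addr0; apply: cvgD.
  exact: (@cont2_of1 (fun t => sint (G t) a b0) (@sint_param_cont G a b0 cG) (t0, b0)).
apply: norm_cvg0.
apply: (@squeeze_cvgr _ _ _ _ (fun=> 0) (fun z : R * R => C * `|z.2 - b0|)).
- near=> z; rewrite normr_ge0/=.
  have z1 : t0 - 1 <= z.1 <= t0 + 1.
    rewrite -ler_distl; near: z.
    have : (fun z : R * R => `|z.1 - t0|) @ (t0, b0) --> (0:R).
      rewrite -[X in _ --> X](normr0 R) -[X in `|X|](subrr t0).
      apply: cvg_norm; apply: cvgB; [exact: cvg_fst|exact: cvg_cst].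
    by move=> /cvgr_le; apply.
  have z2 : `|z.2 - b0| <= 1.
    near: z.
    have : (fun z : R * R => `|z.2 - b0|) @ (t0, b0) --> (0:R).
      rewrite -[X in _ --> X](normr0 R) -[X in `|X|](subrr b0).
      apply: cvg_norm; apply: cvgB; [exact: cvg_snd|exact: cvg_cst].
    by move=> /cvgr_le; apply.
  move: z2; rewrite ler_distl => /andP[z2 z2'].
  have [bz|/ltW zb] := leP b0 z.2.
    rewrite [X in _ <= C * X]ger0_norm ?subr_ge0//; apply: sint_norm_le => // x /andP[x1 x2].
    apply: GC => //; apply/andP; split.
      by rewrite (le_trans _ x1)// gerBl.
    by rewrite (le_trans x2).
  rewrite sintC normrN [X in _ <= C * X]ler0_norm ?subr_le0// opprB.
  apply: sint_norm_le => // x /andP[x1 x2].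
  apply: GC => //; apply/andP; split; first by rewrite (le_trans _ x1).
  by rewrite (le_trans x2)// lerDl.
- exact: cvg_cst.
- rewrite -[X in _ --> X](mulr0 C); apply: cvgM; first exact: cvg_cst.
  rewrite -[X in _ --> X](normr0 R) -[X in `|X|](subrr b0).
  by apply: cvg_norm; apply: cvgB; [exact: cvg_snd|exact: cvg_cst].
Unshelve. all: by end_near. Qed.

Lemma sint_param_derive G (dG : R -> R -> R) a b t : cont2 G -> cont2 dG ->
  (forall t x, is_derive t 1 (G ^~ x) (dG t x)) ->
  is_derive t 1 (fun t => sint (G t) a b) (sint (dG t) a b).
Proof.
move=> cG cdG DG; wlog ab : a b / a <= b => [H|].
  have [|/ltW ba] := leP a b; first exact: H.
  have -> : (fun t => sint (G t) a b) = (fun t => -1 * sint (G t) b a).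
    by apply/funext => s; rewrite sintC mulN1r.
  by apply: drv_eq (drvZ (-1) (H _ _ ba)) _; rewrite mulN1r -sintC.
have [C C0 GC] := cont2_bounded (t - 1) (t + 1) a b cdG.
have E s x : partial1of2 G s x = dG s x.
  by rewrite partial1of2E; have [_] := DG s x.
have tI : `]t - 1, t + 1[%classic t by rewrite /= in_itv/= ltrBlDr !ltrDl ltr01.
have lG s : `]t - 1, t + 1[%classic s -> mu.-integrable `[a, b] (EFin \o G s).
  by move=> _; apply: continuous_locint; exact: cont2_snd.
have dGx s x : `]t - 1, t + 1[%classic s -> `[a, b]%classic x -> derivable (G ^~ x) s 1.
  by move=> _ _; have [] := DG s x.
have iC : mu.-integrable `[a, b] (EFin \o (fun=> C)).
  by apply: continuous_locint => x; exact: cvg_cst.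
have bd s x : `]t - 1, t + 1[%classic s -> `[a, b]%classic x -> `|partial1of2 G s x| <= C.
  rewrite /= !in_itv/= => /andP[/ltW s1 /ltW s2] xI; rewrite E; apply: GC => //.
  by rewrite s1 s2.
have mI : measurable (`[a, b] : set (measurableTypeR R)) by exact: measurable_itv.
have -> : (fun t => sint (G t) a b) = (fun t => \int[mu]_(x in `[a, b]) G t x).
  by apply/funext => s; rewrite sint_itv.
apply: DeriveDef.
  by apply: (@derivable_under_integral _ _ _ mu G `[a, b] mI t (t - 1) (t + 1) tI lG dGx (fun=> C)) => // *; exact: ltW.
rewrite -derive1E.
rewrite (@differentiation_under_integral _ _ _ mu G `[a, b] mI t (t - 1) (t + 1) tI lG dGx (fun=> C)) //; last first.
  by move=> *; exact: ltW.
by rewrite sint_itv//; apply: eq_Rintegral => x _; rewrite E.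
Qed.

(** As functions of the bound [b], both sides have the same derivative and vanish at b = a, so no
    product measure is involved. *)
Lemma sint_fubini G a b c d : cont2 G ->
  sint (fun t => sint (G t) c d) a b = sint (fun x => sint (G ^~ x) a b) c d.
Proof.
move=> cG.
pose F1 s := sint (fun t => sint (G t) c d) a s.
pose F2 s := sint (fun x => sint (G ^~ x) a s) c d.
have D1 (s : R) : is_derive s 1 F1 (sint (G s) c d).
  by apply: (@sint_derive _ (fun t => sint (G t) c d)); exact: sint_param_cont.
have D2 (s : R) : is_derive s 1 F2 (sint (G s) c d).
  apply: (@sint_param_derive (fun s x => sint (G ^~ x) a s) G).
  - by apply: cont2_swap; apply: sint_cont2; exact: cont2_swap.
  - exact: cG.
  - by move=> r x; apply: (@sint_derive _ (G ^~ x)); exact: cont2_fst.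
have d0 (s : R) : is_derive s 1 (fun s => F1 s - F2 s) 0.
  by apply: drv_eq (drvB (D1 s) (D2 s)) _; rewrite subrr.
have := is_derive_0_is_cst b a d0.
have F2a : F2 a = 0.
  rewrite /F2 (_ : (fun x => _) = fun=> 0) ?sint_cst ?mul0r//.
  by apply/funext => x; rewrite sintxx.
have F1a : F1 a = 0 by rewrite /F1 sintxx.
rewrite F2a F1a subrr => E.
by apply/eqP; rewrite -subr_eq0; apply/eqP.
Qed.

End TwoVariables.

(** * Square integrable functions: density, integration by parts, duality *)

Section SquareIntegrable.
Context {R : realType}.
Local Notation mu := (@lebesgue_measure R).
Implicit Types (u v f g : R -> R) (a b x : R).

(** Functions on [0, L] enter this class after extension by zero, which makes measurability on all
    of R available. *)
Definition L2loc u := measurable_fun setT u /\ locint (fun x => u x ^+ 2).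

Lemma locint_le f g : measurable_fun setT f -> locint g ->
  (forall x, `|f x| <= g x) -> locint f.
Proof.
move=> mf lg fg a b; apply: (le_integrable _ _ _ (lg a b)) => //.
  by apply/measurable_EFinP; apply: measurable_funS mf.
move=> x _ /=; rewrite lee_fin (le_trans (fg x))//.
exact: ler_norm.
Qed.

Lemma locint_cst (k : R) : locint (fun=> k).
Proof. by apply: continuous_locint => x; exact: cvg_cst. Qed.

Lemma L2loc_sqr u : L2loc u -> locint (fun x => u x ^+ 2). Proof. by case. Qed.

Lemma L2loc_mul u v : L2loc u -> L2loc v -> locint (fun x => u x * v x).
Proof.
move=> [mu_ u2] [mv v2].
apply: (@locint_le _ (fun x => u x ^+ 2 + v x ^+ 2)).
- exact: measurable_funM.
- exact: locintD.
- move=> x; rewrite normrM -(real_normK (num_real (u x))) -(real_normK (num_real (v x))).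
  by have := sqr_ge0 (`|u x| - `|v x|); have := sqr_ge0 (`|u x| + `|v x|); nra.
Qed.

Lemma continuous_L2loc f : continuous f -> L2loc f.
Proof.
move=> cf; split; first exact: continuous_measurable_fun.
by apply: continuous_locint => x; apply: cvgM; exact: cf.
Qed.

Lemma L2loc_locint u : L2loc u -> locint u.
Proof.
move=> lu; have l1 : L2loc (fun=> 1 : R).
  by apply: continuous_L2loc => x; exact: cvg_cst.
have := L2loc_mul lu l1; congr locint.
by apply/funext => x; rewrite mulr1.
Qed.

Lemma L2locD u v : L2loc u -> L2loc v -> L2loc (fun x => u x + v x).
Proof.
move=> lu lv; split; first by apply: measurable_funD; [case: lu|case: lv].
have luv := L2loc_mul lu lv.
have := locintD (locintD (L2loc_sqr lu) (L2loc_sqr lv)) (locintZ 2 luv).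
by congr locint; apply/funext => x; ring.
Qed.

Lemma L2loc_cmul u f : L2loc u -> continuous f -> L2loc (fun x => f x * u x).
Proof.
move=> lu cf.
have mfu : measurable_fun setT (fun x => f x * u x).
  by apply: measurable_funM; [exact: continuous_measurable_fun|case: lu].
split => // a b.
have [C C0 fC] := cont2_bounded 0 0 a b (@cont2_of2 _ f cf).
apply: (le_integrable _ _ _ (locintZ (C ^+ 2) (L2loc_sqr lu) a b)) => //.
  by apply/measurable_EFinP; apply: measurable_funS (measurable_funX 2 mfu).
move=> x /=; rewrite in_itv/= => xab; rewrite lee_fin [leRHS]ger0_norm; last first.
  by rewrite mulr_ge0// sqr_ge0.
rewrite exprMn normrM !ger0_norm ?sqr_ge0//.
apply: ler_wpM2r; first exact: sqr_ge0.
rewrite -(real_normK (num_real (f x))) lerXn2r ?nnegrE ?(ltW C0)//.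
by apply: (fC 0 x) => //; rewrite lexx.
Qed.

Lemma L2locZ k u : L2loc u -> L2loc (fun x => k * u x).
Proof.
by move=> lu; apply: (@L2loc_cmul u (fun=> k)) => // x; exact: cvg_cst.
Qed.

Lemma L2locB u v : L2loc u -> L2loc v -> L2loc (fun x => u x - v x).
Proof.
move=> lu /(L2locZ (-1)) lv; have := L2locD lu lv; congr L2loc.
by apply/funext => x; rewrite mulN1r.
Qed.

Lemma cauchy_schwarz u v a b : a <= b -> L2loc u -> L2loc v ->
  sint (fun x => u x * v x) a b ^+ 2 <=
  sint (fun x => u x ^+ 2) a b * sint (fun x => v x ^+ 2) a b.
Proof.
move=> ab lu lv.
set A := sint _ a b; set B := sint _ a b; set C := sint _ a b.
have luv := L2loc_mul lu lv; have lu2 := L2loc_sqr lu; have lv2 := L2loc_sqr lv.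
(* The integral of (k u + l v)^2 is a nonnegative quadratic form in (k, l), and the claim is its
   discriminant condition. *)
have H k l : 0 <= k ^+ 2 * B + 2 * k * l * A + l ^+ 2 * C.
  have : 0 <= sint (fun x => (k * u x + l * v x) ^+ 2) a b.
    by apply: sint_ge0 => // x _; exact: sqr_ge0.
  rewrite (_ : (fun x => _) = (fun x => k ^+ 2 * (u x ^+ 2) + 2 * k * l * (u x * v x)
     + l ^+ 2 * (v x ^+ 2))); last by apply/funext => x; ring.
  have l1 := locintZ (k ^+ 2) lu2; have l2 := locintZ (2 * k * l) luv.
  have l3 := locintZ (l ^+ 2) lv2.
  by rewrite sintD ?sintD ?sintZ//; exact: locintD.
have B0 : 0 <= B by apply: sint_ge0 => // x _; exact: sqr_ge0.
have [B_eq0|B_neq0] := eqVneq B 0.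
  have C0 : 0 <= C by apply: sint_ge0 => // x _; exact: sqr_ge0.
  (* When B = 0 the form takes the value -(C + 2) A^2 at (-(C + 1), A), which forces A = 0. *)
  have := H (- (C + 1)) A; rewrite B_eq0; nra.
have Bp : 0 < B by rewrite lt_def B_neq0.
have := H (- A) B.
have -> : (- A) ^+ 2 * B + 2 * - A * B * A + B ^+ 2 * C = B * (B * C - A ^+ 2) by ring.
by rewrite pmulr_rge0// subr_ge0.
Qed.

Lemma sint_sqr_ge0 u a b : a <= b -> 0 <= sint (fun x => u x ^+ 2) a b.
Proof. by move=> ab; apply: sint_ge0 => // x _; exact: sqr_ge0. Qed.

Lemma cauchy_schwarz_sqrt u v a b : a <= b -> L2loc u -> L2loc v ->
  `|sint (fun x => u x * v x) a b| <=
  Num.sqrt (sint (fun x => u x ^+ 2) a b) * Num.sqrt (sint (fun x => v x ^+ 2) a b).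
Proof.
move=> ab lu lv; rewrite -sqrtrM ?sint_sqr_ge0// -sqrtr_sqr ler_wsqrtr//.
exact: cauchy_schwarz.
Qed.

Let clamp (M x : R) := Num.max (- M) (Num.min x M).

Let clamp_cont M : continuous (clamp M).
Proof.
have c1 : continuous ((@id R^o) \min (fun=> M)).
  by move=> x; apply: continuous_min => //; exact: cvg_cst.
have c2 : continuous ((fun=> - M : R^o) \max ((@id R^o) \min (fun=> M))).
  by move=> x; apply: continuous_max; [exact: cvg_cst|exact: c1].
exact: c2.
Qed.

Let clamp_le (M x : R) : 0 <= M -> `|clamp M x| <= M.
Proof. by move=> M0; rewrite /clamp ler_norml /Num.max /Num.min; do 2 case: ifPn; rewrite -?leNgt; lra. Qed.

Let clamp_dist (M x : R) : 0 <= M -> `|x - clamp M x| <= `|x|.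
Proof.
by move=> M0; rewrite /clamp ler_norml /Num.max /Num.min; do 2 case: ifPn; rewrite -?leNgt => ? ?;
 apply/andP; split; have [] := ger0P x; lra.
Qed.

Let clamp_id (M x : R) : `|x| <= M -> clamp M x = x.
Proof.
by rewrite ler_norml => /andP[? ?]; rewrite /clamp /Num.max /Num.min; do 2 case: ifPn; rewrite -?leNgt; lra.
Qed.

Let clamp_lip (M x y : R) : 0 <= M -> `|clamp M x - clamp M y| <= `|x - y|.
Proof.
by move=> M0; rewrite /clamp ler_norml /Num.max /Num.min; do 4 case: ifPn; rewrite -?leNgt => *;
 apply/andP; split; have [] := ger0P (x - y); lra.
Qed.

Let L2loc_clamp u M : L2loc u -> 0 <= M -> L2loc (fun x => clamp M (u x)).
Proof.
move=> lu M0.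
have mc : measurable_fun setT (fun x => clamp M (u x)).
  apply: (@measurableT_comp _ _ _ _ _ _ (clamp M)); last by case: lu.
  by apply: continuous_measurable_fun; exact: clamp_cont.
split => //; apply: (@locint_le _ (fun=> M ^+ 2)).
- exact: measurable_funX.
- exact: locint_cst.
- move=> x; rewrite ger0_norm ?sqr_ge0// -(real_normK (num_real (clamp M _))).
  by rewrite lerXn2r ?nnegrE// clamp_le.
Qed.

Let truncation_cvg u a b : a <= b -> L2loc u ->
  sint (fun x => (u x - clamp n%:R (u x)) ^+ 2) a b @[n --> \oo] --> (0 : R).
Proof.
move=> ab lu.
have lc n : L2loc (fun x => u x - clamp n%:R (u x)) by apply: L2locB => //; exact: L2loc_clamp.
pose f n x := ((u x - clamp n%:R (u x)) ^+ 2)%:E.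
have mf n : measurable_fun `[a, b] (f n) := measurable_int mu (L2loc_sqr (lc n) a b).
have f0 : {ae mu, forall x, `[a, b]%classic x -> f n x @[n --> \oo] --> 0%E}.
  apply: aeW => x _; apply: cvg_near_cst.
  near=> n; rewrite /f clamp_id ?subrr ?expr0n//.
  by near: n; exact: nbhs_infty_ger.
have fu : {ae mu, forall x, forall n : nat, `[a, b]%classic x -> (`|f n x| <= (u x ^+ 2)%:E)%E}.
  apply: aeW => x n _; rewrite /f lee_fin ger0_norm ?sqr_ge0//.
  rewrite -(real_normK (num_real (u x - _))) -[leRHS](real_normK (num_real (u x))).
  by rewrite lerXn2r ?nnegrE// clamp_dist.
have mI : measurable (`[a, b] : set (measurableTypeR R)) by exact: measurable_itv.
have [_ _] := @dominated_convergence _ _ _ mu `[a, b] mI f (cst 0%E) (fun x => (u x ^+ 2)%:E)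
  mf (measurable_cst _) f0 (L2loc_sqr lu a b) fu.
rewrite integral0 => /fine_cvg; apply: cvg_trans; apply: near_eq_cvg.
by near=> n; rewrite sint_itv.
Unshelve. all: by end_near. Qed.

(** Between functions with values in [-M, M], approximation in L^1 gives approximation in L^2, since
    the square of their difference is at most 2 M times its modulus. So [u] is truncated first, its
    truncation is approximated in L^1 by a continuous function, and that function is truncated
    too. *)
Lemma L2_density u a b e : a <= b -> L2loc u -> 0 < e ->
  exists2 psi : R -> R, continuous psi & sint (fun x => (u x - psi x) ^+ 2) a b <= e.
Proof.
move=> ab lu e0.
have e4 : 0 < e / 4 by rewrite divr_gt0.
have [N HN] : exists N : nat, sint (fun x => (u x - clamp N%:R (u x)) ^+ 2) a b <= e / 4.
  have /cvgr_le /(_ _ e4) := truncation_cvg ab lu.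
  by move=> [N _ HN]; exists N; apply: HN => /=.
set M : R := N%:R in HN; have M0 : 0 <= M by rewrite ler0n.
have lc : L2loc (fun x => clamp M (u x)) by exact: L2loc_clamp.
have mI : measurable (`[a, b] : set (measurableTypeR R)) by exact: measurable_itv.
have fI : (lebesgue_measure (`[a, b] : set R) < +oo)%E.
  by rewrite lebesgue_measure_itv/=; case: ifPn => // _; rewrite ltry.
have [g [cg ig]] := approximation_continuous_integrable mI fI (L2loc_locint lc a b).
move=> /fine_cvg /cvgr_le.
(* With (p + q)^2 <= 2 p^2 + 2 q^2, truncation costs 2 (e / 4) and the L^1 part costs 4 M d <= e /
   2. *)
pose d := e / (4 * (2 * M + 1)).
have d0 : 0 < d by rewrite divr_gt0// mulr_gt0// ltr_wpDl// mulr_ge0.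
move=> /(_ _ d0) [n _ /(_ n (leqnn n)) Hn].
have {}Hn : sint (fun x => `|clamp M (u x) - g n x|) a b <= d by rewrite sint_itv.
exists (fun x => clamp M (g n x)).
  by move=> x; apply: (cvg_comp (g n) (clamp M) (cg n x)); exact: clamp_cont.
have lg : L2loc (fun x => clamp M (g n x)).
  by apply: L2loc_clamp => //; exact: continuous_L2loc.
have l1 : locint (fun x => (u x - clamp M (u x)) ^+ 2) by apply: L2loc_sqr; exact: L2locB.
have l2 : locint (fun x => `|clamp M (u x) - g n x|).
  apply: locint_norm; apply: locintB; first exact: L2loc_locint.
  exact: continuous_locint.
have l3 := locintD (locintZ 2 l1) (locintZ (4 * M) l2).
have : sint (fun x => (u x - clamp M (g n x)) ^+ 2) a b <=
  sint (fun x => 2 * (u x - clamp M (u x)) ^+ 2 + 4 * M * `|clamp M (u x) - g n x|) a b.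
  apply: le_sint => //; first by apply: L2loc_sqr; exact: L2locB.
  move=> x _; set p := u x - clamp M (u x); set q := clamp M (u x) - clamp M (g n x).
  have -> : u x - clamp M (g n x) = p + q by rewrite /p /q; ring.
  have qM : `|q| <= 2 * M.
    by rewrite /q (le_trans (ler_normB _ _))// mulrDl mul1r lerD// clamp_le.
  have qg : `|q| <= `|clamp M (u x) - g n x|.
    by rewrite /q -{1}(@clamp_id M (clamp M (u x))) ?clamp_le// clamp_lip.
  have := sqr_ge0 (p - q); have := real_normK (num_real q); have := normr_ge0 q.
  by move: qM qg; nra.
rewrite sintD; [|exact: locintZ..]; rewrite !sintZ//.
move=> /le_trans; apply.
have : 4 * M * d <= e / 2.
  rewrite /d mulrA ler_pdivrMr; last by rewrite mulr_gt0// ltr_wpDl// mulr_ge0.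
  by nra.
have := ler_wpM2l (mulr_ge0 (ler0n _ 4) M0) Hn.
by lra.
Qed.

(** The defect [E] of the formula is linear in [u], vanishes on continuous functions by the
    fundamental theorem, and is bounded by a constant times the L^2 norm of [u]; density of
    continuous functions concludes. *)
Lemma ibp u (phi dphi : R -> R) b : 0 <= b -> L2loc u ->
  (forall x, is_derive x 1 phi (dphi x)) -> continuous dphi ->
  sint (fun x => u x * phi x) 0 b =
  sint u 0 b * phi b - sint (fun x => sint u 0 x * dphi x) 0 b.
Proof.
move=> b0 lu Dphi cd.
have cp : continuous phi := is_derive1_continuous Dphi.
pose E f := sint (fun x => f x * phi x) 0 b - (sint f 0 b * phi b - sint (fun x => sint f 0 x * dphi x) 0 b).
have cFd f : L2loc f -> continuous (fun x => sint f 0 x * dphi x).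
  by move=> lf x; apply: cvgM; [apply: sint_locint_cont; exact: L2loc_locint|exact: cd].
have Ec f : continuous f -> E f = 0.
  move=> cf; have lf := continuous_L2loc cf.
  have D x : is_derive x 1 (fun x => sint f 0 x * phi x) (f x * phi x + sint f 0 x * dphi x).
    by apply: drvM (Dphi x); exact: sint_derive.
  have cfp : continuous (fun x => f x * phi x) by move=> x; apply: cvgM; [exact: cf|exact: cp].
  have cD : continuous (fun x => f x * phi x + sint f 0 x * dphi x).
    by move=> x; apply: cvgD; [exact: cfp|exact: cFd].
  have := sint_FTC2 0 b D cD; rewrite sintxx mul0r subr0 sintD.
  - by rewrite /E => <-; ring.
  - exact: continuous_locint.
  - by apply: continuous_locint; exact: cFd.
have EB f g : L2loc f -> L2loc g -> E (fun x => f x - g x) = E f - E g.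
  move=> lf lg; rewrite /E.
  have -> : (fun x => (f x - g x) * phi x) = (fun x => f x * phi x - g x * phi x).
    by apply/funext => x; ring.
  have -> : (fun x => sint (fun x => f x - g x) 0 x * dphi x) =
            (fun x => sint f 0 x * dphi x - sint g 0 x * dphi x).
    by apply/funext => x; rewrite sintB; [ring|exact: L2loc_locint..].
  have lp := continuous_L2loc cp.
  have lf1 := L2loc_locint lf; have lg1 := L2loc_locint lg.
  rewrite (sintB 0 b (L2loc_mul lf lp) (L2loc_mul lg lp)) (sintB 0 b lf1 lg1) sintB; [ring|..].
  - by apply: continuous_locint; exact: cFd.
  - by apply: continuous_locint; exact: cFd.
have [C C0 HC] : exists2 C, 0 <= C & forall x, 0 <= x <= b -> `|phi x| <= C /\ `|dphi x| <= C.
  have [C1 C10 H1] := cont2_bounded 0 0 0 b (@cont2_of2 _ phi cp).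
  have [C2 C20 H2] := cont2_bounded 0 0 0 b (@cont2_of2 _ dphi cd).
  exists (C1 + C2); first by rewrite addr_ge0// ltW.
  move=> x xb; have := H1 0 x; have := H2 0 x; rewrite lexx => /(_ isT xb) h2 /(_ isT xb) h1.
  by split; lra.
have Ebd f : L2loc f -> `|E f| <= C * (1 + b) * (2 + b) * Num.sqrt (sint (fun x => f x ^+ 2) 0 b).
  move=> lf; set s := Num.sqrt _; have s0 : 0 <= s by exact: sqrtr_ge0.
  have sb : Num.sqrt b <= 1 + b.
    by rewrite -(ler_sqr) ?nnegrE ?sqrtr_ge0 ?addr_ge0// sqr_sqrtr//; nra.
  have l1 : L2loc (fun=> 1 : R) by apply: continuous_L2loc => x; exact: cvg_cst.
  have F x : 0 <= x <= b -> `|sint f 0 x| <= s * (1 + b).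
    move=> /andP[x0 xb].
    have := cauchy_schwarz_sqrt x0 lf l1.
    rewrite (_ : (fun x => f x * 1) = f); last by apply/funext => y; rewrite mulr1.
    rewrite (_ : (fun x => 1 ^+ 2) = fun=> 1); last by apply/funext => y; rewrite expr1n.
    rewrite sint_cst mul1r subr0 => /le_trans; apply.
    apply: ler_pM; rewrite ?sqrtr_ge0//.
      apply: ler_wsqrtr; rewrite -(sint_chasles 0 x b (L2loc_sqr lf)) lerDl.
      exact: sint_sqr_ge0.
    by rewrite (le_trans _ sb)// ler_wsqrtr.
  have t1 : `|sint (fun x => f x * phi x) 0 b| <= s * (C * (1 + b)).
    have lp := continuous_L2loc cp.
    apply: le_trans (cauchy_schwarz_sqrt b0 lf lp) _; rewrite -/s ler_wpM2l//.
    rewrite -(ler_sqr) ?nnegrE ?sqrtr_ge0 ?mulr_ge0 ?addr_ge0// sqr_sqrtr ?sint_sqr_ge0//.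
    apply: (@le_trans _ _ (C ^+ 2 * b)); last by nra.
    rewrite -[X in _ * X]subr0 -sint_cst; apply: le_sint => //.
    - exact: L2loc_sqr.
    - exact: locint_cst.
    - move=> x /HC [+ _]; rewrite -(real_normK (num_real (phi x))) => h.
      by rewrite lerXn2r ?nnegrE.
  have bb : 0 <= b <= b by rewrite b0 lexx.
  have t2 : `|sint f 0 b * phi b| <= s * (1 + b) * C.
    by rewrite normrM ler_pM//; [exact: F|have [] := HC b bb].
  have t3 : `|sint (fun x => sint f 0 x * dphi x) 0 b| <= s * (1 + b) * C * b.
    rewrite -[X in _ * X]subr0; apply: sint_norm_le => //.
      by apply: continuous_locint; exact: cFd.
    by move=> x xb; rewrite normrM ler_pM//; [exact: F|have [] := HC x xb].
  rewrite /E (le_trans (ler_normB _ _))//.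
  have := ler_normB (sint f 0 b * phi b) (sint (fun x => sint f 0 x * dphi x) 0 b).
  by move: t1 t2 t3; nra.
suff : E u = 0 by rewrite /E; lra.
apply/eqP; rewrite -normr_le0; apply/ler_addgt0Pl => e e0; rewrite addr0.
set K := C * (1 + b) * (2 + b) + 1.
have K0 : 0 < K by rewrite ltr_wpDl// !mulr_ge0// addr_ge0.
have eK : 0 < (e / K) ^+ 2 by rewrite exprn_gt0// divr_gt0.
have [psi cpsi psiP] := L2_density b0 lu eK.
have lpsi := continuous_L2loc cpsi.
have : E u = E (fun x => u x - psi x) by rewrite EB// (Ec psi)// subr0.
move=> ->; apply: le_trans (Ebd _ (L2locB lu lpsi)) _.
have : Num.sqrt (sint (fun x => (u x - psi x) ^+ 2) 0 b) <= e / K.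
  by rewrite -(ger0_norm (ltW (divr_gt0 e0 K0))) -sqrtr_sqr ler_wsqrtr.
move=> h; apply: (@le_trans _ _ (K * (e / K))); last by rewrite mulrC divfK// gt_eqF.
by apply: ler_pM => //; rewrite ?sqrtr_ge0// ?mulr_ge0 ?addr_ge0// /K lerDl.
Qed.

(** Testing with (u, v) itself would give N^2 <= K N for its norm [N] at once. Only continuous test
    functions are allowed, so (u, v) is replaced by a continuous pair at distance [d] in each
    component, and the errors are sent to 0. *)
Lemma L2_dual_bound u v b K : 0 <= b -> L2loc u -> L2loc v -> 0 <= K ->
  (forall psi chi, continuous psi -> continuous chi ->
    `|sint (fun x => u x * psi x) 0 b + sint (fun x => v x * chi x) 0 b| <=
    K * Num.sqrt (sint (fun x => psi x ^+ 2) 0 b + sint (fun x => chi x ^+ 2) 0 b)) ->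
  Num.sqrt (sint (fun x => u x ^+ 2) 0 b + sint (fun x => v x ^+ 2) 0 b) <= K.
Proof.
move=> b0 lu lv K0 H; set N2 := _ + _.
have U0 := sint_sqr_ge0 u b0; have V0 := sint_sqr_ge0 v b0.
have N0 : 0 <= N2 by exact: addr_ge0.
set N := Num.sqrt N2; have Nge0 : 0 <= N by exact: sqrtr_ge0.
have NN : N ^+ 2 = N2 by exact: sqr_sqrtr.
suff HN : N * (N - K) <= 0.
  rewrite leNgt; apply/negP => KN.
  have : 0 < N * (N - K) by rewrite mulr_gt0 ?subr_gt0// (le_lt_trans K0).
  by rewrite ltNge HN.
apply/ler_addgt0Pl => e e0; rewrite addr0.
(* The norm [S] of the approximation satisfies S <= N + 4 d, hence N^2 <= K S + 2 N d <= K N + (4 K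
   + 2 N) d, and the last term is at most [e]. *)
pose d := e / (4 * K + 2 * N + 1).
have den0 : 0 < 4 * K + 2 * N + 1 by rewrite ltr_wpDl// addr_ge0// mulr_ge0.
have d0 : 0 < d by exact: divr_gt0.
have dE : d * (4 * K + 2 * N + 1) = e by rewrite /d divfK// gt_eqF.
have d20 : 0 < d ^+ 2 by exact: exprn_gt0.
have [psi cpsi Hpsi] := L2_density b0 lu d20.
have [chi cchi Hchi] := L2_density b0 lv d20.
have lpsi := continuous_L2loc cpsi; have lchi := continuous_L2loc cchi.
have sd (w : R -> R) : sint (fun x => w x ^+ 2) 0 b <= d ^+ 2 ->
    Num.sqrt (sint (fun x => w x ^+ 2) 0 b) <= d.
  by move=> h; rewrite -[leRHS](ger0_norm (ltW d0)) -sqrtr_sqr ler_wsqrtr.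
have lup := L2locB lu lpsi; have lvp := L2locB lv lchi.
have split w p : L2loc w -> L2loc p ->
    sint (fun x => w x ^+ 2) 0 b =
    sint (fun x => w x * p x) 0 b + sint (fun x => w x * (w x - p x)) 0 b.
  move=> lw lp; rewrite -sintD; last 2 first.
  - exact: L2loc_mul.
  - by apply: L2loc_mul => //; exact: L2locB.
  by congr sint; apply/funext => x; ring.
have split' w p : L2loc w -> L2loc p ->
    sint (fun x => p x ^+ 2) 0 b = sint (fun x => w x ^+ 2) 0 b
    - 2 * sint (fun x => p x * (w x - p x)) 0 b - sint (fun x => (w x - p x) ^+ 2) 0 b.
  move=> lw lp.
  have l1 := L2loc_sqr lw; have l2 := L2loc_mul lp (L2locB lw lp).
  have l3 := L2loc_sqr (L2locB lw lp).
  rewrite -sintZ// -!sintB//; last 2 first.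
  - by apply: locintB => //; exact: locintZ.
  - exact: locintZ.
  by congr sint; apply/funext => x; ring.
set S2 := sint (fun x => psi x ^+ 2) 0 b + sint (fun x => chi x ^+ 2) 0 b.
have S20 : 0 <= S2 by rewrite addr_ge0// sint_sqr_ge0.
set S := Num.sqrt S2; have S0 : 0 <= S by exact: sqrtr_ge0.
have SS : S ^+ 2 = S2 by exact: sqr_sqrtr.
have part (X Y : R) : 0 <= X -> 0 <= Y -> Num.sqrt X <= Num.sqrt (X + Y).
  by move=> X0 Y0; rewrite ler_wsqrtr// lerDl.
have pu : Num.sqrt (sint (fun x => u x ^+ 2) 0 b) <= N by exact: part.
have pv : Num.sqrt (sint (fun x => v x ^+ 2) 0 b) <= N by rewrite /N /N2 addrC; exact: part.
have pp : Num.sqrt (sint (fun x => psi x ^+ 2) 0 b) <= S by apply: part; exact: sint_sqr_ge0.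
have pc : Num.sqrt (sint (fun x => chi x ^+ 2) 0 b) <= S.
  by rewrite /S /S2 addrC; apply: part; exact: sint_sqr_ge0.
have cs (w r : R -> R) (T : R) : L2loc w -> L2loc r -> Num.sqrt (sint (fun x => w x ^+ 2) 0 b) <= T ->
    sint (fun x => r x ^+ 2) 0 b <= d ^+ 2 -> `|sint (fun x => w x * r x) 0 b| <= T * d.
  move=> lw lr wT rd; apply: le_trans (cauchy_schwarz_sqrt b0 lw lr) _.
  by apply: ler_pM; rewrite ?sqrtr_ge0// sd.
have h1 := cs _ _ _ lu lup pu Hpsi; have h2 := cs _ _ _ lv lvp pv Hchi.
have h3 := cs _ _ _ lpsi lup pp Hpsi; have h4 := cs _ _ _ lchi lvp pc Hchi.
have := H _ _ cpsi cchi; rewrite -/S2 -/S => h0.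
have e1 := split _ _ lu lpsi; have e2 := split _ _ lv lchi.
have e3 := split' _ _ lu lpsi; have e4 := split' _ _ lv lchi.
have p1 := sint_sqr_ge0 (fun x => u x - psi x) b0.
have p2 := sint_sqr_ge0 (fun x => v x - chi x) b0.
have hS : S ^+ 2 <= N ^+ 2 + 4 * d * S.
  move: h3 h4; rewrite !ler_norml => /andP[h3 _] /andP[h4 _].
  by rewrite SS NN /S2 /N2; lra.
have hN : N ^+ 2 <= K * S + 2 * N * d.
  move: h0 h1 h2; rewrite !ler_norml => /andP[_ h0] /andP[_ h1] /andP[_ h2].
  by rewrite NN /N2 e1 e2; lra.
have SN : S <= N + 4 * d.
  rewrite leNgt; apply/negP => lS.
  have : 0 <= (S - (N + 4 * d)) * S by rewrite mulr_ge0// subr_ge0 ltW.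
  have : 0 < (S - (N + 4 * d)) * (N + 4 * d).
    by rewrite mulr_gt0 ?subr_gt0// ltr_wpDl// mulr_gt0.
  have : 0 <= N * d by rewrite mulr_ge0// ltW.
  by move: hS; nra.
have : K * S <= K * (N + 4 * d) by exact: ler_wpM2l.
by move: hN dE; nra.
Qed.

Lemma sint_sqr_eq0 f b : 0 < b -> continuous f -> sint (fun x => f x ^+ 2) 0 b = 0 ->
  forall x, 0 <= x <= b -> f x = 0.
Proof.
move=> b0 cf f0 x /andP[x0 xb]; apply/eqP/negPn/negP => fx.
have cf2 : continuous (fun x => f x ^+ 2) by move=> y; apply: cvgM; exact: cf.
have lf := continuous_locint cf2.
set c := f x ^+ 2; have c0 : 0 < c by rewrite lt_def sqrf_eq0 fx sqr_ge0.
have [d /= d0 Hd] : \forall y \near x, c / 2 < f y ^+ 2.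
  by apply: cvgr_gt (cf2 x) _ _; rewrite -/c ltr_pdivrMr// ltr_pMr// ltr1n.
set p := Num.max 0 (x - d / 2); set q := Num.min b (x + d / 2).
have p0 : 0 <= p by rewrite /p le_max lexx.
have qb : q <= b by rewrite /q ge_min lexx.
have pq : p < q by rewrite /p /q gt_max !lt_min; lra.
have pqd y : p <= y <= q -> c / 2 <= f y ^+ 2.
  rewrite /p /q ge_max le_min => /andP[/andP[_ py] /andP[_ yq]].
  by apply/ltW; apply: Hd; rewrite /= ltr_norml; lra.
have : c / 2 * (q - p) <= sint (fun x => f x ^+ 2) p q.
  rewrite -sint_cst; apply: le_sint => //; first exact: ltW.
  exact: locint_cst.
have : 0 < c / 2 * (q - p) by rewrite mulr_gt0 ?divr_gt0// subr_gt0.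
have := sint_sqr_ge0 f p0; have := sint_sqr_ge0 f qb.
have := sint_chasles 0 p q lf; have := sint_chasles 0 q b lf.
by rewrite f0; lra.
Qed.

End SquareIntegrable.

(** * Continuous curves in L^2 and their primitives in x and t *)

Section L2Families.
Context {R : realType} (L : R) (L0 : 0 < L).
Implicit Types (u v f g th phi psi : R -> R) (U : R -> R -> R) (a b x t : R).

Let L0' : 0 <= L := ltW L0.

Definition ip u v := sint (fun x => u x * v x) 0 L.
Definition nsq u := sint (fun x => u x ^+ 2) 0 L.

(** Curves are indexed by the whole line, which avoids one-sided continuity at t = 0; a solution is
    extended to negative times by its value at time 0. *)
Definition L2curve U := (forall t, L2loc (U t)) /\
  (forall t, nsq (fun x => U s x - U t x) @[s --> t] --> (0 : R)).

(* Coefficients on [0, L] are extended to R by composition with clip. *)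
Definition clip x := Num.max 0 (Num.min x L).

Lemma clip_cont : continuous clip.
Proof.
have c1 : continuous ((@id R^o) \min (fun=> L)).
  by move=> x; apply: continuous_min => //; exact: cvg_cst.
have c2 : continuous ((fun=> 0 : R^o) \max ((@id R^o) \min (fun=> L))).
  by move=> x; apply: continuous_max; [exact: cvg_cst|exact: c1].
exact: c2.
Qed.

Lemma clip_itv x : 0 <= clip x <= L.
Proof. by rewrite /clip le_max lexx/= ge_max L0' ge_min lexx orbT. Qed.

Lemma clip_id x : 0 <= x <= L -> clip x = x.
Proof.
by move=> /andP[x0 xL]; rewrite /clip (min_idPl xL) (max_idPr x0).
Qed.

Lemma ipC u v : ip u v = ip v u.
Proof. by rewrite /ip; congr sint; apply/funext => x; rewrite mulrC. Qed.

Lemma ipDl u1 u2 v : L2loc u1 -> L2loc u2 -> L2loc v ->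
  ip (fun x => u1 x + u2 x) v = ip u1 v + ip u2 v.
Proof.
move=> l1 l2 lv; rewrite /ip -sintD; [|exact: L2loc_mul..].
by congr sint; apply/funext => x; rewrite mulrDl.
Qed.

Lemma ipZl k u v : L2loc u -> L2loc v -> ip (fun x => k * u x) v = k * ip u v.
Proof.
move=> l1 lv; rewrite /ip -sintZ; last exact: L2loc_mul.
by congr sint; apply/funext => x; rewrite mulrA.
Qed.

Lemma ipBl u1 u2 v : L2loc u1 -> L2loc u2 -> L2loc v ->
  ip (fun x => u1 x - u2 x) v = ip u1 v - ip u2 v.
Proof.
move=> l1 l2 lv; rewrite /ip -sintB; [|exact: L2loc_mul..].
by congr sint; apply/funext => x; rewrite mulrBl.
Qed.

Lemma ipDr u v1 v2 : L2loc u -> L2loc v1 -> L2loc v2 ->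
  ip u (fun x => v1 x + v2 x) = ip u v1 + ip u v2.
Proof. by move=> *; rewrite ipC ipDl// ![ip _ u]ipC. Qed.

Lemma ipBr u v1 v2 : L2loc u -> L2loc v1 -> L2loc v2 ->
  ip u (fun x => v1 x - v2 x) = ip u v1 - ip u v2.
Proof. by move=> *; rewrite ipC ipBl// ![ip _ u]ipC. Qed.

Lemma nsq_ge0 u : 0 <= nsq u. Proof. exact: sint_sqr_ge0. Qed.

Lemma ip_le u v : L2loc u -> L2loc v -> `|ip u v| <= Num.sqrt (nsq u) * Num.sqrt (nsq v).
Proof. exact: cauchy_schwarz_sqrt. Qed.

Lemma L2curve_sqrt_cvg U t : L2curve U ->
  Num.sqrt (nsq (fun x => U s x - U t x)) @[s --> t] --> (0 : R).
Proof.
move=> [_ cU]; rewrite -(sqrtr0 R).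
by apply: (cvg_comp (fun s => nsq (fun x => U s x - U t x)) Num.sqrt (cU t)); exact: sqrt_continuous.
Qed.

Lemma ip_curve_cont U v : L2curve U -> L2loc v -> continuous (fun t => ip (U t) v).
Proof.
move=> cU lv t; have lU := cU.1.
apply/subr_cvg0; apply: norm_cvg0.
apply: (@squeeze_cvgr _ _ _ _ (fun=> 0)
  (fun s => Num.sqrt (nsq (fun x => U s x - U t x)) * Num.sqrt (nsq v))).
- by near=> s; rewrite normr_ge0/= -ipBl// ip_le//; exact: L2locB.
- exact: cvg_cst.
- rewrite -[X in _ --> X](mul0r (Num.sqrt (nsq v))).
  by apply: cvgM; [exact: L2curve_sqrt_cvg|exact: cvg_cst].
Unshelve. all: by end_near. Qed.

Lemma sint_sub_le f b c : 0 <= c <= L -> locint f -> (forall x, 0 <= f x) ->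
  sint f 0 c <= sint f 0 L.
Proof.
move=> /andP[c0 cL] lf f0; rewrite -(sint_chasles 0 c L lf) lerDl.
by apply: sint_ge0.
Qed.

Definition prim (th : R -> R) U t x := sint (fun y => th y * U t y) 0 (clip x).

(** By Cauchy-Schwarz the primitive depends on t through the L^2 norm only, uniformly in x, and for
    fixed t it is continuous in x. This joint continuity is what makes Fubini applicable below. *)
Lemma prim_cont2 th U : continuous th -> L2curve U -> cont2 (prim th U).
Proof.
move=> cth cU [t0 x0]; have lU := cU.1; have lth := continuous_L2loc cth.
have lthU t : L2loc (fun y => th y * U t y) by exact: L2loc_cmul.
rewrite /continuous_at.
rewrite (_ : (fun z => _) = (fun z : R * R => (prim th U z.1 z.2 - prim th U t0 z.2) + prim th U t0 z.2)); last first.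
  by apply/funext => z; rewrite subrK.
rewrite -[X in _ --> X]add0r; apply: cvgD; last first.
  have c1 : continuous (prim th U t0).
    move=> x; apply: (cvg_comp clip (sint (fun y => th y * U t0 y) 0) (clip_cont (x := x))).
    by apply: sint_locint_cont; exact: L2loc_locint.
  exact: (@cont2_of2 _ _ c1 (t0, x0)).
apply: norm_cvg0.
apply: (@squeeze_cvgr _ _ _ _ (fun=> 0)
  (fun z : R * R => Num.sqrt (nsq th) * Num.sqrt (nsq (fun y => U z.1 y - U t0 y)))).
- near=> z; rewrite normr_ge0/= /prim -sintB; [|exact: L2loc_locint..].
  rewrite (_ : (fun y => _) = (fun y => th y * (U z.1 y - U t0 y))); last first.
    by apply/funext => y; rewrite mulrBr.
  have lB := L2locB (lU z.1) (lU t0).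
  have /andP[c0 cL] := clip_itv z.2.
  apply: le_trans (cauchy_schwarz_sqrt c0 lth lB) _.
  apply: ler_pM; rewrite ?sqrtr_ge0// ler_wsqrtr// sint_sub_le ?c0//.
  + exact: L2loc_sqr.
  + by move=> y; exact: sqr_ge0.
  + exact: L2loc_sqr.
  + by move=> y; exact: sqr_ge0.
- exact: cvg_cst.
- rewrite -[X in _ --> X](mulr0 (Num.sqrt (nsq th))).
  apply: cvgM; first exact: cvg_cst.
  apply: (cvg_comp (fun z : R * R => z.1) (fun s => Num.sqrt (nsq (fun y => U s y - U t0 y))) _
    (@L2curve_sqrt_cvg U t0 cU)).
  exact: cvg_fst.
Unshelve. all: by end_near. Qed.

Lemma prim0 th U t : prim th U t 0 = 0.
Proof. by rewrite /prim clip_id ?sintxx// lexx L0'. Qed.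

Lemma primE th U t x : 0 <= x <= L -> prim th U t x = sint (fun y => th y * U t y) 0 x.
Proof. by move=> xL; rewrite /prim clip_id. Qed.

Lemma LinL : 0 <= L <= L. Proof. by rewrite L0' lexx. Qed.

Lemma ip_ibp th U t phi (dphi : R -> R) : continuous th -> L2curve U ->
  (forall x, is_derive x 1 phi (dphi x)) -> continuous dphi ->
  ip (U t) (fun x => th x * phi x) = prim th U t L * phi L - ip (prim th U t) dphi.
Proof.
move=> cth cU Dphi cd; have lU := cU.1.
rewrite /ip (_ : (fun x => _) = (fun x => (th x * U t x) * phi x)); last first.
  by apply/funext => x; ring.
rewrite (ibp L0' _ Dphi cd); last exact: L2loc_cmul.
have -> : sint (fun x => prim th U t x * dphi x) 0 L =
          sint (fun x => sint (fun y => th y * U t y) 0 x * dphi x) 0 L.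
  by apply: eq_sint => // x xL; rewrite primE.
by rewrite primE; last exact: LinL.
Qed.

Definition tprim th U t x := sint (fun s => prim th U s x) 0 t.

Lemma tprim_cont2 th U : continuous th -> L2curve U -> cont2 (tprim th U).
Proof.
move=> cth cU; apply: cont2_swap.
by apply: (@sint_cont2 _ (fun x s => prim th U s x)); apply: cont2_swap; exact: prim_cont2.
Qed.

Lemma tip_ibp th U t phi (dphi : R -> R) : continuous th -> L2curve U ->
  (forall x, is_derive x 1 phi (dphi x)) -> continuous dphi ->
  sint (fun s => ip (U s) (fun x => th x * phi x)) 0 t =
  tprim th U t L * phi L - ip (tprim th U t) dphi.
Proof.
move=> cth cU Dphi cd; have cp := prim_cont2 cth cU.
under eq_fun do rewrite (ip_ibp _ cth cU Dphi cd).
have c1 : continuous (fun s => phi L * prim th U s L).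
  by move=> s; apply: cvgM; [exact: cvg_cst|exact: cont2_fst].
have c2 : cont2 (fun s x => prim th U s x * dphi x).
  by apply: cont2M => //; exact: cont2_of2.
rewrite (_ : (fun s => _) = (fun s => phi L * prim th U s L - ip (prim th U s) dphi)); last first.
  by apply/funext => s; rewrite [phi L * _]mulrC.
rewrite sintB; last 2 first.
- exact: continuous_locint.
- by apply: continuous_locint; exact: sint_param_cont.
rewrite sintZ; last by apply: continuous_locint; exact: cont2_fst.
rewrite mulrC; congr (_ - _).
rewrite /ip (sint_fubini _ _ _ _ c2); congr sint; apply/funext => x.
rewrite /tprim [RHS]mulrC -sintZ; last by apply: continuous_locint; exact: cont2_fst.
by congr sint; apply/funext => s; rewrite mulrC.
Qed.

(** This exchanges the integrals in s and y although [U] need not be jointly measurable. If [W] is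
    the difference of the two sides and phi its primitive, testing the hypothesis with th phi and
    integrating by parts leaves the integral of W^2, which is therefore 0. *)
Lemma time_integral_primitive U v t : L2curve U -> continuous v ->
  (forall psi : R -> R, continuous psi -> sint (fun s => ip (U s) psi) 0 t = ip v psi) ->
  forall th : R -> R, continuous th -> forall x, 0 <= x <= L ->
  tprim th U t x = sint (fun y => th y * v y) 0 x.
Proof.
move=> cU cv H th cth.
have cthv : continuous (fun y => th y * v y) by move=> y; apply: cvgM; [exact: cth|exact: cv].
pose V x := sint (fun y => th y * v y) 0 x.
have cV : continuous V by exact: sint_cont.
have cT : continuous (tprim th U t) by apply: cont2_snd; exact: tprim_cont2.
pose W x := tprim th U t x - V x.
have cW : continuous W by move=> x; apply: cvgB; [exact: cT|exact: cV].
suff W0 : sint (fun x => W x ^+ 2) 0 L = 0.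
  by move=> x xL; apply/eqP; rewrite -subr_eq0; apply/eqP; exact: (sint_sqr_eq0 L0 cW W0).
pose phi := sint W 0.
have Dphi x : is_derive x 1 phi (W x) by exact: sint_derive.
have cphi : continuous phi by exact: sint_cont.
have cthphi : continuous (fun x => th x * phi x) by move=> y; apply: cvgM; [exact: cth|exact: cphi].
(* Testing with [th] itself makes the boundary terms at L agree. *)
have TL : tprim th U t L = V L.
  have := H _ cth.
  have one x : is_derive x 1 (fun=> 1 : R) 0 by exact: drvC.
  have c0 : continuous (fun _ : R => 0 : R) by move=> x; exact: cvg_cst.
  have := tip_ibp t cth cU one c0.
  rewrite (_ : (fun x => th x * 1) = th); last by apply/funext => x; rewrite mulr1.
  move=> -> ; rewrite mulr1 /ip (_ : (fun x => _ * 0) = fun=> 0); last by apply/funext => x; rewrite mulr0.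
  rewrite sint_cst mul0r subr0 => ->.
  by rewrite /V; congr sint; apply/funext => x; rewrite mulrC.
have := H _ cthphi; rewrite (tip_ibp t cth cU Dphi cW) TL.
have Ev : ip v (fun x => th x * phi x) = V L * phi L - ip V W.
  rewrite /ip (_ : (fun x => _) = (fun x => th x * v x * phi x)); last first.
    by apply/funext => x; ring.
  by apply: ibp => //; exact: continuous_L2loc.
rewrite Ev => /addrI /oppr_inj h.
have := ipBl (continuous_L2loc cT) (continuous_L2loc cV) (continuous_L2loc cW).
by rewrite h subrr.
Qed.

End L2Families.

(** * The system integrated in time *)

Section TimeIntegratedSolution.
Context {R : realType} (L : R) (L0 : 0 < L).
Implicit Types (t x : R) (phi psi dphi : R -> R).

Variables (a b ta tb : R -> R) (alh alq : R) (h q : R -> R -> R) (h0 q0 D : R -> R).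
Hypotheses (ca : continuous a) (cb : continuous b).
Hypotheses (cta : continuous ta) (ctb : continuous tb) (a_neq0 : forall x, a x != 0).
Hypotheses (hC : L2curve L h) (qC : L2curve L q) (h0L : L2loc h0) (q0L : L2loc q0).
Hypothesis cD : continuous D.

Local Notation ip := (ip L).
Local Notation prim := (prim L).
Local Notation tprim := (tprim L).

(** This is the weak formulation for test functions of x alone, in which the derivatives of [a] and
    [b] cancel: (a phi2)_x - (a_x + ta) phi2 = a phi2' - ta phi2, and likewise for [b]. Accordingly
    [D] stands for the primitive of the disturbance. *)
Hypothesis weak : forall (phi1 phi2 dphi1 dphi2 : R -> R) (m : R),
  (forall x, is_derive x 1 phi1 (dphi1 x)) -> (forall x, is_derive x 1 phi2 (dphi2 x)) ->
  continuous dphi1 -> continuous dphi2 ->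
  phi1 L + b L * phi2 L = 0 -> a 0 * phi2 0 = m * alh -> phi1 0 + b 0 * phi2 0 = m * alq ->
  forall t, 0 <= t ->
  ip (h t) phi1 + ip (q t) phi2 - (ip h0 phi1 + ip q0 phi2) =
  sint (fun s => ip (h s) (fun x => a x * dphi2 x - ta x * phi2 x)
     + ip (q s) (fun x => dphi1 x + b x * dphi2 x - tb x * phi2 x)) 0 t + m * D t.

Let L0' : 0 <= L := ltW L0.
Let one : R -> R := fun=> 1.
Let zero : R -> R := fun=> 0.
Let c1 : continuous one. Proof. by move=> x; exact: cvg_cst. Qed.
Let c0 : continuous zero. Proof. by move=> x; exact: cvg_cst. Qed.
Let ck (k : R) : continuous (fun _ : R => k). Proof. by move=> x; exact: cvg_cst. Qed.

Lemma L2curve_cst u : L2loc u -> L2curve L (fun=> u).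
Proof.
move=> lu; split => // t; rewrite (_ : (fun s => _) = fun=> 0); first exact: cvg_cst.
apply/funext => s; rewrite /nsq (_ : (fun x => _) = fun=> 0) ?sint_cst ?mul0r//.
by apply/funext => x; rewrite subrr expr0n.
Qed.

(* The continuous functions eta and kap turn out to represent int_0^t h and int_0^t q: the first
   equation integrated over [0, t] x [0, x] gives kap up to kap0 t, its value at x = 0, and the
   second one gives the flux a eta + b kap up to flux0 t, fixed by eta = 0 at x = L. *)
Definition H0 x := prim one (fun=> h0) 0 x.
Definition Q0 x := prim one (fun=> q0) 0 x.
Definition dH t x := prim one h t x - H0 x.
Definition dQ t x := prim one q t x - Q0 x.
Definition JJ t x := tprim ta h t x + tprim tb q t x.
Definition kap0 t := L^-1 * (sint (dH t) 0 L + tprim one q t L).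
Definition kap t x := kap0 t - dH t x.
Definition flux0 t := b L * kap t L + dQ t L + JJ t L.
Definition eta t x := (a x)^-1 * (flux0 t - dQ t x - JJ t x - b x * kap t x).

Let cH0 : continuous H0.
Proof. by apply: cont2_snd; apply: prim_cont2 => //; exact: L2curve_cst. Qed.
Let cQ0 : continuous Q0.
Proof. by apply: cont2_snd; apply: prim_cont2 => //; exact: L2curve_cst. Qed.

Let dH_cont2 : cont2 dH.
Proof. by apply: cont2B; [exact: prim_cont2|exact: cont2_of2]. Qed.
Let dQ_cont2 : cont2 dQ.
Proof. by apply: cont2B; [exact: prim_cont2|exact: cont2_of2]. Qed.
Let JJ_cont2 : cont2 JJ.
Proof. by apply: cont2D; exact: tprim_cont2. Qed.

Let kap0_cont : continuous kap0.
Proof.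
move=> t; apply: cvgM; first exact: cvg_cst.
apply: cvgD; first by apply: sint_param_cont; exact: dH_cont2.
have cT : cont2 (tprim one q) by exact: tprim_cont2.
exact: (cont2_fst (x := L) cT).
Qed.

Lemma kap_cont2 : cont2 kap.
Proof. by apply: cont2B => //; exact: cont2_of1. Qed.

Let flux0_cont : continuous flux0.
Proof.
have k1 := cont2_fst (x := L) kap_cont2; have k2 := cont2_fst (x := L) dQ_cont2.
have k3 := cont2_fst (x := L) JJ_cont2.
by move=> t; apply: cvgD; [apply: cvgD; [apply: cvgM; [exact: cvg_cst|exact: k1]|exact: k2]|exact: k3].
Qed.

Let cai : continuous (fun x => (a x)^-1).
Proof. by move=> x; apply: cvgV; [exact: a_neq0|exact: ca]. Qed.

Lemma eta_cont2 : cont2 eta.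
Proof.
apply: cont2M; first exact: cont2_of2.
apply: cont2B; last by apply: cont2M; [exact: cont2_of2|exact: kap_cont2].
apply: cont2B => //; apply: cont2B => //; exact: cont2_of1.
Qed.

Let ip_one (u : R -> R) : ip u one = sint u 0 L.
Proof. by rewrite /ip; congr sint; apply/funext => x; rewrite mulr1. Qed.

Let ip_ibp1 (U : R -> R -> R) t phi dphi : L2curve L U ->
  (forall x, is_derive x 1 phi (dphi x)) -> continuous dphi ->
  ip (U t) phi = prim one U t L * phi L - ip (prim one U t) dphi.
Proof.
move=> cU Dp cd; rewrite -(ip_ibp L0 t c1 cU Dp cd); congr ip.
by apply/funext => x; rewrite mul1r.
Qed.

Let dh_ibp t phi dphi : (forall x, is_derive x 1 phi (dphi x)) -> continuous dphi ->
  ip (h t) phi - ip h0 phi = dH t L * phi L - ip (dH t) dphi.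
Proof.
move=> Dp cd; rewrite (ip_ibp1 t hC Dp cd).
have -> : ip h0 phi = H0 L * phi L - ip H0 dphi.
  exact: (ip_ibp1 0 (L2curve_cst h0L) Dp cd).
have l1 : L2loc (prim one h t) by apply: continuous_L2loc; apply: cont2_snd; exact: prim_cont2.
have -> : ip (dH t) dphi = ip (prim one h t) dphi - ip H0 dphi.
  exact: (ipBl L l1 (continuous_L2loc cH0) (continuous_L2loc cd)).
have -> : dH t L = prim one h t L - H0 L by [].
move: (prim one h t L) (ip (prim one h t) dphi) (H0 L) (ip H0 dphi) => *; ring.
Qed.

Let dq_ibp t phi dphi : (forall x, is_derive x 1 phi (dphi x)) -> continuous dphi ->
  ip (q t) phi - ip q0 phi = dQ t L * phi L - ip (dQ t) dphi.
Proof.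
move=> Dp cd; rewrite (ip_ibp1 t qC Dp cd).
have -> : ip q0 phi = Q0 L * phi L - ip Q0 dphi.
  exact: (ip_ibp1 0 (L2curve_cst q0L) Dp cd).
have l1 : L2loc (prim one q t) by apply: continuous_L2loc; apply: cont2_snd; exact: prim_cont2.
have -> : ip (dQ t) dphi = ip (prim one q t) dphi - ip Q0 dphi.
  exact: (ipBl L l1 (continuous_L2loc cQ0) (continuous_L2loc cd)).
have -> : dQ t L = prim one q t L - Q0 L by [].
move: (prim one q t L) (ip (prim one q t) dphi) (Q0 L) (ip Q0 dphi) => *; ring.
Qed.

Let weak_ibp (phi1 phi2 dphi1 dphi2 : R -> R) (m : R) :
  (forall x, is_derive x 1 phi1 (dphi1 x)) -> (forall x, is_derive x 1 phi2 (dphi2 x)) ->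
  continuous dphi1 -> continuous dphi2 ->
  phi1 L + b L * phi2 L = 0 -> a 0 * phi2 0 = m * alh -> phi1 0 + b 0 * phi2 0 = m * alq ->
  forall t, 0 <= t ->
  (dH t L * phi1 L - ip (dH t) dphi1) + (dQ t L * phi2 L - ip (dQ t) dphi2) =
  sint (fun s => ip (h s) (fun x => a x * dphi2 x - ta x * phi2 x)
     + ip (q s) (fun x => dphi1 x + b x * dphi2 x - tb x * phi2 x)) 0 t + m * D t.
Proof.
move=> D1 D2 cd1 cd2 e1 e2 e3 t t0; rewrite -(weak D1 D2 cd1 cd2 e1 e2 e3 t0).
rewrite -(dh_ibp t D1 cd1) -(dq_ibp t D2 cd2).
move: (ip (h t) phi1) (ip h0 phi1) (ip (q t) phi2) (ip q0 phi2) => *; ring.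
Qed.

Let ip0 (u : R -> R) : ip u zero = 0.
Proof.
rewrite /ip (_ : (fun x => _) = fun=> 0) ?sint_cst ?mul0r//.
by apply/funext => x; rewrite mulr0.
Qed.

Let curve_locint (U : R -> R -> R) psi : L2curve L U -> continuous psi ->
  locint (fun s => ip (U s) psi).
Proof. by move=> cU cp; apply: continuous_locint; apply: ip_curve_cont => //; exact: continuous_L2loc. Qed.

Let ipZr k (u v : R -> R) : L2loc u -> L2loc v -> ip u (fun x => k * v x) = k * ip u v.
Proof. by move=> lu lv; rewrite ipC ipZl// ipC. Qed.

Let ip_cst k (u : R -> R) : L2loc u -> ip u (fun=> k) = k * sint u 0 L.
Proof.
move=> lu; rewrite -ip_one -(ipZr k lu (continuous_L2loc c1)); congr ip.
by apply/funext => x; rewrite mulr1.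
Qed.

Let tip_one (U : R -> R -> R) t : L2curve L U ->
  sint (fun s => ip (U s) one) 0 t = tprim one U t L.
Proof.
move=> cU; rewrite /tprim.
suff -> : (fun s => ip (U s) one) = (fun s => prim one U s L) by [].
apply/funext => s; rewrite ip_one primE ?LinL//; congr sint; apply/funext => x.
by rewrite mul1r.
Qed.

(** Subtracting its mean [m] from [psi] gives a primitive [phi] that vanishes at both ends, so the
    pair (phi, 0) satisfies the adjoint boundary conditions with zero multiplier. The identity is
    thereby known up to the mean of [psi]; [kap0] is chosen to make the integral of [kap] over
    [0, L] equal to the time integral of that of [q], which settles the mean. *)
Lemma q_time_integral t psi : 0 <= t -> continuous psi ->
  sint (fun s => ip (q s) psi) 0 t = ip (kap t) psi.
Proof.
move=> t0 cpsi; pose m := L^-1 * sint psi 0 L.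
have Lm : L * m = sint psi 0 L by rewrite /m mulrA mulfV ?mul1r// gt_eqF.
pose phi x := sint psi 0 x - m * x.
pose dphi x := psi x - m * 1.
have Dphi x : is_derive x 1 phi (dphi x).
  by apply: drvB; exact: sint_derive.
have cd : continuous dphi by move=> x; apply: cvgB; [exact: cpsi|exact: cvg_cst].
have D0 x : is_derive x 1 zero (zero x) by exact: drvC.
have pL : phi L = 0 by rewrite /phi -Lm; ring.
have p0 : phi 0 = 0 by rewrite /phi sintxx mulr0 subrr.
have := weak_ibp (m := 0) Dphi D0 cd c0 _ _ _ t0.
rewrite pL p0 !mulr0 !mul0r !addr0 => /(_ erefl erefl erefl).
rewrite (_ : (fun s => _ + _) = fun s => ip (q s) psi - m * ip (q s) one); last first.
  apply/funext => s; rewrite (_ : (fun x => _ - _) = zero); last first.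
    by apply/funext => x; rewrite /zero; ring.
  rewrite ip0 add0r.
  have lq : L2loc (q s) by case: qC.
  rewrite -(ipZr m lq (continuous_L2loc c1)) -ipBr//.
  - by congr ip; apply/funext => x; rewrite /dphi /zero /one; ring.
  - exact: continuous_L2loc.
  - by apply: continuous_L2loc; exact: (@ck (m * 1)).
rewrite sintB; [|exact: curve_locint|by apply: locintZ; exact: curve_locint].
rewrite sintZ; last exact: curve_locint.
rewrite (tip_one t qC) ip0 subrr addr0 sub0r.
have cdH : continuous (dH t) by exact: cont2_snd.
have ld := continuous_L2loc cdH; have lp := continuous_L2loc cpsi.
have lk : L2loc (fun _ : R => m * 1) by exact: continuous_L2loc.
rewrite (ipBr L ld lp lk) ip_cst// (ipBl L (continuous_L2loc (@ck _)) ld lp).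
rewrite (ipC L (fun _ : R => kap0 t) psi) (ip_cst (kap0 t) lp) /kap0 /m => E.
set X := sint (fun s => _) 0 t in E *; set S := sint psi 0 L in E *.
have -> : X = L^-1 * S * tprim one q t L
  - (ip (dH t) psi - L^-1 * S * 1 * sint (dH t) 0 L) by rewrite -[ip _ _ - _]opprK E; ring.
by ring.
Qed.

(** Dividing by [a] gives phi2 with a phi2' = psi and phi2(0) = 0. The linear function phi1 vanishes
    at 0 and takes the value -b(L) phi2(L) at L, so the adjoint conditions hold with zero
    multiplier; the terms in [q] are already known from [q_time_integral]. *)
Lemma h_time_integral t psi : 0 <= t -> continuous psi ->
  sint (fun s => ip (h s) psi) 0 t = ip (eta t) psi.
Proof.
move=> t0 cpsi.
pose chi x := (a x)^-1 * psi x.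
have cchi : continuous chi by move=> x; apply: cvgM; [exact: cai|exact: cpsi].
pose phi2 := sint chi 0.
have D2 x : is_derive x 1 phi2 (chi x) by exact: sint_derive.
have cp2 : continuous phi2 by exact: sint_cont.
pose s := - (b L * phi2 L) * L^-1.
pose phi1 x := s * x.
pose dphi1 (x : R) := s * 1.
have D1 x : is_derive x 1 phi1 (dphi1 x) by exact: (drvZ s (drv_id x)).
have cd1 : continuous dphi1 by exact: ck.
have LL : L^-1 * L = 1 by rewrite mulVf// gt_eqF.
have p1L : phi1 L = - (b L * phi2 L) by rewrite /phi1 /s -mulrA LL mulr1.
have := weak_ibp (m := 0) D1 D2 cd1 cchi _ _ _ t0.
have p20 : phi2 0 = 0 by rewrite /phi2 sintxx.
have p10 : phi1 0 = 0 by rewrite /phi1 mulr0.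
rewrite p1L p20 p10 !mulr0 !mul0r !addr0 => /(_ (addNr _) erefl erefl).
have lchi := continuous_L2loc cchi; have lpsi := continuous_L2loc cpsi.
have cbchi : continuous (fun x => b x * chi x) by move=> x; apply: cvgM; [exact: cb|exact: cchi].
have ctap : continuous (fun x => ta x * phi2 x) by move=> x; apply: cvgM; [exact: cta|exact: cp2].
have ctbp : continuous (fun x => tb x * phi2 x) by move=> x; apply: cvgM; [exact: ctb|exact: cp2].
have csb : continuous (fun x => s * 1 + b x * chi x).
  by move=> x; apply: cvgD; [exact: cvg_cst|exact: cbchi].
rewrite (_ : (fun r => _ + _) = fun r => (ip (h r) psi + ip (q r) (fun x => s * 1 + b x * chi x))
   - (ip (h r) (fun x => ta x * phi2 x) + ip (q r) (fun x => tb x * phi2 x))); last first.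
  apply/funext => r; have lh : L2loc (h r) by case: hC.
  have lq : L2loc (q r) by case: qC.
  rewrite (_ : (fun x => a x * _ - _) = fun x => psi x - ta x * phi2 x); last first.
    by apply/funext => x; rewrite /chi mulrA divff// mul1r.
  rewrite (ipBr L lh lpsi (continuous_L2loc ctap)) (ipBr L lq (continuous_L2loc csb) (continuous_L2loc ctbp)).
  by ring.
rewrite sintB; [|by apply: locintD; exact: curve_locint..].
rewrite (sintD 0 t (curve_locint hC cpsi) (curve_locint qC csb)).
rewrite (sintD 0 t (curve_locint hC ctap) (curve_locint qC ctbp)).
rewrite (q_time_integral t0 csb) (tip_ibp L0 t cta hC D2 cchi) (tip_ibp L0 t ctb qC D2 cchi).
have ckap : continuous (kap t) by apply: cont2_snd; exact: kap_cont2.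
have cdH : continuous (dH t) by exact: cont2_snd.
have cdQ : continuous (dQ t) by exact: cont2_snd.
have cJ1 : continuous (tprim ta h t) by apply: cont2_snd; exact: tprim_cont2.
have cJ2 : continuous (tprim tb q t) by apply: cont2_snd; exact: tprim_cont2.
have lkap := continuous_L2loc ckap; have ldH := continuous_L2loc cdH.
have ldQ := continuous_L2loc cdQ; have lJ1 := continuous_L2loc cJ1; have lJ2 := continuous_L2loc cJ2.
have lJJ : L2loc (JJ t) by exact: L2locD.
rewrite (ipDr L lkap (continuous_L2loc (@ck (s * 1))) (continuous_L2loc cbchi)).
rewrite (ip_cst _ lkap) (ip_cst _ ldH).
have skap : sint (kap t) 0 L = kap0 t * L - sint (dH t) 0 L.
  by rewrite sintB ?sint_cst ?subr0//; [exact: locint_cst|exact: continuous_locint].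
rewrite skap.
have cbk : continuous (fun x => b x * kap t x) by move=> x; apply: cvgM; [exact: cb|exact: ckap].
have -> : ip (eta t) psi = flux0 t * phi2 L - ip (dQ t) chi
    - (ip (tprim ta h t) chi + ip (tprim tb q t) chi) - ip (kap t) (fun x => b x * chi x).
  have -> : ip (eta t) psi = ip (fun x => flux0 t - dQ t x - JJ t x - b x * kap t x) chi.
    by rewrite /ip; congr sint; apply/funext => x; rewrite /eta /chi; ring.
  have lf := continuous_L2loc (@ck (flux0 t)).
  rewrite (ipBl L _ (continuous_L2loc cbk) lchi); last by apply: L2locB => //; exact: L2locB.
  rewrite (ipBl L (L2locB lf ldQ) lJJ lchi) (ipBl L lf ldQ lchi) (ipDl L lJ1 lJ2 lchi).
  rewrite (ipC L (fun _ : R => flux0 t) chi) (ip_cst (flux0 t) lchi); congr (_ - _).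
  by rewrite /ip; congr sint; apply/funext => x; ring.
have kL : kap t L = kap0 t - dH t L by [].
have fE : flux0 t = b L * kap t L + dQ t L + (tprim ta h t L + tprim tb q t L) by [].
rewrite fE kL /s.
set X := sint (fun r => ip (h r) psi) 0 t.
move: (ip (kap t) (fun x => b x * chi x)) (ip (dQ t) chi) (ip (tprim ta h t) chi) (ip (tprim tb q t) chi) (sint (dH t) 0 L)
  (dH t L) (dQ t L) (tprim ta h t L) (tprim tb q t L) (kap0 t) => A1 A2 A3 A4 A5 A6 A7 A8 A9 A10.
move: (phi2 L) (b L) X => p bL X E.
have E2 : - (bL * p) / L * 1 * (A10 * L - A5) = - (bL * p) * (A10 * (L^-1 * L)) + (bL * p) / L * A5 by ring.
rewrite E2 LL in E.
by clear E2 fE kL skap p1L p20 p10 LL; lra.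
Qed.

(** The test functions are affine, vanish at L, and take at 0 the values [k1], [k2] imposed by the
    adjoint condition with multiplier 1. Once the time integrals of [h] and [q] are replaced by
    [eta] and [kap], all integrals over [0, L] cancel and only the terms at 0 remain. *)
Lemma boundary0 t : 0 <= t -> alh * eta t 0 + alq * kap t 0 = D t.
Proof.
move=> t0.
have [k2 k2E] : exists k2, k2 = (a 0)^-1 * alh by exists ((a 0)^-1 * alh).
have [k1 k1E] : exists k1, k1 = alq - b 0 * k2 by exists (alq - b 0 * k2).
have LL : L^-1 * L = 1 by rewrite mulVf// gt_eqF.
have [ph [dph [Dph phL ph0 dphE]]] : exists ph dph : R -> R -> R,
    [/\ forall k x, is_derive x 1 (ph k) (dph k x), forall k, ph k L = 0,
     forall k, ph k 0 = k & forall k, dph k = fun=> - (k / L)].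
  exists (fun k x => k * (1 - L^-1 * x)), (fun k x => - (k / L)); split => //.
  - move=> k x.
    apply: drv_eq (drvZ k (drvB (drvC 1 x) (drvZ L^-1 (drv_id x)))) _.
    by ring.
  - by move=> k; rewrite LL subrr mulr0.
  - by move=> k; rewrite mulr0 subr0 mulr1.
have cph k : continuous (ph k) by exact: is_derive1_continuous (Dph k).
have cdph k : continuous (dph k) by rewrite dphE; exact: ck.
have := weak_ibp (m := 1) (Dph k1) (Dph k2) (cdph k1) (cdph k2) _ _ _ t0.
rewrite !phL !ph0 mulr0 addr0 !mul1r => /(_ erefl).
have -> : a 0 * k2 = alh by rewrite k2E mulrA divff// mul1r.
have -> : k1 + b 0 * k2 = alq by rewrite k1E subrK.
move=> /(_ erefl erefl).
have cak : continuous (fun x => a x * dph k2 x) by move=> x; apply: cvgM; [exact: ca|exact: cdph].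
have cbk : continuous (fun x => dph k1 x + b x * dph k2 x).
  by move=> x; apply: cvgD; [exact: cdph|apply: cvgM; [exact: cb|exact: cdph]].
have ctap : continuous (fun x => ta x * ph k2 x) by move=> x; apply: cvgM; [exact: cta|exact: cph].
have ctbp : continuous (fun x => tb x * ph k2 x) by move=> x; apply: cvgM; [exact: ctb|exact: cph].
rewrite (_ : (fun r => _ + _) = fun r => (ip (h r) (fun x => a x * dph k2 x)
   + ip (q r) (fun x => dph k1 x + b x * dph k2 x))
   - (ip (h r) (fun x => ta x * ph k2 x) + ip (q r) (fun x => tb x * ph k2 x))); last first.
  apply/funext => r; have lh : L2loc (h r) by case: hC.
  have lq : L2loc (q r) by case: qC.
  rewrite (ipBr L lh (continuous_L2loc cak) (continuous_L2loc ctap)).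
  rewrite (ipBr L lq (continuous_L2loc cbk) (continuous_L2loc ctbp)).
  by ring.
rewrite sintB; [|by apply: locintD; exact: curve_locint..].
rewrite (sintD 0 t (curve_locint hC cak) (curve_locint qC cbk)).
rewrite (sintD 0 t (curve_locint hC ctap) (curve_locint qC ctbp)).
rewrite (q_time_integral t0 cbk) (h_time_integral t0 cak).
rewrite (tip_ibp L0 t cta hC (Dph k2) (cdph k2)) (tip_ibp L0 t ctb qC (Dph k2) (cdph k2)).
rewrite phL.
have ckap : continuous (kap t) by apply: cont2_snd; exact: kap_cont2.
have ceta : continuous (eta t) by apply: cont2_snd; exact: eta_cont2.
have cdH : continuous (dH t) by exact: cont2_snd.
have cdQ : continuous (dQ t) by exact: cont2_snd.
have cJ1 : continuous (tprim ta h t) by apply: cont2_snd; exact: tprim_cont2.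
have cJ2 : continuous (tprim tb q t) by apply: cont2_snd; exact: tprim_cont2.
have lkap := continuous_L2loc ckap; have ldH := continuous_L2loc cdH.
have ldQ := continuous_L2loc cdQ; have lJ1 := continuous_L2loc cJ1; have lJ2 := continuous_L2loc cJ2.
have lJJ : L2loc (JJ t) by exact: L2locD.
have cb2 : continuous (fun x => b x * dph k2 x) by move=> x; apply: cvgM; [exact: cb|exact: cdph].
rewrite (ipDr L lkap (continuous_L2loc (cdph k1)) (continuous_L2loc cb2)).
have skap : sint (kap t) 0 L = kap0 t * L - sint (dH t) 0 L.
  by rewrite sintB ?sint_cst ?subr0//; [exact: locint_cst|exact: continuous_locint].
have sfl : ip (eta t) (fun x => a x * dph k2 x) + ip (kap t) (fun x => b x * dph k2 x) =
   - (k2 * L^-1) * (flux0 t * L - sint (dQ t) 0 L - (sint (tprim ta h t) 0 L + sint (tprim tb q t) 0 L)).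
  rewrite /ip -sintD; last 2 first.
  - by apply: continuous_locint => x; apply: cvgM; [exact: ceta|exact: cak].
  - by apply: continuous_locint => x; apply: cvgM; [exact: ckap|exact: cb2].
  rewrite (_ : (fun x => _) = fun x => - (k2 * L^-1) * (flux0 t - dQ t x - JJ t x)); last first.
    apply/funext => x; rewrite /eta dphE.
    have aa : (a x)^-1 * a x = 1 by rewrite mulVf.
    rewrite (_ : forall w, (a x)^-1 * w * (a x * - (k2 / L)) = (a x)^-1 * a x * (w * - (k2 / L))); last first.
      by move=> w; ring.
    by rewrite aa; ring.
  have lf : locint (fun _ : R => flux0 t) by exact: locint_cst.
  have lq' := continuous_locint cdQ; have lj1 := continuous_locint cJ1; have lj2 := continuous_locint cJ2.
  have lj : locint (JJ t) by exact: locintD.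
  rewrite sintZ; last by apply: locintB => //; exact: locintB.
  by rewrite (sintB 0 L (locintB lf lq') lj) (sintB 0 L lf lq') (sintD 0 L lj1 lj2) sint_cst subr0.
rewrite [ip (eta t) _ + (_ + _)]addrCA sfl !dphE.
rewrite (ip_cst _ lkap) (ip_cst _ ldH) (ip_cst _ ldQ) (ip_cst _ lJ1) (ip_cst _ lJ2).
rewrite skap.
(* Primitives in x vanish at 0, so [flux0] and [kap0] are the values at x = 0 of the flux and of
   [kap]. *)
have fl0 : flux0 t = a 0 * eta t 0 + b 0 * kap t 0.
  rewrite /eta /dQ /JJ /Q0 /tprim mulrA divff// mul1r.
  rewrite prim0// prim0// (_ : (fun s => prim ta h s 0) = fun=> 0); last by apply/funext => s; rewrite prim0.
  rewrite (_ : (fun s => prim tb q s 0) = fun=> 0); last by apply/funext => s; rewrite prim0.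
  by rewrite sint_cst; ring.
have kp0 : kap t 0 = kap0 t by rewrite /kap /dH /H0 prim0// prim0// subrr subr0.
move=> E.
have : k2 * flux0 t + k1 * kap0 t = D t.
  have k1E' : k1 = k1 / L * L by rewrite -mulrA LL mulr1.
  have k2E' : k2 = k2 / L * L by rewrite -mulrA LL mulr1.
  rewrite k1E' k2E'; move: E {k1E' k2E'}.
  move: (k1 / L) (k2 / L) (flux0 t) (kap0 t) (sint (dH t) 0 L) (sint (dQ t) 0 L).
  move: (dH t L) (dQ t L) (tprim ta h t L) (tprim tb q t L) => ? ? ? ?.
  move: (sint (tprim ta h t) 0 L) (sint (tprim tb q t) 0 L) (D t) => S1 S2 DD r1 r2 F K SH SQ.
  by clear sfl skap fl0 kp0 LL; lra.
have k2a : k2 * a 0 = alh by rewrite k2E mulrAC mulVf// mul1r.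
move=> <-; rewrite fl0 kp0 k1E -k2a.
by move: (eta t 0) (kap0 t) => *; ring.
Qed.

Lemma eta_L t : eta t L = 0.
Proof. by rewrite /eta /flux0; ring. Qed.

Lemma flux_eq t x : a x * eta t x + b x * kap t x = flux0 t - dQ t x - JJ t x.
Proof.
rewrite /eta mulrA divff// mul1r.
by move: (flux0 t - dQ t x - JJ t x) (b x * kap t x) => *; ring.
Qed.

Lemma time_integrated_solution : exists (eta kap : R -> R -> R) (E K : R -> R),
  [/\ [/\ cont2 eta, cont2 kap, continuous E & continuous K],
   forall t psi, 0 <= t -> continuous psi -> sint (fun s => ip (h s) psi) 0 t = ip (eta t) psi,
   forall t psi, 0 <= t -> continuous psi -> sint (fun s => ip (q s) psi) 0 t = ip (kap t) psi,
   (forall t x, kap t x = K t - (prim one h t x - H0 x)) /\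
   (forall t x, a x * eta t x + b x * kap t x =
      E t - (prim one q t x - Q0 x) - (tprim ta h t x + tprim tb q t x)) &
   (forall t, eta t L = 0) /\
   (forall t, 0 <= t -> alh * eta t 0 + alq * kap t 0 = D t)].
Proof.
exists eta, kap, flux0, kap0; split; [split|..].
- exact: eta_cont2.
- exact: kap_cont2.
- exact: flux0_cont.
- exact: kap0_cont.
- exact: h_time_integral.
- exact: q_time_integral.
- by split=> // t x; rewrite flux_eq.
- by split; [exact: eta_L|exact: boundary0].
Qed.

End TimeIntegratedSolution.

(** * Double averages as second differences *)

Section SecondDifference.
Context {R : realType} (e : R).
Hypothesis e0 : 0 < e.

(* Applied to the second primitive of G, this is the average of G(t + r + s) over r, s in [0, e]. *)
Definition sdiff (f : R -> R) (t : R) : R := (e ^+ 2)^-1 * (f (t + 2 * e) - 2 * f (t + e) + f t).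

Lemma sdiff_cont2 (G : R -> R -> R) : cont2 G -> cont2 (fun t x => sdiff (G ^~ x) t).
Proof.
move=> cG; apply: cont2M; first exact: cont2_cst.
have sh k : continuous (fun t : R => t + k) by move=> t; apply: cvgD => //; exact: cvg_cst.
apply: cont2D => //; apply: cont2B; first exact: (@cont2_comp1 _ G _ cG (sh (2 * e))).
apply: cont2M; first exact: cont2_cst.
exact: (@cont2_comp1 _ G _ cG (sh e)).
Qed.

Lemma sdiff_derive (f df : R -> R) (t : R) : (forall s : R, is_derive s 1 f (df s)) ->
  is_derive t 1 (sdiff f) (sdiff df t).
Proof.
move=> Df.
have sh k : is_derive t 1 (fun s => f (s + k)) (df (t + k)).
  have D1 := drv_eq (drvD (drv_id t) (drvC k t)) (addr0 1).
  by apply: drv_eq (drv_comp D1 (Df (t + k))) _; rewrite mulr1.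
exact: (drvZ _ (drvD (drvB (sh (2 * e)) (drvZ 2 (sh e))) (Df t))).
Qed.

(** This removes the initial data, which appear in the twice integrated equations multiplied by
    t. *)
Lemma sdiff_affine (k l : R) t : sdiff (fun s => s * k + l) t = 0.
Proof. by rewrite /sdiff; ring. Qed.

Lemma sdiffD (f g : R -> R) t : sdiff (fun s => f s + g s) t = sdiff f t + sdiff g t.
Proof. by rewrite /sdiff; ring. Qed.

Lemma sdiffB (f g : R -> R) t : sdiff (fun s => f s - g s) t = sdiff f t - sdiff g t.
Proof. by rewrite /sdiff; ring. Qed.

Lemma sdiffZ k (f : R -> R) t : sdiff (fun s => k * f s) t = k * sdiff f t.
Proof. by rewrite /sdiff; ring. Qed.

Lemma eq_sdiff (f g : R -> R) t : 0 <= t -> (forall s, 0 <= s -> f s = g s) ->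
  sdiff f t = sdiff g t.
Proof.
move=> t0 fg; rewrite /sdiff !fg// addr_ge0// ?mulr_ge0// ltW//.
Qed.

Lemma sdiff_sint (G : R -> R -> R) a b t : (forall s, locint (G s)) ->
  sdiff (fun s => sint (G s) a b) t = sint (fun x => sdiff (G ^~ x) t) a b.
Proof.
move=> lG; rewrite /sdiff.
have l2 := locintZ 2 (lG (t + e)).
have l1 := locintB (lG (t + 2 * e)) l2.
by rewrite (sintZ _ _ _ (locintD l1 (lG t))) (sintD _ _ l1 (lG t)) (sintB _ _ (lG _) l2) sintZ.
Qed.

Lemma sdiff_bound (G : R -> R) (K t : R) : locint G ->
  (forall s, t <= s <= t + 2 * e -> `|G s| <= K) ->
  `|sdiff (fun s => sint (sint G 0) 0 s) t| <= K.
Proof.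
move=> lG GK.
have cF : continuous (sint G 0) by exact: sint_locint_cont.
(* The second difference is f(e) - f(0) divided by e^2, and f'(r) is an integral of [G] over an
   interval of length [e]. *)
pose f r := sint (sint G 0) 0 (t + e + r) - sint (sint G 0) 0 (t + r).
pose df r := sint G 0 (t + e + r) - sint G 0 (t + r).
have Dsh (k r : R) : is_derive r 1 (fun r => sint (sint G 0) 0 (k + r)) (sint G 0 (k + r)).
  have D1 := drv_eq (drvD (drvC k r) (drv_id r)) (add0r 1).
  by apply: drv_eq (drv_comp D1 (@sint_derive _ _ 0 (k + r) cF)) _; rewrite mulr1.
have Df (r : R) : is_derive r 1 f (df r) by exact: drvB.
have csh (k : R) : continuous (fun r : R => sint G 0 (k + r)).
  move=> r; apply: (cvg_comp (fun r => k + r) (sint G 0) _ (cF (k + r))).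
  by apply: cvgD => //; exact: cvg_cst.
have cdf : continuous df by move=> r; apply: cvgB; exact: csh.
have E := sint_FTC2 0 e Df cdf.
have dfK (r : R) : 0 <= r <= e -> `|df r| <= K * e.
  move=> /andP[r0 re]; rewrite /df.
  have -> : sint G 0 (t + e + r) - sint G 0 (t + r) = sint G (t + r) (t + e + r).
    by rewrite -(sint_chasles 0 (t + r) (t + e + r) lG); ring.
  have le : t + r <= t + e + r by rewrite lerD2r lerDl ltW.
  have -> : K * e = K * ((t + e + r) - (t + r)) by ring.
  apply: sint_norm_le => // s /andP[s1 s2]; apply: GK; apply/andP; split.
    by rewrite (le_trans _ s1)// lerDl.
  by rewrite (le_trans s2)//; lra.
have := sint_norm_le (ltW e0) (continuous_locint cdf) dfK.
rewrite E subr0 /f !addr0 => H.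
have -> : sdiff (fun s => sint (sint G 0) 0 s) t = (e ^+ 2)^-1 *
   (sint (sint G 0) 0 (t + e + e) - sint (sint G 0) 0 (t + e) - (sint (sint G 0) 0 (t + e) - sint (sint G 0) 0 t)).
  by rewrite /sdiff (_ : t + 2 * e = t + e + e); ring.
have e2 : 0 < e ^+ 2 by exact: exprn_gt0.
have ei : 0 <= (e ^+ 2)^-1 by rewrite invr_ge0 ltW.
rewrite normrM (ger0_norm ei) ler_pdivrMl//.
by rewrite [e ^+ 2 * K]mulrC expr2 mulrA.
Qed.

End SecondDifference.

(** * The doubly averaged solution *)

Section SmoothedSolution.
Context {R : realType} (L : R) (L0 : 0 < L).
Implicit Types (t x : R) (phi psi dphi : R -> R).
Variables (a b ta tb : R -> R) (alh alq : R) (h q : R -> R -> R) (h0 q0 d : R -> R).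
Hypotheses (ca : continuous a) (cb : continuous b).
Hypotheses (cta : continuous ta) (ctb : continuous tb) (a_neq0 : forall x, a x != 0).
Hypotheses (hC : L2curve L h) (qC : L2curve L q) (h0L : L2loc h0) (q0L : L2loc q0).
Hypothesis ld : locint d.

Hypothesis weak : forall (phi1 phi2 dphi1 dphi2 : R -> R) (m : R),
  (forall x, is_derive x 1 phi1 (dphi1 x)) -> (forall x, is_derive x 1 phi2 (dphi2 x)) ->
  continuous dphi1 -> continuous dphi2 ->
  phi1 L + b L * phi2 L = 0 -> a 0 * phi2 0 = m * alh -> phi1 0 + b 0 * phi2 0 = m * alq ->
  forall t, 0 <= t ->
  ip L (h t) phi1 + ip L (q t) phi2 - (ip L h0 phi1 + ip L q0 phi2) =
  sint (fun s => ip L (h s) (fun x => a x * dphi2 x - ta x * phi2 x)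
     + ip L (q s) (fun x => dphi1 x + b x * dphi2 x - tb x * phi2 x)) 0 t + m * sint d 0 t.

Let L0' : 0 <= L := ltW L0.

(* The equations are stated integrated in x, so that no derivative in x is involved. *)
Record smooth_solution (delta : R -> R) (w1 w2 dw1 dw2 : R -> R -> R) : Prop := SmoothSolution {
  ss_cont1 : cont2 w1; ss_cont2 : cont2 w2; ss_dcont1 : cont2 dw1; ss_dcont2 : cont2 dw2;
  ss_der1 : forall t x, is_derive t 1 (w1 ^~ x) (dw1 t x);
  ss_der2 : forall t x, is_derive t 1 (w2 ^~ x) (dw2 t x);
  ss_eq1 : forall t x, 0 <= t -> 0 <= x <= L -> w2 t x = w2 t 0 - sint (dw1 t) 0 x;
  ss_eq2 : forall t x, 0 <= t -> 0 <= x <= L ->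
    a x * w1 t x + b x * w2 t x = (a 0 * w1 t 0 + b 0 * w2 t 0)
      - sint (fun y => dw2 t y + ta y * w1 t y + tb y * w2 t y) 0 x;
  ss_bcL : forall t, 0 <= t -> w1 t L = 0;
  ss_bc0 : forall t, 0 <= t -> alh * w1 t 0 + alq * w2 t 0 = delta t }.

(** [om1] and [om2] represent the second time primitives of [h] and [q], so their second differences
    are double averages, whose time derivatives are the second differences of [eta] and [kap]. The
    averaged solution is linked to (h, q) only through pairings with continuous functions. *)
Lemma smoothing e : 0 < e -> exists w1 w2 dw1 dw2 : R -> R -> R,
  [/\ smooth_solution (sdiff e (sint (sint d 0) 0)) w1 w2 dw1 dw2,
   forall t psi, 0 <= t -> continuous psi ->
     ip L (w1 t) psi = sdiff e (sint (sint (fun r => ip L (h r) psi) 0) 0) t &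
   forall t psi, 0 <= t -> continuous psi ->
     ip L (w2 t) psi = sdiff e (sint (sint (fun r => ip L (q r) psi) 0) 0) t].
Proof.
move=> e0.
have cD : continuous (sint d 0) by exact: sint_locint_cont.
have [eta [kap [E [K [[ceta ckap cE cK] heta qkap [kapE fluxE] [etaL bc0]]]]]] :=
  time_integrated_solution L0 ca cb cta ctb a_neq0 hC qC h0L q0L weak.
pose om1 t x := sint (fun s => eta s x) 0 t.
pose om2 t x := sint (fun s => kap s x) 0 t.
have com1 : cont2 om1.
  by apply: cont2_swap; apply: (@sint_cont2 _ (fun x s => eta s x)); exact: cont2_swap.
have com2 : cont2 om2.
  by apply: cont2_swap; apply: (@sint_cont2 _ (fun x s => kap s x)); exact: cont2_swap.
have Dom1 t x : is_derive t 1 (om1 ^~ x) (eta t x).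
  by apply: (@sint_derive _ (fun s => eta s x)); exact: cont2_fst.
have Dom2 t x : is_derive t 1 (om2 ^~ x) (kap t x).
  by apply: (@sint_derive _ (fun s => kap s x)); exact: cont2_fst.
pose one : R -> R := fun=> 1.
have c1 : continuous one by move=> x; exact: cvg_cst.
(* These four identities rewrite the primitives of [h] and [q] in the equations in terms of the
   continuous functions [eta] and [kap]. *)
have P1h t x : 0 <= t -> 0 <= x <= L -> tprim L one h t x = sint (eta t) 0 x.
  move=> t0 xL.
  rewrite (time_integral_primitive L0 hC (@cont2_snd _ eta t ceta) (fun psi cp => heta t psi t0 cp) c1 xL).
  by congr sint; apply/funext => y; rewrite mul1r.
have P1q t x : 0 <= t -> 0 <= x <= L -> tprim L one q t x = sint (kap t) 0 x.
  move=> t0 xL.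
  rewrite (time_integral_primitive L0 qC (@cont2_snd _ kap t ckap) (fun psi cp => qkap t psi t0 cp) c1 xL).
  by congr sint; apply/funext => y; rewrite mul1r.
have Pth t x : 0 <= t -> 0 <= x <= L -> tprim L ta h t x = sint (fun y => ta y * eta t y) 0 x.
  move=> t0 xL.
  exact: (time_integral_primitive L0 hC (@cont2_snd _ eta t ceta) (fun psi cp => heta t psi t0 cp) cta xL).
have Ptq t x : 0 <= t -> 0 <= x <= L -> tprim L tb q t x = sint (fun y => tb y * kap t y) 0 x.
  move=> t0 xL.
  exact: (time_integral_primitive L0 qC (@cont2_snd _ kap t ckap) (fun psi cp => qkap t psi t0 cp) ctb xL).
have lfst (G : R -> R -> R) x : cont2 G -> locint (G ^~ x).
  by move=> cG; apply: continuous_locint; exact: cont2_fst.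
have lsnd (G : R -> R -> R) t : cont2 G -> locint (G t).
  by move=> cG; apply: continuous_locint; exact: cont2_snd.
have cph := prim_cont2 L0 c1 hC; have cpq := prim_cont2 L0 c1 qC.
(* A further integration in time: the primitives [H0] and [Q0] of the initial data do not depend on
   time and pick up a factor t. *)
have omE2 t x : 0 <= t -> 0 <= x <= L ->
    om2 t x = sint K 0 t - sint (eta t) 0 x + t * H0 L h0 x.
  move=> t0 xL; rewrite -P1h// /om2.
  rewrite (_ : (fun s => kap s x) = fun s => (K s - prim L one h s x) + H0 L h0 x); last first.
    by apply/funext => s; rewrite kapE; ring.
  have lK := continuous_locint cK; have lp := @lfst _ x cph.
  by rewrite (sintD _ _ (locintB lK lp) (locint_cst _)) (sintB _ _ lK lp) sint_cst subr0 [_ * t]mulrC.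
have cea : cont2 (fun s y => ta y * eta s y) by apply: cont2M => //; exact: cont2_of2.
have ckb : cont2 (fun s y => tb y * kap s y) by apply: cont2M => //; exact: cont2_of2.
have omE1 t x : 0 <= t -> 0 <= x <= L ->
    a x * om1 t x + b x * om2 t x = sint E 0 t - sint (kap t) 0 x + t * Q0 L q0 x
     - sint (fun y => ta y * om1 t y + tb y * om2 t y) 0 x.
  move=> t0 xL; have le1 := @lfst _ x ceta; have lk1 := @lfst _ x ckap.
  rewrite /om1 /om2 -(sintZ (a x) _ _ le1) -(sintZ (b x) _ _ lk1).
  rewrite -(sintD _ _ (locintZ (a x) le1) (locintZ (b x) lk1)).
  have -> : sint (fun s => a x * eta s x + b x * kap s x) 0 t =
     sint (fun s => (E s - prim L one q s x) + Q0 L q0 x -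
       sint (fun y => ta y * eta s y + tb y * kap s y) 0 x) 0 t.
    apply: eq_sint => // s /andP[s0 st].
    rewrite fluxE Pth// Ptq// (sintD _ _ (@lsnd _ s cea) (@lsnd _ s ckb)).
    by move: (sint (fun y => ta y * eta s y) 0 x) (sint (fun y => tb y * kap s y) 0 x) => *; ring.
  have lE := continuous_locint cE; have lp := @lfst _ x cpq.
  have cab : cont2 (fun s y => ta y * eta s y + tb y * kap s y) by exact: cont2D.
  have l4 : locint (fun s => sint (fun y => ta y * eta s y + tb y * kap s y) 0 x).
    by apply: continuous_locint; exact: (@sint_param_cont _ _ 0 x cab).
  have l3 := locintD (locintB lE lp) (locint_cst (Q0 L q0 x)).
  rewrite (sintB _ _ l3 l4) (sintD _ _ (locintB lE lp) (locint_cst _)) (sintB _ _ lE lp) sint_cst subr0.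
  rewrite (sint_fubini _ _ _ _ cab) [_ * t]mulrC -P1q//; congr (_ - _).
  congr sint; apply/funext => y.
  have l5 := @lfst _ y ceta; have l6 := @lfst _ y ckap.
  by rewrite (sintD _ _ (locintZ (ta y) l5) (locintZ (tb y) l6)) !sintZ.
have z0L : 0 <= (0 : R) <= L by rewrite lexx L0'.
have H00 : H0 L h0 0 = 0 by rewrite /H0 prim0.
have Q00 : Q0 L q0 0 = 0 by rewrite /Q0 prim0.
pose w1 t x := sdiff e (om1 ^~ x) t.
pose w2 t x := sdiff e (om2 ^~ x) t.
pose dw1 t x := sdiff e (eta ^~ x) t.
pose dw2 t x := sdiff e (kap ^~ x) t.
have w2E t x : 0 <= t -> 0 <= x <= L -> w2 t x = sdiff e (sint K 0) t - sint (dw1 t) 0 x.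
  move=> t0 xL; rewrite /w2.
  rewrite (eq_sdiff e0 t0 (fun s s0 => omE2 s x s0 xL)).
  rewrite (sdiffD e (fun s => sint K 0 s - sint (eta s) 0 x) (fun s => s * H0 L h0 x)).
  have -> : sdiff e (fun s => s * H0 L h0 x) t = 0.
    by rewrite -(sdiff_affine e (H0 L h0 x) 0 t); congr sdiff; apply/funext => s; rewrite addr0.
  by rewrite addr0 sdiffB sdiff_sint// => s; exact: lsnd.
have w1E t x : 0 <= t -> 0 <= x <= L -> a x * w1 t x + b x * w2 t x =
    sdiff e (sint E 0) t - sint (fun y => dw2 t y + ta y * w1 t y + tb y * w2 t y) 0 x.
  move=> t0 xL; rewrite /w1 /w2 -!sdiffZ -sdiffD.
  rewrite (eq_sdiff e0 t0 (fun s s0 => omE1 s x s0 xL)).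
  have com s : locint (fun y => ta y * om1 s y + tb y * om2 s y).
    apply: (lsnd (fun s y => ta y * om1 s y + tb y * om2 s y)).
    by apply: cont2D; apply: cont2M => //; exact: cont2_of2.
  rewrite (sdiffB e (fun s => sint E 0 s - sint (kap s) 0 x + s * Q0 L q0 x)).
  rewrite (sdiffD e (fun s => sint E 0 s - sint (kap s) 0 x) (fun s => s * Q0 L q0 x)).
  have -> : sdiff e (fun s => s * Q0 L q0 x) t = 0.
    by rewrite -(sdiff_affine e (Q0 L q0 x) 0 t); congr sdiff; apply/funext => s; rewrite addr0.
  rewrite addr0 sdiffB sdiff_sint; last by move=> s; exact: lsnd.
  rewrite (@sdiff_sint _ e (fun s y => ta y * om1 s y + tb y * om2 s y) 0 x t com).
  have cdw2 : cont2 dw2 by exact: sdiff_cont2.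
  have cw : cont2 (fun s y => sdiff e (fun s => ta y * om1 s y + tb y * om2 s y) s).
    apply: (@sdiff_cont2 _ e (fun s y => ta y * om1 s y + tb y * om2 s y)).
    by apply: cont2D; apply: cont2M => //; exact: cont2_of2.
  rewrite -addrA -opprD; congr (_ - _).
  rewrite -(sintD _ _ (@lsnd _ t cdw2) (@lsnd _ t cw)); congr sint; apply/funext => y.
  by rewrite (sdiffD e (fun s => ta y * om1 s y)) !sdiffZ addrA.
exists w1, w2, dw1, dw2; split.
- split.
  + exact: sdiff_cont2.
  + exact: sdiff_cont2.
  + exact: sdiff_cont2.
  + exact: sdiff_cont2.
  + by move=> t x; exact: sdiff_derive.
  + by move=> t x; exact: sdiff_derive.
  + by move=> t x t0 xL; rewrite (w2E _ _ t0 xL) (w2E _ _ t0 z0L) sintxx subr0.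
  + by move=> t x t0 xL; rewrite (w1E _ _ t0 xL) (w1E _ _ t0 z0L) sintxx subr0.
  + move=> t t0; rewrite /w1 -(sdiff_affine e 0 0 t); apply: (eq_sdiff e0 t0) => s s0.
    rewrite /om1 (_ : (fun s => eta s L) = fun=> 0) ?sint_cst; first by ring.
    by apply/funext => r.
  + move=> t t0; rewrite /w1 /w2 -!sdiffZ -sdiffD; apply: (eq_sdiff e0 t0) => s s0.
    have le1 := @lfst _ 0 ceta; have lk1 := @lfst _ 0 ckap.
    rewrite /om1 /om2 -(sintZ alh _ _ le1) -(sintZ alq _ _ lk1).
    rewrite -(sintD _ _ (locintZ alh le1) (locintZ alq lk1)).
    by apply: eq_sint => // r /andP[r0 _]; exact: bc0.
- move=> t psi t0 cp.
  have cep s : locint (fun x => om1 s x * psi x).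
    by apply: (lsnd (fun s x => om1 s x * psi x)); apply: cont2M => //; exact: cont2_of2.
  rewrite /ip (_ : (fun x => _) = (fun x => sdiff e (fun s => om1 s x * psi x) t)); last first.
    apply/funext => x; rewrite /w1 mulrC -sdiffZ; congr sdiff.
    by apply/funext => s; rewrite mulrC.
  rewrite -(@sdiff_sint _ e (fun s x => om1 s x * psi x) 0 L t cep).
  apply: (eq_sdiff e0 t0) => s s0.
  have cg : cont2 (fun r x => eta r x * psi x) by apply: cont2M => //; exact: cont2_of2.
  rewrite (_ : sint (sint _ 0) 0 s = sint (fun r => sint (fun x => eta r x * psi x) 0 L) 0 s); last first.
    by apply: eq_sint => // r /andP[r0 _]; exact: heta.
  rewrite (sint_fubini _ _ _ _ cg); congr sint; apply/funext => x.
  have le1 := @lfst _ x ceta.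
  rewrite /om1 mulrC -sintZ//; congr sint; apply/funext => r.
  by rewrite mulrC.
- move=> t psi t0 cp.
  have cep s : locint (fun x => om2 s x * psi x).
    by apply: (lsnd (fun s x => om2 s x * psi x)); apply: cont2M => //; exact: cont2_of2.
  rewrite /ip (_ : (fun x => _) = (fun x => sdiff e (fun s => om2 s x * psi x) t)); last first.
    apply/funext => x; rewrite /w2 mulrC -sdiffZ; congr sdiff.
    by apply/funext => s; rewrite mulrC.
  rewrite -(@sdiff_sint _ e (fun s x => om2 s x * psi x) 0 L t cep).
  apply: (eq_sdiff e0 t0) => s s0.
  have cg : cont2 (fun r x => kap r x * psi x) by apply: cont2M => //; exact: cont2_of2.
  rewrite (_ : sint (sint _ 0) 0 s = sint (fun r => sint (fun x => kap r x * psi x) 0 L) 0 s); last first.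
    by apply: eq_sint => // r /andP[r0 _]; exact: qkap.
  rewrite (sint_fubini _ _ _ _ cg); congr sint; apply/funext => x.
  have le1 := @lfst _ x ckap.
  rewrite /om2 mulrC -sintZ//; congr sint; apply/funext => r.
  by rewrite mulrC.
Qed.

End SmoothedSolution.

(** Coefficients extended by [clip] need not be differentiable at 0 and L, so the derivative is
    required only inside; continuity covers the endpoints. *)
Lemma sint_FTC2_oo (R : realType) (f F : R -> R) (b : R) : 0 < b -> continuous f -> continuous F ->
  (forall x : R, 0 < x < b -> is_derive x 1 F (f x)) -> sint f 0 b = F b - F 0.
Proof.
move=> b0 cf cF DF.
pose G x := sint f 0 x - F x.
have DG (x : R) : x \in `]0, b[%R -> is_derive x 1 G 0.
  rewrite in_itv/= => xb.
  by apply: drv_eq (drvB (sint_derive 0 x cf) (DF _ xb)) _; rewrite subrr.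
have cG : {within `[0, b], continuous G}.
  apply: continuous_subspaceT => x; apply: cvgB; [exact: sint_cont|exact: cF].
have [c _] := MVT b0 DG cG.
by rewrite mul0r /G sintxx; lra.
Qed.

(** * Decay of the quadratic functional along smooth solutions *)

Section EnergyEstimate.
Context {R : realType} (L : R) (L0 : 0 < L).
Implicit Types (t x : R).
Variables (a b ta tb da db : R -> R) (alh alq : R).
Variables (P11 P12 P22 m11 m12 m22 dm11 dm12 dm22 : R -> R).
Variables (c0 c1 C nu : R).
Hypotheses (ca : continuous a) (cb : continuous b) (cta : continuous ta) (ctb : continuous tb).
Hypotheses (cda : continuous da) (cdb : continuous db).
Hypothesis a_neq0 : forall x, a x != 0.
Hypotheses (cP11 : continuous P11) (cP12 : continuous P12) (cP22 : continuous P22).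
Hypotheses (cm11 : continuous m11) (cm12 : continuous m12) (cm22 : continuous m22).
Hypotheses (cdm11 : continuous dm11) (cdm12 : continuous dm12) (cdm22 : continuous dm22).
Hypothesis Da : forall x, 0 < x < L -> is_derive x 1 a (da x).
Hypothesis Db : forall x, 0 < x < L -> is_derive x 1 b (db x).
Hypothesis Dm11 : forall x, 0 < x < L -> is_derive x 1 m11 (dm11 x).
Hypothesis Dm12 : forall x, 0 < x < L -> is_derive x 1 m12 (dm12 x).
Hypothesis Dm22 : forall x, 0 < x < L -> is_derive x 1 m22 (dm22 x).
(** The four identities say M = P A entry by entry; the two expressions for [m12] encode the
    symmetry of M. *)
Hypothesis m11E : forall x, m11 x = P12 x * a x.
Hypothesis m12E : forall x, m12 x = P11 x + P12 x * b x.
Hypothesis m21E : forall x, m12 x = P22 x * a x.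
Hypothesis m22E : forall x, m22 x = P12 x + P22 x * b x.

Definition qform (k11 k12 k22 h q : R) := k11 * h ^+ 2 + 2 * k12 * h * q + k22 * q ^+ 2.

(** The entries of -M_x + B^T P + P B, where da + ta and db + tb form the second row of B. *)
Let S11 x := - dm11 x + 2 * P12 x * (da x + ta x).
Let S12 x := - dm12 x + P12 x * (db x + tb x) + P22 x * (da x + ta x).
Let S22 x := - dm22 x + 2 * P22 x * (db x + tb x).

Hypotheses (nu0 : 0 < nu) (C0 : 0 <= C).
Hypothesis S_ge : forall x h q, 0 <= x <= L ->
  2 * nu * qform (P11 x) (P12 x) (P22 x) h q <= qform (S11 x) (S12 x) (S22 x) h q.
Hypothesis bcL : 0 <= m22 L.
Hypothesis bc0 : forall h q, qform (m11 0) (m12 0) (m22 0) h q <= C * (alh * h + alq * q) ^+ 2.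

Variables (delta : R -> R) (w1 w2 dw1 dw2 : R -> R -> R) (D : R).
Hypothesis ss : smooth_solution L a b ta tb alh alq delta w1 w2 dw1 dw2.
Hypothesis deltaD : forall t, 0 <= t -> `|delta t| <= D.

Definition energy t := sint (fun x => qform (P11 x) (P12 x) (P22 x) (w1 t x) (w2 t x)) 0 L.
Let dE t x := 2 * (P11 x * w1 t x + P12 x * w2 t x) * dw1 t x
  + 2 * (P12 x * w1 t x + P22 x * w2 t x) * dw2 t x.

Let qform_cont2 (k11 k12 k22 : R -> R) : continuous k11 -> continuous k12 -> continuous k22 ->
  cont2 (fun t x => qform (k11 x) (k12 x) (k22 x) (w1 t x) (w2 t x)).
Proof.
move=> c11 c12 c22; have cw1 := ss_cont1 ss; have cw2 := ss_cont2 ss.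
apply: cont2D; [apply: cont2D|]; repeat (apply: cont2M); try exact: cont2_of2; try exact: cont2_cst; done.
Qed.

Let dE_cont2 : cont2 dE.
Proof.
have cw1 := ss_cont1 ss; have cw2 := ss_cont2 ss.
have cd1 := ss_dcont1 ss; have cd2 := ss_dcont2 ss.
by apply: cont2D; repeat (apply: cont2M || apply: cont2D) => //; (exact: cont2_of2 || exact: cont2_cst).
Qed.

Lemma energy_derive t : is_derive t 1 energy (sint (dE t) 0 L).
Proof.
apply: (@sint_param_derive _ (fun t x => qform (P11 x) (P12 x) (P22 x) (w1 t x) (w2 t x)) dE).
- exact: qform_cont2.
- exact: dE_cont2.
- move=> s x; have D1 := ss_der1 ss s x; have D2 := ss_der2 ss s x.
  have H := drvD (drvD (drvZ (P11 x) (drvM D1 D1)) (drvZ (2 * P12 x) (drvM D1 D2)))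
    (drvZ (P22 x) (drvM D2 D2)).
  have E : (fun s => P11 x * (w1 s x * w1 s x) + 2 * P12 x * (w1 s x * w2 s x) + P22 x * (w2 s x * w2 s x))
     = (fun s => qform (P11 x) (P12 x) (P22 x) (w1 s x) (w2 s x)).
    by apply/funext => r; rewrite /qform; ring.
  move: H; rewrite E => H; apply: drv_eq H _; rewrite /dE; ring.
Qed.

Let w2_derive t x : 0 <= t -> 0 < x < L -> is_derive x 1 (w2 t) (- dw1 t x).
Proof.
move=> t0 /andP[x0 xL].
have cd : continuous (dw1 t) by apply: cont2_snd; exact: ss_dcont1 ss.
have H := drv_eq (drvB (drvC (w2 t 0) x) (sint_derive 0 x cd)) (sub0r _).
apply: near_eq_is_derive H; near=> y.
apply/esym; apply: (ss_eq1 ss) => //.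
apply/andP; split; apply/ltW; near: y; [exact: lt_nbhsr|exact: lt_nbhsl].
Unshelve. all: by end_near. Qed.

(** The integrated second equation shows that a w1 = (a w1 + b w2) - b w2 is differentiable in x;
    dividing by [a] gives [w1]. *)
Let w1_derive t x : 0 <= t -> 0 < x < L ->
  is_derive x 1 (w1 t) ((a x)^-1 * (- (dw2 t x + ta x * w1 t x + tb x * w2 t x)
    - da x * w1 t x - db x * w2 t x + b x * dw1 t x)).
Proof.
move=> t0 xI; have /andP[x0 xL] := xI.
have cw1 : continuous (w1 t) by apply: cont2_snd; exact: ss_cont1 ss.
have cw2 : continuous (w2 t) by apply: cont2_snd; exact: ss_cont2 ss.
have cd : continuous (dw2 t) by apply: cont2_snd; exact: ss_dcont2 ss.
pose rhs y := dw2 t y + ta y * w1 t y + tb y * w2 t y.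
have crhs : continuous rhs.
  move=> y; apply: cvgD; [apply: cvgD; first exact: cd|];
    by apply: cvgM; [exact: cta || exact: ctb|exact: cw1 || exact: cw2].
have Dinv : is_derive x 1 (fun y => (a y)^-1) (- (a x ^- 2) * da x).
  have Dax := Da xI.
  by have := @is_deriveV _ a x (da x) 1 (a_neq0 x) Dax.
have DF := drvB (drvB (drvC (a 0 * w1 t 0 + b 0 * w2 t 0) x) (sint_derive 0 x crhs))
  (drvM (Db xI) (w2_derive t0 xI)).
have H := drvM Dinv DF.
have H2 : is_derive x 1 (fun y => (a y)^-1 *
     (a 0 * w1 t 0 + b 0 * w2 t 0 - sint rhs 0 y - b y * w2 t y))
  ((a x)^-1 * (- rhs x - da x * w1 t x - db x * w2 t x + b x * dw1 t x)).
  apply: drv_eq H _.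
  have xI' : 0 <= x <= L by rewrite !ltW.
  rewrite -(ss_eq2 ss t0 xI').
  have -> : a x * w1 t x + b x * w2 t x - b x * w2 t x = a x * w1 t x by rewrite addrK.
  rewrite -exprVn.
  have := mulVf (a_neq0 x).
  move: (a x) (a x)^-1 => ax ai E.
  have -> : - ai ^+ 2 * da x * (ax * w1 t x) = - (ai * ax) * ai * (da x * w1 t x) by ring.
  by rewrite E; ring.
apply: near_eq_is_derive H2; near=> y.
have yI : 0 <= y <= L.
  by apply/andP; split; apply/ltW; near: y; [exact: lt_nbhsr|exact: lt_nbhsl].
by rewrite -(ss_eq2 ss t0 yI) addrK mulrA mulVf// mul1r.
Unshelve. all: by end_near. Qed.

(** With z = (w1, w2) and z_t + A z_x + B z = 0, the derivative of z^T M z in x is -2 z^T P z_t -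
    z^T S z. Integrating it, the term at L is favourable because w1 = 0 there, and the term at 0 is
    bounded through the boundary data. *)
Lemma energy_decay_rate t : 0 <= t ->
  sint (dE t) 0 L <= - (2 * nu) * energy t + C * D ^+ 2.
Proof.
move=> t0.
have cw1 : continuous (w1 t) by apply: cont2_snd; exact: ss_cont1 ss.
have cw2 : continuous (w2 t) by apply: cont2_snd; exact: ss_cont2 ss.
pose Phi x := qform (m11 x) (m12 x) (m22 x) (w1 t x) (w2 t x).
pose Sf x := qform (S11 x) (S12 x) (S22 x) (w1 t x) (w2 t x).
have cPhi : continuous Phi.
  exact: (@cont2_snd _ (fun t x => qform (m11 x) (m12 x) (m22 x) (w1 t x) (w2 t x)) t (qform_cont2 cm11 cm12 cm22)).
have cS11 : continuous S11.
  move=> y; apply: cvgD; first by apply: cvgN; exact: cdm11.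
  apply: cvgM; first by apply: cvgM; [exact: cvg_cst|exact: cP12].
  by apply: cvgD; [exact: cda|exact: cta].
have cS12 : continuous S12.
  move=> y; apply: cvgD; first apply: cvgD; first by apply: cvgN; exact: cdm12.
    by apply: cvgM; [exact: cP12|apply: cvgD; [exact: cdb|exact: ctb]].
  by apply: cvgM; [exact: cP22|apply: cvgD; [exact: cda|exact: cta]].
have cS22 : continuous S22.
  move=> y; apply: cvgD; first by apply: cvgN; exact: cdm22.
  apply: cvgM; first by apply: cvgM; [exact: cvg_cst|exact: cP22].
  by apply: cvgD; [exact: cdb|exact: ctb].
have cSf : continuous Sf.
  exact: (@cont2_snd _ (fun t x => qform (S11 x) (S12 x) (S22 x) (w1 t x) (w2 t x)) t (qform_cont2 cS11 cS12 cS22)).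
have cE : continuous (dE t) by apply: cont2_snd; exact: dE_cont2.
have cf : continuous (fun x => - dE t x - Sf x).
  by move=> y; apply: cvgB; [apply: cvgN; exact: cE|exact: cSf].
have DPhi x : 0 < x < L -> is_derive x 1 Phi (- dE t x - Sf x).
  move=> xI; have D1 := w1_derive t0 xI; have D2 := w2_derive t0 xI.
  have H := drvD (drvD (drvM (Dm11 xI) (drvM D1 D1)) (drvZ 2 (drvM (Dm12 xI) (drvM D1 D2))))
    (drvM (Dm22 xI) (drvM D2 D2)).
  have EE : (fun x => m11 x * (w1 t x * w1 t x) + 2 * (m12 x * (w1 t x * w2 t x)) + m22 x * (w2 t x * w2 t x)) = Phi.
    by apply/funext => y; rewrite /Phi /qform; ring.
  move: H; rewrite EE => H; apply: drv_eq H _.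
  rewrite /dE /Sf /qform /S11 /S12 /S22.
  have e1 := m11E x; have e2 := m12E x; have e3 := m21E x; have e4 := m22E x.
  have aa := mulVf (a_neq0 x).
  set z := (- (dw2 t x + ta x * w1 t x + tb x * w2 t x) - da x * w1 t x - db x * w2 t x + b x * dw1 t x).
  rewrite e1 e4.
  move: e2 e3 aa; rewrite /z.
  move: (w1 t x) (w2 t x) (dw1 t x) (dw2 t x) (a x)^-1 => h q dh dq ai.
  move: (a x) (b x) (ta x) (tb x) (da x) (db x) (dm11 x) (dm12 x) (dm22 x) => ax bx tax tbx dax dbx d11 d12 d22.
  move: (P11 x) (P12 x) (P22 x) (m12 x) => p11 p12 p22 mm e2 e3 aa.
  set zz := (- _ - _ - _ + _).
  (* The factor 1 / a coming from the derivative of [w1] is paired with a factor [a] of m11 = P12 a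
     and of m12 = P22 a; the second pairing is where the symmetry of M enters. *)
  transitivity (d11 * (h * h) + 2 * (d12 * (h * q)) + d22 * (q * q)
     + 2 * p12 * (ai * ax) * zz * h + 2 * mm * ai * zz * q - 2 * mm * h * dh - 2 * (p12 + p22 * bx) * q * dh).
    by ring.
  have -> : 2 * mm * ai * zz * q = 2 * p22 * (ai * ax) * zz * q by rewrite e3; ring.
  by rewrite aa e2 /zz; ring.
have FTC := sint_FTC2_oo L0 cf cPhi DPhi.
have lE := continuous_locint cE; have lS := continuous_locint cSf.
have IE : sint (dE t) 0 L = Phi 0 - Phi L - sint Sf 0 L.
  move: FTC; rewrite (sintB _ _ (locintN lE) lS) sintN//.
  by move: (sint (dE t) 0 L) (sint Sf 0 L) (Phi 0) (Phi L) => *; lra.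
have PhiL : 0 <= Phi L.
  by rewrite /Phi /qform (ss_bcL ss t0) expr0n/= mulr0 mulr0 mul0r !add0r mulr_ge0// sqr_ge0.
have Phi0 : Phi 0 <= C * D ^+ 2.
  apply: le_trans (bc0 _ _) _; apply: ler_wpM2l => //.
  rewrite (ss_bc0 ss t0) -(real_normK (num_real (delta t))) lerXn2r ?nnegrE//.
    exact: le_trans (deltaD t0).
  exact: deltaD.
have SV : 2 * nu * energy t <= sint Sf 0 L.
  have lP : locint (fun x => qform (P11 x) (P12 x) (P22 x) (w1 t x) (w2 t x)).
    apply: continuous_locint.
    exact: (@cont2_snd _ (fun t x => qform (P11 x) (P12 x) (P22 x) (w1 t x) (w2 t x)) t (qform_cont2 cP11 cP12 cP22)).
  rewrite /energy -sintZ//; apply: le_sint => //.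
  - exact: ltW.
  - exact: locintZ.
  - by move=> x xI; exact: S_ge.
rewrite IE; move: PhiL Phi0 SV.
by move: (Phi L) (Phi 0) (energy t) (sint Sf 0 L) => *; lra.
Qed.

Lemma energy_estimate t : 0 <= t ->
  energy t <= expR (- (2 * nu) * t) * energy 0 + C * D ^+ 2 / (2 * nu).
Proof.
set K := C * D ^+ 2 / (2 * nu).
have nu2 : 0 < 2 * nu by exact: mulr_gt0.
have nn : 2 * nu != 0 by rewrite gt_eqF.
have K0 : 0 <= K by apply: divr_ge0; [rewrite mulr_ge0// sqr_ge0|exact: ltW].
rewrite le_eqVlt => /predU1P[<-|t0]; first by rewrite mulr0 expR0 mul1r lerDl.
have KE : 2 * nu * K = C * D ^+ 2 by rewrite /K mulrCA divff// mulr1.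
(* Gronwall argument: [K] is the equilibrium of y' = -2 nu y + C D^2, so [G] has nonpositive
   derivative at nonnegative times. *)
pose G s := expR (2 * nu * s) * (energy s - K).
pose dG s := (expR (2 * nu * s) * (2 * nu * 1)) * (energy s - K) + expR (2 * nu * s) * (sint (dE s) 0 L - 0).
have DG (s : R) : is_derive s 1 G (dG s).
  have D1 := drvB (energy_derive s) (drvC K s).
  have D0 : is_derive s 1 (fun s => expR (2 * nu * s)) (expR (2 * nu * s) * (2 * nu * 1)).
    exact: (drv_comp (drvZ (2 * nu) (drv_id s)) (is_derive_expR _)).
  exact: (drvM D0 D1).
have cG : {within `[0, t], continuous G}.
  by apply: continuous_subspaceT; exact: is_derive1_continuous DG.
have [c cI E] := MVT t0 (fun s _ => DG s) cG.
have dG0 : dG c <= 0.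
  move: cI; rewrite in_itv/= => /andP[/ltW c_0 _].
  rewrite /dG mulr1 subr0 -mulrA -mulrDr; apply: mulr_ge0_le0; first exact: expR_ge0.
  have := energy_decay_rate c_0; rewrite -KE.
  by move: (sint (dE c) 0 L) (energy c) => *; lra.
have : G t <= G 0.
  rewrite -subr_le0 E subr0 mulrC; apply: mulr_ge0_le0 => //; exact: ltW.
rewrite /G mulr0 expR0 mul1r => H.
have ex : expR (- (2 * nu) * t) * expR (2 * nu * t) = 1 by rewrite -expRD mulNr addNr expR0.
have H2 : expR (- (2 * nu) * t) * (expR (2 * nu * t) * (energy t - K)) <= expR (- (2 * nu) * t) * (energy 0 - K).
  by apply: ler_wpM2l => //; exact: expR_ge0.
move: H2; rewrite mulrA ex mul1r => H2.
have : expR (- (2 * nu) * t) * (energy 0 - K) <= expR (- (2 * nu) * t) * energy 0.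
  by apply: ler_wpM2l; [exact: expR_ge0|rewrite gerBl].
by move: H2; move: (energy t) (expR _ * (_ - _)) (expR _ * energy 0) => *; lra.
Qed.

End EnergyEstimate.

(** * From averaged solutions to weak solutions *)

Section PassageToTheLimit.
Context {R : realType} (L : R) (L0 : 0 < L).
Implicit Types (t x : R) (phi psi chi dphi : R -> R).

Let L0' : 0 <= L := ltW L0.

Lemma ip2_le (u1 u2 v1 v2 : R -> R) : L2loc u1 -> L2loc u2 -> L2loc v1 -> L2loc v2 ->
  `|ip L u1 v1 + ip L u2 v2| <=
  Num.sqrt (nsq L u1 + nsq L u2) * Num.sqrt (nsq L v1 + nsq L v2).
Proof.
move=> l1 l2 l3 l4; apply: le_trans (ler_normD _ _) _.
have h1 := ip_le L0 l1 l3; have h2 := ip_le L0 l2 l4.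
apply: le_trans (lerD h1 h2) _.
have n1 := nsq_ge0 L0 u1; have n2 := nsq_ge0 L0 u2.
have n3 := nsq_ge0 L0 v1; have n4 := nsq_ge0 L0 v2.
set A := Num.sqrt (nsq L u1); set B := Num.sqrt (nsq L v1).
set E := Num.sqrt (nsq L u2); set F := Num.sqrt (nsq L v2).
have A0 : 0 <= A by exact: sqrtr_ge0.
have B0 : 0 <= B by exact: sqrtr_ge0.
have E0 : 0 <= E by exact: sqrtr_ge0.
have F0 : 0 <= F by exact: sqrtr_ge0.
have -> : Num.sqrt (nsq L u1 + nsq L u2) * Num.sqrt (nsq L v1 + nsq L v2) =
          Num.sqrt ((A ^+ 2 + E ^+ 2) * (B ^+ 2 + F ^+ 2)).
  by rewrite !sqr_sqrtr// sqrtrM// addr_ge0.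
have X0 : 0 <= A * B + E * F by rewrite addr_ge0 ?mulr_ge0.
rewrite -[leLHS](ger0_norm X0) -sqrtr_sqr ler_wsqrtr//.
have -> : (A ^+ 2 + E ^+ 2) * (B ^+ 2 + F ^+ 2) = (A * B + E * F) ^+ 2 + (A * F - E * B) ^+ 2 by ring.
by rewrite lerDl sqr_ge0.
Qed.

Lemma nsq_curve_cont (U : R -> R -> R) : L2curve L U -> continuous (fun t => nsq L (U t)).
Proof.
move=> cU t; have lU := cU.1.
have c1 : continuous (fun s => ip L (U s) (U t)) by exact: ip_curve_cont.
rewrite /continuous_at.
have E : (fun s => nsq L (U s)) =
    (fun s => nsq L (fun x => U s x - U t x) + (2 * ip L (U s) (U t) - ip L (U t) (U t))).
  apply/funext => s.
  have l1 := L2loc_sqr (L2locB (lU s) (lU t)); have l2 := L2loc_mul (lU s) (lU t).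
  have l3 := L2loc_mul (lU t) (lU t).
  rewrite /nsq /ip -(sintZ _ _ _ l2) -(sintB _ _ (locintZ 2 l2) l3).
  rewrite -(sintD _ _ l1 (locintB (locintZ 2 l2) l3)); congr sint; apply/funext => x.
  by ring.
rewrite E (_ : nsq L (U t) = 0 + (2 * ip L (U t) (U t) - ip L (U t) (U t))); last first.
  have -> : nsq L (U t) = ip L (U t) (U t) by [].
  by ring.
apply: cvgD; first exact: cU.2.
by apply: cvgB; [apply: cvgM; [exact: cvg_cst|exact: c1]|exact: cvg_cst].
Qed.

Lemma sdiff_cst (e k t : R) : 0 < e -> sdiff e (sint (sint (fun=> k) 0) 0) t = k.
Proof.
move=> e0.
have E s : sint (sint (fun=> k) 0) 0 s = k * (s * s / 2).
  have D (r : R) : is_derive r 1 (fun r => k * (r * r / 2)) (k * r).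
    apply: drv_eq (drvZ k (drvM (drvM (drv_id r) (drv_id r)) (drvC (2^-1) r))) _.
    by field.
  rewrite (_ : sint (fun=> k) 0 = fun r => k * r); last by apply/funext => r; rewrite sint_cst subr0.
  have ck : continuous (fun r : R => k * r) by move=> r; apply: cvgM => //; exact: cvg_cst.
  by rewrite (sint_FTC2 0 s D ck); ring.
rewrite /sdiff !E.
by field; rewrite gt_eqF.
Qed.

Lemma sdiff_near (e eta t : R) (G : R -> R) : 0 < e -> continuous G ->
  (forall s, t <= s <= t + 2 * e -> `|G s - G t| <= eta) ->
  `|sdiff e (sint (sint G 0) 0) t - G t| <= eta.
Proof.
move=> e0 cG H.
have lG := continuous_locint cG; have lk := locint_cst (G t).
have := sdiff_bound e0 (locintB lG lk) H.
have -> : sdiff e (fun s => sint (sint (fun s => G s - G t) 0) 0 s) t =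
   sdiff e (sint (sint G 0) 0) t - sdiff e (sint (sint (fun=> G t) 0) 0) t.
  rewrite -sdiffB; congr sdiff; apply/funext => s.
  have l1 : locint (sint G 0) by apply: continuous_locint; exact: sint_cont.
  have l2 : locint (sint (fun=> G t) 0).
    by apply: continuous_locint; apply: sint_cont => x; exact: cvg_cst.
  by rewrite -(sintB _ _ l1 l2); congr sint; apply/funext => r; rewrite (sintB _ _ lG lk).
rewrite (sdiff_cst (G t) t e0) => H'; exact: H'.
Qed.

Variables (a b ta tb : R -> R) (alh alq : R) (h q : R -> R -> R) (h0 q0 d : R -> R).
Hypotheses (ca : continuous a) (cb : continuous b).
Hypotheses (cta : continuous ta) (ctb : continuous tb) (a_neq0 : forall x, a x != 0).
Hypotheses (hC : L2curve L h) (qC : L2curve L q) (h0L : L2loc h0) (q0L : L2loc q0).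
Hypothesis ld : locint d.
Hypothesis weak : forall (phi1 phi2 dphi1 dphi2 : R -> R) (m : R),
  (forall x, is_derive x 1 phi1 (dphi1 x)) -> (forall x, is_derive x 1 phi2 (dphi2 x)) ->
  continuous dphi1 -> continuous dphi2 ->
  phi1 L + b L * phi2 L = 0 -> a 0 * phi2 0 = m * alh -> phi1 0 + b 0 * phi2 0 = m * alq ->
  forall t, 0 <= t ->
  ip L (h t) phi1 + ip L (q t) phi2 - (ip L h0 phi1 + ip L q0 phi2) =
  sint (fun s => ip L (h s) (fun x => a x * dphi2 x - ta x * phi2 x)
     + ip L (q s) (fun x => dphi1 x + b x * dphi2 x - tb x * phi2 x)) 0 t + m * sint d 0 t.

Variables (P11 P12 P22 : R -> R) (c0 c1 C nu D : R).
Hypotheses (cP11 : continuous P11) (cP12 : continuous P12) (cP22 : continuous P22).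
Hypotheses (c0_gt0 : 0 < c0) (c1_gt0 : 0 < c1) (C0 : 0 <= C) (nu0 : 0 < nu) (D0 : 0 <= D).
Hypothesis P_bounds : forall x u v, 0 <= x <= L ->
  c0 * (u ^+ 2 + v ^+ 2) <= qform (P11 x) (P12 x) (P22 x) u v <= c1 * (u ^+ 2 + v ^+ 2).
Hypothesis energy_le : forall delta w1 w2 dw1 dw2,
  smooth_solution L a b ta tb alh alq delta w1 w2 dw1 dw2 ->
  (forall t, 0 <= t -> `|delta t| <= D) -> forall t, 0 <= t ->
  energy L P11 P12 P22 w1 w2 t <=
  expR (- (2 * nu) * t) * energy L P11 P12 P22 w1 w2 0 + C * D ^+ 2 / (2 * nu).
Hypothesis dD : forall s, 0 <= s -> `|d s| <= D.

Let N2 s := nsq L (h s) + nsq L (q s).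

Let N2_ge0 s : 0 <= N2 s. Proof. by apply: addr_ge0; exact: nsq_ge0. Qed.

Let N2_cont : continuous N2.
Proof. by move=> s; apply: cvgD; [exact: (nsq_curve_cont hC)|exact: (nsq_curve_cont qC)]. Qed.

Let energy_bounds w1 w2 t : cont2 w1 -> cont2 w2 ->
  c0 * (nsq L (w1 t) + nsq L (w2 t)) <= energy L P11 P12 P22 w1 w2 t
  <= c1 * (nsq L (w1 t) + nsq L (w2 t)).
Proof.
move=> cw1 cw2.
have l1 : L2loc (w1 t) by apply: continuous_L2loc; exact: cont2_snd.
have l2 : L2loc (w2 t) by apply: continuous_L2loc; exact: cont2_snd.
have s1 := L2loc_sqr l1; have s2 := L2loc_sqr l2; have s12 := L2loc_mul l1 l2.
have lP : locint (fun x => qform (P11 x) (P12 x) (P22 x) (w1 t x) (w2 t x)).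
  have cc1 : continuous (w1 t) by exact: cont2_snd.
  have cc2 : continuous (w2 t) by exact: cont2_snd.
  apply: continuous_locint => x; apply: cvgD; [apply: cvgD|].
  - by apply: cvgM; [exact: cP11|apply: cvgM; exact: cc1].
  - apply: cvgM; last exact: cc2.
    by apply: cvgM; [apply: cvgM; [exact: cvg_cst|exact: cP12]|exact: cc1].
  - by apply: cvgM; [exact: cP22|apply: cvgM; exact: cc2].
rewrite /nsq -(sintD _ _ s1 s2) -!(sintZ _ _ _ (locintD s1 s2)).
apply/andP; split; apply: le_sint => //; try by apply: locintZ; exact: locintD.
- by move=> x xI; have /andP[] := P_bounds (w1 t x) (w2 t x) xI.
- by move=> x xI; have /andP[] := P_bounds (w1 t x) (w2 t x) xI.
Qed.

Let close (G : R -> R) (t eta : R) : continuous G -> 0 < eta ->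
  exists2 e : R, 0 < e & forall s, t <= s <= t + 2 * e -> `|G s - G t| <= eta.
Proof.
move=> cG eta0; have /cvgrPdist_le /(_ _ eta0) [e /= e0 He] := cG t.
exists (e / 4); first by rewrite divr_gt0.
move=> s /andP[s1 s2]; rewrite distrC; apply: He; rewrite /= ltr_norml.
by lra.
Qed.

Let bound t : R := c1 / c0 * expR (- (2 * nu) * t) * N2 0 + C * D ^+ 2 / (2 * nu) / c0.

(** At time t the averaged solution approaches (h, q) through pairings with continuous functions.
    The norm bound is therefore transferred to each pairing separately, and back to the norm by
    [L2_dual_bound]. *)
Lemma weak_solution_estimate t : 0 <= t -> Num.sqrt (N2 t) <= Num.sqrt (bound t).
Proof.
move=> t0; apply: (L2_dual_bound L0' (hC.1 t) (qC.1 t)); first exact: sqrtr_ge0.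
move=> psi chi cpsi cchi; rewrite -/(ip L (h t) psi) -/(ip L (q t) chi) -/(nsq L psi) -/(nsq L chi).
set S := Num.sqrt (nsq L psi + nsq L chi); have S0 : 0 <= S by exact: sqrtr_ge0.
have lpsi := continuous_L2loc cpsi; have lchi := continuous_L2loc cchi.
pose G s := ip L (h s) psi + ip L (q s) chi.
have cGh (u : R -> R) : L2loc u -> continuous (fun s => ip L (h s) u) by exact: ip_curve_cont.
have cGq (u : R -> R) : L2loc u -> continuous (fun s => ip L (q s) u) by exact: ip_curve_cont.
have cG : continuous G by move=> s; apply: cvgD; [exact: cGh|exact: cGq].
have c10 : 0 < c1 / c0 by exact: divr_gt0.
(* [eta] bounds both the oscillation of the pairing just after t and that of the squared norm just
   after 0; the averaging length [e] serves both purposes. *)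
have main eta : 0 < eta -> `|G t| <= eta + Num.sqrt (bound t + c1 / c0 * eta) * S.
  move=> eta0.
  have [e1 e10 He1] := @close G t eta cG eta0.
  have [e2 e20 He2] := @close N2 0 eta N2_cont eta0.
  pose e := Num.min e1 e2.
  have e0 : 0 < e by rewrite /e lt_min e10.
  have ee1 : e <= e1 by rewrite /e ge_min lexx.
  have ee2 : e <= e2 by rewrite /e ge_min lexx orbT.
  have [w1 [w2 [dw1 [dw2 [ss ip1 ip2]]]]] :=
    smoothing L0 ca cb cta ctb a_neq0 hC qC h0L q0L ld weak e0.
  have cw1 := ss_cont1 ss; have cw2 := ss_cont2 ss.
  have lw1 s : L2loc (w1 s) by apply: continuous_L2loc; exact: cont2_snd.
  have lw2 s : L2loc (w2 s) by apply: continuous_L2loc; exact: cont2_snd.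
  have delta_le s : 0 <= s -> `|sdiff e (sint (sint d 0) 0) s| <= D.
    move=> s0; apply: sdiff_bound => // r /andP[r0 _]; apply: dD.
    exact: le_trans s0 r0.
  have En := energy_le ss delta_le t0.
  have sum s (u v : R -> R) : 0 <= s -> continuous u -> continuous v ->
      ip L (w1 s) u + ip L (w2 s) v =
      sdiff e (sint (sint (fun r => ip L (h r) u + ip L (q r) v) 0) 0) s.
    move=> s0 cu cv; rewrite ip1// ip2// -sdiffD; congr sdiff; apply/funext => r.
    have lu := continuous_locint (cGh _ (continuous_L2loc cu)).
    have lv := continuous_locint (cGq _ (continuous_L2loc cv)).
    have l1 : locint (sint (fun r => ip L (h r) u) 0).
      by apply: continuous_locint; exact: sint_locint_cont.
    have l2 : locint (sint (fun r => ip L (q r) v) 0).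
      by apply: continuous_locint; exact: sint_locint_cont.
    by rewrite -(sintD _ _ l1 l2); congr sint; apply/funext => r'; rewrite (sintD _ _ lu lv).
  pose W s := nsq L (w1 s) + nsq L (w2 s).
  have W_ge0 s : 0 <= W s by apply: addr_ge0; exact: nsq_ge0.
  (* Pairing the averaged solution at time 0 with itself gives an average of pairings of (h, q) with
     it over [0, 2e], each at most M sqrt(W 0). Hence W 0 <= M sqrt(W 0), so sqrt(W 0) <= M. *)
  have W0 : W 0 <= N2 0 + eta.
    have N0 : 0 <= N2 0 + eta by apply: addr_ge0; [exact: N2_ge0|exact: ltW].
    set M := Num.sqrt (N2 0 + eta).
    have MM : M ^+ 2 = N2 0 + eta by rewrite sqr_sqrtr.
    have cu : continuous (w1 0) by exact: cont2_snd.
    have cv : continuous (w2 0) by exact: cont2_snd.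
    have lG : locint (fun r => ip L (h r) (w1 0) + ip L (q r) (w2 0)).
      by apply: continuous_locint => r; apply: cvgD; [exact: cGh|exact: cGq].
    have GM s : 0 <= s <= 0 + 2 * e -> `|ip L (h s) (w1 0) + ip L (q s) (w2 0)| <= M * Num.sqrt (W 0).
      move=> /andP[s0 se].
      apply: le_trans (ip2_le (hC.1 s) (qC.1 s) (lw1 0) (lw2 0)) _.
      apply: ler_wpM2r; first exact: sqrtr_ge0.
      apply: ler_wsqrtr.
      have : `|N2 s - N2 0| <= eta.
        by apply: He2; rewrite s0 (le_trans se)// lerD2l ler_pM2l.
      by rewrite ler_norml => /andP[_]; rewrite lerBlDl.
    have := sdiff_bound e0 lG GM.
    have -> : sdiff e (fun s => sint (sint (fun r => ip L (h r) (w1 0) + ip L (q r) (w2 0)) 0) 0 s) 0 = W 0.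
      by rewrite -(sum 0).
    rewrite ger0_norm// => H.
    have := sqrtr_ge0 (W 0); have := sqr_sqrtr (W_ge0 0).
    have M0 : 0 <= M by exact: sqrtr_ge0.
    move: H; move: (Num.sqrt (W 0)) => X H XX X0.
    have XM : X <= M.
      rewrite leNgt; apply/negP => MX.
      have : M * X < X * X by rewrite ltr_pM2r// (le_lt_trans M0).
      by rewrite -expr2 XX ltNge H.
    by rewrite -MM -XX lerXn2r.
  have /andP[lowt _] := energy_bounds t cw1 cw2.
  have /andP[_ up0] := energy_bounds 0 cw1 cw2.
  have ex0 : 0 <= expR (- (2 * nu) * t) by exact: expR_ge0.
  have ex1 : expR (- (2 * nu) * t) <= 1.
    by rewrite -expR0 ler_expR mulNr oppr_le0 mulr_ge0// mulr_ge0// ltW.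
  have Wt : W t <= bound t + c1 / c0 * eta.
    rewrite -(ler_pM2l c0_gt0); apply: le_trans lowt _; apply: le_trans En _.
    have h1 : expR (- (2 * nu) * t) * energy L P11 P12 P22 w1 w2 0 <=
      expR (- (2 * nu) * t) * (c1 * (N2 0 + eta)).
      by apply: ler_wpM2l => //; apply: le_trans up0 _; apply: ler_wpM2l => //; exact: ltW.
    have h2 : expR (- (2 * nu) * t) * (c1 * eta) <= c1 * eta.
      by rewrite ler_piMl// mulr_ge0// ltW.
    have -> : c0 * (bound t + c1 / c0 * eta) = expR (- (2 * nu) * t) * (c1 * N2 0) + C * D ^+ 2 / (2 * nu) + c1 * eta.
      rewrite /bound.
      have cc : c0 * c0^-1 = 1 by rewrite divff// gt_eqF.
      move: (expR _) (N2 0) (C * D ^+ 2 / (2 * nu)) => E1 E2 E3.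
      have -> : c0 * (c1 / c0 * E1 * E2 + E3 / c0 + c1 / c0 * eta) =
        (c0 * c0^-1) * (E1 * (c1 * E2) + E3 + c1 * eta) by ring.
      by rewrite cc mul1r.
    move: h1 h2.
    rewrite (mulrDr c1) (mulrDr (expR (- (2 * nu) * t))).
    move: (expR _ * energy _ _ _ _ _ _ _) (expR _ * (c1 * N2 0)) (expR _ * (c1 * eta)) (C * _ / _) => *; lra.
  have GG : `|sdiff e (sint (sint G 0) 0) t - G t| <= eta.
    apply: sdiff_near => // s /andP[s1 s2]; apply: He1.
    by rewrite s1 (le_trans s2)// lerD2l ler_pM2l.
  have : `|sdiff e (sint (sint G 0) 0) t| <= Num.sqrt (W t) * S.
    rewrite -(sum t psi chi t0 cpsi cchi).
    exact: ip2_le.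
  have : Num.sqrt (W t) * S <= Num.sqrt (bound t + c1 / c0 * eta) * S.
    by apply: ler_wpM2r => //; apply: ler_wsqrtr.
  have : `|G t| <= `|sdiff e (sint (sint G 0) 0) t - G t| + `|sdiff e (sint (sint G 0) 0) t|.
    by rewrite [X in X + _]distrC -{1}(subrK (sdiff e (sint (sint G 0) 0) t) (G t)) ler_normD.
  move: GG; move: (`|G t|) (`|_ - G t|) (`|sdiff _ _ _|) (Num.sqrt _ * S) (Num.sqrt _ * S) => *; lra.
rewrite -/(G t); apply/ler_addgt0Pl => eps eps0.
have B0 : 0 <= bound t.
  rewrite /bound addr_ge0//.
    by apply: mulr_ge0 (N2_ge0 0); apply: mulr_ge0 (expR_ge0 _); exact: ltW.
  by rewrite divr_ge0 ?(ltW c0_gt0)// divr_ge0// ?mulr_ge0 ?sqr_ge0// ltW.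
set k := Num.sqrt (c1 / c0); have k0 : 0 <= k by exact: sqrtr_ge0.
(* [main] is used with tolerance r^2, whose contribution under the square root is at most k r
   outside it; then r^2 + k r S <= r (1 + k S) <= eps. *)
pose r := Num.min 1 (eps / (1 + k * S)).
have den : 0 < 1 + k * S by rewrite ltr_pwDl// mulr_ge0.
have r0 : 0 < r by rewrite /r lt_min ltr01 divr_gt0.
have r1 : r <= 1 by rewrite /r ge_min lexx.
have re : r * (1 + k * S) <= eps by rewrite -ler_pdivlMr// /r ge_min lexx orbT.
have r20 : 0 < r ^+ 2 by exact: exprn_gt0.
apply: le_trans (main _ r20) _.
have -> : bound t + c1 / c0 * r ^+ 2 = Num.sqrt (bound t) ^+ 2 + (k * r) ^+ 2.
  by rewrite sqr_sqrtr// exprMn sqr_sqrtr// ltW.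
have sK : Num.sqrt (Num.sqrt (bound t) ^+ 2 + (k * r) ^+ 2) <= Num.sqrt (bound t) + k * r.
  have K0 := sqrtr_ge0 (bound t).
  have kr : 0 <= k * r by rewrite mulr_ge0// ltW.
  rewrite -[leRHS]ger0_norm ?addr_ge0// -sqrtr_sqr ler_wsqrtr//.
  rewrite sqrrD -addrA [X in _ <= _ + X]addrC lerD2l lerDl.
  by rewrite mulrn_wge0// mulr_ge0.
have := ler_wpM2r S0 sK; have : r ^+ 2 <= r by rewrite expr2 ler_piMl// ltW.
move: re; move: (Num.sqrt (bound t)) (Num.sqrt (_ + _)) => X Y re h1 h2.
by move: re h1 h2; rewrite mulrDl mulrDr mulr1 mulrA [r * k]mulrC; lra.
Qed.

End PassageToTheLimit.

(** * Differential calculus on the segment [0, L] *)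

Section SegmentCalculus.
Context {R : realType} (L : R) (L0 : 0 < L).
Implicit Types (p dp g : R -> R) (x y l : R).

Local Notation I := (`[0, L]%classic).
Local Notation clip := (clip L).

Let L0' : 0 <= L := ltW L0.

Lemma clip_within x : clip y @[y --> x] --> within I (nbhs (clip x)).
Proof.
move=> A /= [e /= e0 He].
have := clip_cont (x := x) (L := L) => /cvgrPdist_lt /(_ _ e0).
apply: filterS => y Hy /=; apply: He => //=.
by rewrite in_itv/= clip_itv.
Qed.

Lemma within_clip_cont g : {within I, continuous g} -> continuous (g \o clip).
Proof.
move=> cg x; apply: (cvg_comp clip g (clip_within (x := x))).
have Ix : I (clip x) by rewrite /= in_itv/= clip_itv.
by move/subspace_continuousP : cg => /(_ _ Ix).
Qed.

Definition is_dseg p x l := diff_quot L p x --> l.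

(** Since L > 0, every point of the segment is a limit of other points of it, at the ends from one
    side; so limits of difference quotients are unique and [dseg] computes them. *)
Lemma seg_proper x : I x -> ProperFilter (within I (x^')).
Proof.
rewrite /= in_itv/= => /andP[x0 xL]; apply: Build_ProperFilter_ex => A [e /= e0 He].
pose y := if x < L then Num.min L (x + e / 2) else Num.max 0 (x - e / 2).
have yI : 0 <= y <= L.
  rewrite /y; case: ifPn => xL'.
    by rewrite le_min L0' ge_min lexx/= andbT; lra.
  by rewrite le_max lexx ge_max L0'/=; lra.
have yx : y != x.
  rewrite /y; case: ifPn => xL'.
    by rewrite gt_eqF// lt_min xL'/=; lra.
  have xE : L <= x by rewrite leNgt.
  rewrite lt_eqF// gt_max (lt_le_trans L0 xE)/=.
  by rewrite ltrBlDr ltrDl divr_gt0.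
have ye : `|x - y| < e.
  rewrite /y; case: ifPn => xL'; rewrite ltr_norml.
    by rewrite /Num.min; case: ifPn; rewrite -?leNgt; lra.
  by rewrite /Num.max; case: ifPn; move: xL'; rewrite -?leNgt; lra.
by exists y; apply: He => //=; rewrite in_itv.
Qed.

Lemma is_dsegE p x l : I x -> is_dseg p x l -> derivable_seg L p x /\ dseg L p x = l.
Proof.
move=> Ix H; have FF := seg_proper Ix.
split; first by apply/cvg_ex; exists l.
exact: (cvg_lim (@Rhausdorff R) H).
Qed.

Lemma derivable_is_dseg p x : derivable_seg L p x -> is_dseg p x (dseg L p x).
Proof. by move=> H. Qed.

Let FF x : Filter (within I (x^')). Proof. exact: within_filter. Qed.

Lemma is_dseg_cvg p x l : is_dseg p x l -> p y @[y --> within I (x^')] --> p x.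
Proof.
move=> H.
have -> : p = fun y => p x + (y - x) * ((y - x)^-1 * (p y - p x)).
  apply/funext => y; have [->|yx] := eqVneq y x; first by rewrite subrr mul0r addr0.
  by rewrite mulrA mulfV ?subr_eq0// mul1r addrC subrK.
rewrite [X in _ --> X](_ : _ = p x + (x - x) * l); last by rewrite !subrr !mul0r.
apply: cvgD; first exact: cvg_cst.
apply: cvgM; last exact: H.
apply: cvgB; last exact: cvg_cst.
by move=> A nA; apply: cvg_within; apply: nbhs_dnbhs.
Qed.

Lemma is_dseg_cst k x : is_dseg (fun=> k) x 0.
Proof.
rewrite /is_dseg /diff_quot (_ : (fun y => _) = fun=> 0); first exact: cvg_cst.
by apply/funext => y; rewrite subrr mulr0.
Qed.

Lemma is_dsegD p q x l m : is_dseg p x l -> is_dseg q x m ->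
  is_dseg (fun y => p y + q y) x (l + m).
Proof.
move=> Hp Hq; rewrite /is_dseg /diff_quot (_ : (fun y => _) =
  fun y => (y - x)^-1 * (p y - p x) + (y - x)^-1 * (q y - q x)); first exact: cvgD.
by apply/funext => y; ring.
Qed.

Lemma is_dsegM p q x l m : is_dseg p x l -> is_dseg q x m ->
  is_dseg (fun y => p y * q y) x (l * q x + p x * m).
Proof.
move=> Hp Hq; rewrite /is_dseg /diff_quot (_ : (fun y => _) =
  fun y => ((y - x)^-1 * (p y - p x)) * q y + p x * ((y - x)^-1 * (q y - q x))).
  apply: cvgD; first by apply: cvgM => //; exact: is_dseg_cvg Hq.
  by apply: cvgM => //; exact: cvg_cst.
by apply/funext => y; ring.
Qed.

(** Caratheodory's slope function for [F] avoids dividing by p y - p x, which may vanish for y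
    arbitrarily close to x. *)
Lemma is_dseg_comp p (F : R -> R) x l m : is_dseg p x l -> is_derive (p x) 1 F m ->
  is_dseg (fun y => F (p y)) x (m * l).
Proof.
move=> Hp /is_derive1_caratheodory [g [gE cg gm]].
rewrite /is_dseg /diff_quot (_ : (fun y => _) = fun y => g (p y) * ((y - x)^-1 * (p y - p x))).
  apply: cvgM => //; rewrite -gm.
  exact: (cvg_comp p g (is_dseg_cvg Hp) cg).
by apply/funext => y; rewrite gE; ring.
Qed.

Lemma is_dseg_ext p q x l : I x -> (forall y, I y -> p y = q y) -> is_dseg p x l -> is_dseg q x l.
Proof.
move=> Ix pq; apply: cvg_trans; apply: near_eq_cvg.
by rewrite near_withinE; apply: nearW => y Iy; rewrite !pq.
Qed.

Lemma derive_is_dseg p x l : is_derive x 1 p l -> is_dseg p x l.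
Proof.
move=> H; have : is_dseg (fun y => p y) x (l * 1).
  apply: is_dseg_comp H.
  rewrite /is_dseg /diff_quot.
  have : (fun=> 1 : R) y @[y --> within I (x^')] --> (1 : R) by exact: cvg_cst.
  apply: cvg_trans; apply: near_eq_cvg; rewrite near_withinE.
  have : \forall y \near x^', y != x by exact: nbhs_dnbhs_neq.
  by apply: filterS => y yx _; rewrite mulVf// subr_eq0.
by rewrite mulr1.
Qed.

Lemma is_dseg_derive p x l : 0 < x < L -> is_dseg p x l -> is_derive x 1 p l.
Proof.
move=> /andP[x0 xL] H.
have H' : (h^-1 *: (p (h *: 1 + x) - p x) @[h --> 0^'] --> l)%R.
  apply/cvgrPdist_le => e e0; move/cvgrPdist_le : H => /(_ _ e0) [d /= d0 Hd].
  pose r := Num.min d (Num.min x (L - x)).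
  have r0 : 0 < r by rewrite !lt_min d0 x0 subr_gt0.
  rewrite near_withinE; exists r => // h /= h1 hn.
  have : `|h| < r by move: h1; rewrite sub0r normrN.
  rewrite !lt_min => /and3P[hd hx hL].
  have := Hd (h + x); rewrite /= (_ : x - (h + x) = - h); last by ring.
  rewrite normrN => /(_ hd).
  rewrite -subr_eq0 addrK => /(_ hn).
  rewrite in_itv/= => Hh; rewrite [h *: 1]mulr1; apply: Hh.
  by move: hx hL; rewrite !ltr_norml; lra.
apply: DeriveDef; first by apply/cvg_ex; exists l.
exact: (cvg_lim (@Rhausdorff R) H').
Qed.

(** Carrying an explicit derivative lets sums, products and compositions be computed without
    evaluating [dseg]; continuity on the segment becomes continuity on R through [clip]. *)
Definition C1d p dp := (forall x, I x -> is_dseg p x (dp x)) /\ continuous (dp \o clip).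

Lemma C1_segP p : C1_seg L p -> C1d p (dseg L p).
Proof.
move=> [dp cp]; split; last exact: within_clip_cont.
by move=> x Ix; apply: derivable_is_dseg; apply: dp.
Qed.

Lemma C1d_dseg p dp x : C1d p dp -> I x -> dseg L p x = dp x.
Proof. by move=> [H _] Ix; have [] := is_dsegE Ix (H x Ix). Qed.

Lemma C1d_cont p dp : C1d p dp -> continuous (p \o clip).
Proof.
move=> [H _]; apply: within_clip_cont; apply/subspace_continuousP => x Ix.
have := is_dseg_cvg (H x Ix) => c A nA.
have := c A nA => -[e /= e0 He]; exists e => //= y xy Iy.
by have [->|yx] := eqVneq y x; [exact: nbhs_singleton|exact: He].
Qed.

Lemma C1d_derive p dp x : C1d p dp -> 0 < x < L -> is_derive x 1 (p \o clip) (dp (clip x)).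
Proof.
move=> [H _] xI; have /andP[x0 xL] := xI.
have Ix : I x by rewrite /= in_itv/= !ltW.
rewrite clip_id ?ltW//; have D := is_dseg_derive xI (H x Ix).
apply: near_eq_is_derive D; near=> y; rewrite /= clip_id//.
by apply/andP; split; apply/ltW; near: y; [exact: lt_nbhsr|exact: lt_nbhsl].
Unshelve. all: by end_near. Qed.

Let cfun_add (f g : R -> R) : continuous f -> continuous g -> continuous (fun x => f x + g x).
Proof. by move=> cf cg x; apply: cvgD; [exact: cf|exact: cg]. Qed.

Let cfun_mul (f g : R -> R) : continuous f -> continuous g -> continuous (fun x => f x * g x).
Proof. by move=> cf cg x; apply: cvgM; [exact: cf|exact: cg]. Qed.

Lemma C1d_cst k : C1d (fun=> k) (fun=> 0).
Proof. by split=> [x _|x]; [exact: is_dseg_cst|exact: cvg_cst]. Qed.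

Lemma C1dD p q dp dq : C1d p dp -> C1d q dq -> C1d (fun y => p y + q y) (fun y => dp y + dq y).
Proof.
move=> [Hp cp] [Hq cq]; split; last exact: cfun_add.
by move=> x Ix; apply: is_dsegD; [exact: Hp|exact: Hq].
Qed.

Lemma C1dM p q dp dq : C1d p dp -> C1d q dq ->
  C1d (fun y => p y * q y) (fun y => dp y * q y + p y * dq y).
Proof.
move=> Hp Hq; have c1 := C1d_cont Hp; have c2 := C1d_cont Hq.
split; last by apply: cfun_add; apply: cfun_mul => //; [case: Hp|case: Hq].
by move=> x Ix; apply: is_dsegM; [apply: Hp.1|apply: Hq.1].
Qed.

Lemma C1dZ k p dp : C1d p dp -> C1d (fun y => k * p y) (fun y => k * dp y).
Proof.
move=> Hp; have := C1dM (C1d_cst k) Hp; congr C1d.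
by apply/funext => y; rewrite mul0r add0r.
Qed.

Lemma C1dB p q dp dq : C1d p dp -> C1d q dq -> C1d (fun y => p y - q y) (fun y => dp y - dq y).
Proof.
move=> Hp /(C1dZ (-1)) Hq; have := C1dD Hp Hq.
by congr C1d; apply/funext => y; rewrite mulN1r.
Qed.

Lemma C1d_comp p dp (F dF : R -> R) : C1d p dp -> (forall u : R, is_derive u 1 F (dF u)) ->
  continuous dF -> C1d (fun y => F (p y)) (fun y => dF (p y) * dp y).
Proof.
move=> Hp DF cF; have c1 := C1d_cont Hp; split.
  by move=> x Ix; apply: is_dseg_comp => //; exact: Hp.1.
apply: cfun_mul; last by case: Hp.
by move=> x; apply: (cvg_comp (p \o clip) dF (c1 x)); exact: cF.
Qed.

Lemma C1d_sqrt p dp : C1d p dp -> (forall x, I x -> 0 < p x) ->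
  C1d (fun y => Num.sqrt (p y)) (fun y => (2 * Num.sqrt (p y))^-1 * dp y).
Proof.
move=> Hp p0; have c1 := C1d_cont Hp; split.
  by move=> x Ix; apply: is_dseg_comp; [exact: Hp.1|apply: is_derive1_sqrt; exact: p0].
apply: cfun_mul; last by case: Hp.
have cs : continuous (fun x => Num.sqrt ((p \o clip) x)).
  by move=> x; apply: (cvg_comp (p \o clip) Num.sqrt (c1 x)); exact: sqrt_continuous.
move=> x; apply: cvgV.
  by rewrite mulf_neq0 ?gt_eqF// sqrtr_gt0 p0//= in_itv/= clip_itv.
by apply: cvgM; [exact: cvg_cst|exact: cs].
Qed.

Lemma eq_C1d p q dp : (forall y, I y -> p y = q y) -> C1d p dp -> C1d q dp.
Proof. by move=> pq [Hp cp]; split=> // x Ix; apply: is_dseg_ext pq _ => //; exact: Hp. Qed.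

End SegmentCalculus.

(** * Uniform bounds for quadratic forms, and the boundary form at x = 0 *)

Section QuadraticForms.
Context {R : realType} (L : R) (L0 : 0 < L).
Implicit Types (k : R -> R) (x u v : R).

(** For a positive definite 2 x 2 matrix, det / tr is a lower bound of the smallest eigenvalue. It
    is a continuous function of x, so it has a positive minimum on [0, L]. *)
Lemma qform_lower k11 k12 k22 : continuous k11 -> continuous k12 -> continuous k22 ->
  (forall x u v, 0 <= x <= L -> (u != 0) || (v != 0) -> 0 < qform (k11 x) (k12 x) (k22 x) u v) ->
  exists2 m : R, 0 < m & forall x u v, 0 <= x <= L ->
    m * (u ^+ 2 + v ^+ 2) <= qform (k11 x) (k12 x) (k22 x) u v.
Proof.
move=> c11 c12 c22 H.
pose tr x := k11 x + k22 x; pose det x := k11 x * k22 x - k12 x * k12 x.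
have k11_gt0 x : 0 <= x <= L -> 0 < k11 x.
  by move=> xL; have := H x 1 0 xL; rewrite oner_eq0/= /qform => /(_ isT); lra.
have k22_gt0 x : 0 <= x <= L -> 0 < k22 x.
  by move=> xL; have := H x 0 1 xL; rewrite oner_eq0 orbT /qform => /(_ isT); lra.
have tr_gt0 x : 0 <= x <= L -> 0 < tr x.
  by move=> xL; rewrite addr_gt0// ?k11_gt0// k22_gt0.
have det_gt0 x : 0 <= x <= L -> 0 < det x.
  move=> xL; have k0 := k11_gt0 x xL.
  (* The form takes the value k11 det at (-k12, k11). *)
  have := H x (- k12 x) (k11 x) xL; rewrite (gt_eqF k0) orbT => /(_ isT).
  have -> : qform (k11 x) (k12 x) (k22 x) (- k12 x) (k11 x) = k11 x * det x.
    by rewrite /qform /det; ring.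
  by rewrite pmulr_rgt0.
have cq : {within `[0, L], continuous (fun x => det x / tr x)}.
  apply/subspace_continuousP => x /=; rewrite in_itv/= => xL.
  have ct : continuous tr by move=> y; apply: cvgD; [exact: c11|exact: c22].
  have cd : continuous det.
    by move=> y; apply: cvgB; apply: cvgM; [exact: c11|exact: c22|exact: c12|exact: c12].
  have : {for x, continuous (fun x => det x / tr x)}.
    by apply: cvgM; [exact: cd|apply: cvgV; [rewrite gt_eqF// tr_gt0|exact: ct]].
  by move=> cx; apply: cvg_within_filter; exact: cx.
have [c] := EVT_min (ltW L0) cq; rewrite in_itv/= => cL Hc.
exists (det c / tr c); first by rewrite divr_gt0 ?det_gt0 ?tr_gt0.
move=> x u v xL.
have h : det c / tr c <= det x / tr x by apply: Hc; rewrite in_itv.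
apply: le_trans (ler_wpM2r _ h) _; first by rewrite addr_ge0// sqr_ge0.
rewrite mulrAC ler_pdivrMr ?tr_gt0//.
(* Cayley-Hamilton: tr K = det + K^2, and the form with matrix K^2 is the squared length of K (u,
   v). *)
have -> : qform (k11 x) (k12 x) (k22 x) u v * tr x = det x * (u ^+ 2 + v ^+ 2)
   + ((k11 x * u + k12 x * v) ^+ 2 + (k12 x * u + k22 x * v) ^+ 2).
  by rewrite /qform /tr /det; ring.
by rewrite lerDl addr_ge0// sqr_ge0.
Qed.

Lemma qform_upper k11 k12 k22 : continuous k11 -> continuous k12 -> continuous k22 ->
  exists2 m : R, 0 < m & forall x u v, 0 <= x <= L ->
    qform (k11 x) (k12 x) (k22 x) u v <= m * (u ^+ 2 + v ^+ 2).
Proof.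
move=> c11 c12 c22.
have [K1 K10 H1] := cont2_bounded 0 0 0 L (@cont2_of2 _ _ c11).
have [K2 K20 H2] := cont2_bounded 0 0 0 L (@cont2_of2 _ _ c12).
have [K3 K30 H3] := cont2_bounded 0 0 0 L (@cont2_of2 _ _ c22).
exists (K1 + K2 + K3); first by rewrite !addr_gt0.
move=> x u v xL; have z : 0 <= (0 : R) <= 0 by rewrite lexx.
have := H1 0 x z xL; have := H2 0 x z xL; have := H3 0 x z xL.
rewrite !ler_norml => /andP[_ h3] /andP[h2' h2] /andP[_ h1].
rewrite /qform.
have e1 : k11 x * u ^+ 2 <= K1 * u ^+ 2 by apply: ler_wpM2r => //; exact: sqr_ge0.
have e3 : k22 x * v ^+ 2 <= K3 * v ^+ 2 by apply: ler_wpM2r => //; exact: sqr_ge0.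
have e2 : 2 * k12 x * u * v <= K2 * (u ^+ 2 + v ^+ 2).
  have := mulr_ge0 (_ : 0 <= K2 - k12 x) (sqr_ge0 (u + v)).
  have := mulr_ge0 (_ : 0 <= K2 + k12 x) (sqr_ge0 (u - v)).
  rewrite !subr_ge0 -lerBlDl sub0r => /(_ h2') a1 /(_ h2) a2.
  by move: a1 a2; rewrite sqrrB sqrrD; nra.
have f1 := mulr_ge0 (ltW K10) (sqr_ge0 v).
have f2 := mulr_ge0 (ltW K30) (sqr_ge0 u).
by rewrite !mulrDl !mulrDr; move: e1 e2 e3 f1 f2; rewrite mulrDr; lra.
Qed.

(* In the characteristic variables xi = l2 h + q and chi = q - l1 h the boundary condition with
   data d reads xi = k chi + k' d. *)
Lemma boundary_qform (l1 l2 p1 p2 alh alq : R) : 0 < l1 -> 0 < l2 -> 0 < p1 -> 0 < p2 ->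
  alh + alq * l1 != 0 ->
  ((alh - alq * l2) / (alh + alq * l1)) ^+ 2 < p2 / p1 * (l2 / l1) ->
  exists2 C : R, 0 <= C & forall h q,
    p1 * l1 * (l2 * h + q) ^+ 2 - p2 * l2 * (q - l1 * h) ^+ 2 <= C * (alh * h + alq * q) ^+ 2.
Proof.
move=> l10 l20 p10 p20 g0; set k := (_ / _); set r := p2 / p1 * (l2 / l1) => kr.
set g := alh + alq * l1 in g0 k kr *.
pose k' := (l1 + l2) / g.
have rk : 0 < r - k ^+ 2 by rewrite subr_gt0.
have r0 : 0 < r by rewrite /r mulr_gt0 ?divr_gt0.
(* Since p2 l2 = p1 l1 r, the form equals p1 l1 ((k chi + k' d)^2 - r chi^2). For fixed [d] its
   maximum over chi, finite because k^2 < r, is this constant times d^2. *)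
exists (p1 * l1 * (k' ^+ 2 * r / (r - k ^+ 2))).
  apply: mulr_ge0; first by rewrite mulr_ge0// ltW.
  apply: divr_ge0; last exact: ltW.
  by rewrite mulr_ge0 ?sqr_ge0// ltW.
move=> h q; set d := alh * h + alq * q; set xi := l2 * h + q; set chi := q - l1 * h.
have xiE : xi = k * chi + k' * d.
  apply: (mulfI g0).
  have -> : g * (k * chi + k' * d) = (alh - alq * l2) * chi + (l1 + l2) * d.
    have kg : g * k = alh - alq * l2 by rewrite /k mulrC divfK.
    have kg' : g * k' = l1 + l2 by rewrite /k' mulrC divfK.
    by rewrite mulrDr (mulrA g k) (mulrA g k') kg kg'.
  by rewrite /g /xi /chi /d; ring.
have rE : p2 * l2 = p1 * l1 * r.
  by rewrite /r; field; rewrite !gt_eqF.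
have alg (P s m m' z w : R) : 0 <= P -> 0 < s - m ^+ 2 ->
    P * (m * z + m' * w) ^+ 2 - P * s * z ^+ 2 <= P * (m' ^+ 2 * s / (s - m ^+ 2)) * w ^+ 2.
  move=> P0 sm; rewrite -subr_ge0.
  have -> : P * (m' ^+ 2 * s / (s - m ^+ 2)) * w ^+ 2 - (P * (m * z + m' * w) ^+ 2 - P * s * z ^+ 2)
     = P * (((s - m ^+ 2) * z - m * m' * w) ^+ 2 / (s - m ^+ 2)).
    by field; rewrite gt_eqF.
  by apply: mulr_ge0 => //; rewrite divr_ge0 ?sqr_ge0// ltW.
rewrite rE xiE; apply: alg => //.
by rewrite mulr_ge0// ltW.
Qed.

End QuadraticForms.

(** * The 2 x 2 matrices of the statement in coordinates *)

Section MatrixEntries.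
Context {R : realType}.
Implicit Types (a b p : R -> R) (x : R).

Let o1 : 'I_2 := lift ord0 ord0.

Let mx2E (k00 k01 k10 k11 : R) : (mx2 k00 k01 k10 k11 ord0 ord0 = k00) *
  (mx2 k00 k01 k10 k11 ord0 o1 = k01) * (mx2 k00 k01 k10 k11 o1 ord0 = k10) *
  (mx2 k00 k01 k10 k11 o1 o1 = k11).
Proof. by rewrite !mxE. Qed.

Let mulmx2E (A B : 'M[R]_2) i j : (A *m B) i j = A i ord0 * B ord0 j + A i o1 * B o1 j.
Proof. by rewrite mxE !big_ord_recl big_ord0 addr0. Qed.

Lemma PmxE (a b p1 p2 : R -> R) (x : R) (l1 := lambda1 a b x) (l2 := lambda2 a b x) :
  Pmx a b p1 p2 x = mx2 (p1 x * l2 ^+ 2 + p2 x * l1 ^+ 2) (p1 x * l2 - p2 x * l1)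
    (p1 x * l2 - p2 x * l1) (p1 x + p2 x).
Proof.
have o1E (i : 'I_2) : i = ord0 \/ i = o1.
  by case: i => [[|[|//]] Hi]; [left|right]; apply/val_inj.
apply/matrixP => i j; rewrite /Pmx !mulmx2E ![(_ ^T) _ _]mxE.
by have [->|->] := o1E i; have [->|->] := o1E j; rewrite !mx2E -/l1 -/l2; ring.
Qed.

Lemma mulmx_mx2 (A00 A01 A10 A11 B00 B01 B10 B11 : R) :
  mx2 A00 A01 A10 A11 *m mx2 B00 B01 B10 B11 =
  mx2 (A00 * B00 + A01 * B10) (A00 * B01 + A01 * B11)
      (A10 * B00 + A11 * B10) (A10 * B01 + A11 * B11).
Proof.
have o1E (i : 'I_2) : i = ord0 \/ i = o1.
  by case: i => [[|[|//]] Hi]; [left|right]; apply/val_inj.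
apply/matrixP => i j; rewrite !mulmx2E.
by have [->|->] := o1E i; have [->|->] := o1E j; rewrite !mx2E.
Qed.

Lemma tr_mx2 (A00 A01 A10 A11 : R) : (mx2 A00 A01 A10 A11)^T = mx2 A00 A10 A01 A11.
Proof.
have o1E (i : 'I_2) : i = ord0 \/ i = o1.
  by case: i => [[|[|//]] Hi]; [left|right]; apply/val_inj.
apply/matrixP => i j; rewrite mxE.
by have [->|->] := o1E i; have [->|->] := o1E j; rewrite !mx2E.
Qed.

Lemma dseg_mx2 (L : R) (k00 k01 k10 k11 : R -> R) x :
  dseg_mx L (fun y => mx2 (k00 y) (k01 y) (k10 y) (k11 y)) x =
  mx2 (dseg L k00 x) (dseg L k01 x) (dseg L k10 x) (dseg L k11 x).
Proof.
have o1E (i : 'I_2) : i = ord0 \/ i = o1.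
  by case: i => [[|[|//]] Hi]; [left|right]; apply/val_inj.
apply/matrixP => i j; rewrite mxE.
have [->|->] := o1E i; have [->|->] := o1E j; rewrite !mx2E; congr dseg; apply/funext => y;
  by rewrite !mx2E.
Qed.

(** The off-diagonal entries are averaged since only the symmetric part of a matrix matters for its
    form; [K] need not be presented symmetrically. *)
Lemma posdef_qform (K : 'M[R]_2) (k00 k01 k10 k11 u v : R) : K = mx2 k00 k01 k10 k11 ->
  posdef K -> (u != 0) || (v != 0) -> 0 < qform k00 ((k01 + k10) / 2) k11 u v.
Proof.
move=> KE pK uv.
pose w : 'cV[R]_2 := \matrix_(i, j) (if i == ord0 then u else v).
have w0 : w ord0 ord0 = u by rewrite mxE.
have w1 : w o1 ord0 = v by rewrite mxE.
have wn0 : w != 0.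
  apply: contraTneq uv => E; rewrite negb_or !negbK -w0 -w1 E !mxE eqxx//.
have := pK w wn0; rewrite KE.
have -> : (w^T *m mx2 k00 k01 k10 k11 *m w) 0 0 = qform k00 ((k01 + k10) / 2) k11 u v.
  rewrite mxE !big_ord_recl big_ord0 !mxE !big_ord_recl !big_ord0 !mxE /= /qform.
  by field.
by [].
Qed.

End MatrixEntries.

(** * Partial derivatives, slices and test functions independent of time *)

Section PartialDerivatives.
Context {R : realType}.

(** A directional derivative depends only on the values along one line, so the two functions may
    live on different spaces; this passes between R * R and R. *)
Lemma derive_congr (V W : normedModType R) (f : V -> R) (g : W -> R) a b v w (l : R) :
  (forall h : R, f (h *: v + a) = g (h *: w + b)) -> f a = g b ->
  is_derive a v f l -> is_derive b w g l.
Proof.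
move=> fg ab [Hd Hl].
have E : (fun h : R => h^-1 *: ((f \o shift a) (h *: v) - f a)) =
         (fun h : R => h^-1 *: ((g \o shift b) (h *: w) - g b)).
  by apply/funext => h; rewrite /= fg ab.
apply: DeriveDef; first by move: Hd; rewrite /derivable E.
by rewrite -Hl /derive E.
Qed.

Lemma Ck1_slice (G : R * R -> R) (Q x : R) : Ck 1 G ->
  is_derive x 1 (fun y => G (y, Q)) (D1 G (x, Q)).
Proof.
move=> [_ dG _ _]; have [/derivableP H _] := dG (x, Q).
apply: derive_congr H => // h.
by congr G; congr pair; rewrite /= ?scaler0 ?add0r.
Qed.

Lemma continuous_slice (G : R * R -> R) (Q : R) : continuous G -> continuous (fun y => G (y, Q)).
Proof.
move=> cG; have c2 : cont2 (fun x y => G (x, y)).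
  by move=> [x y]; have := cG (x, y); apply: cvg_trans; apply: near_eq_cvg; apply: nearW => -[].
exact: (cont2_fst (x := Q) c2).
Qed.

Lemma Ck1_space (phi dphi : R -> R) : (forall x : R, is_derive x 1 phi (dphi x)) ->
  continuous dphi -> let Phi := fun z : R * R => phi z.2 in
  [/\ Ck 1 Phi, D1 Phi = fun=> 0 & D2 Phi = fun z => dphi z.2].
Proof.
move=> Dphi cd Phi.
have H1 (z : R * R) : is_derive z ((1, 0) : R * R) Phi 0.
  have H : is_derive (0 : R) 1 (fun _ : R => phi z.2) 0 by exact: drvC.
  by apply: derive_congr H => // h; rewrite /Phi /= scaler0 add0r.
have H2 (z : R * R) : is_derive z ((0, 1) : R * R) Phi (dphi z.2).
  by apply: derive_congr (Dphi z.2).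
have E1 : D1 Phi = fun=> 0 by apply/funext => z; have [_ <-] := H1 z.
have E2 : D2 Phi = fun z => dphi z.2 by apply/funext => z; have [_ <-] := H2 z.
have cs (f : R -> R) : continuous f -> continuous (fun z : R * R => f z.2).
  by move=> cf; exact: (@cont2_of2 _ f cf).
split => //=; rewrite E1 E2; split.
- by apply: cs; exact: is_derive1_continuous Dphi.
- by move=> z; split; [have [] := H1 z|have [] := H2 z].
- by move=> z; exact: cvg_cst.
- exact: cs.
Qed.

End PartialDerivatives.

(** * Extension of data on [0, L] and on t >= 0 to the whole line *)

Section Restriction.
Context {R : realType} (L : R) (L0 : 0 < L).
Local Notation mu := (@lebesgue_measure R).
Local Notation I := (`[0, L]%classic).
Implicit Types (u v phi : R -> R).

Let L0' : 0 <= L := ltW L0.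
Let mI : measurable (I : set (measurableTypeR R)). Proof. exact: measurable_itv. Qed.

Lemma restrI u x : 0 <= x <= L -> (u \_ I) x = u x.
Proof. by move=> xL; rewrite patchE mem_set//= in_itv. Qed.

Lemma L2_seg_restr u : L2_seg L u -> L2loc (u \_ I).
Proof.
move=> [mu_ iu]; split.
  exact/(measurable_restrictT _ mI).
move=> a b.
have -> : EFin \o (fun x => (u \_ I) x ^+ 2) = (fun x => (u x ^+ 2)%:E) \_ I.
  by apply/funext => x; rewrite /= !patchE; case: ifPn => // _; rewrite expr0n.
apply/integrable_restrict => //.
by apply: integrableS iu => //; exact: measurableI.
Qed.

Lemma L2norm_nsq u v (u' v' : R -> R) : (forall x, 0 <= x <= L -> u x = u' x) ->
  (forall x, 0 <= x <= L -> v x = v' x) -> L2loc u' -> L2loc v' ->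
  L2norm L u v = Num.sqrt (nsq L u' + nsq L v').
Proof.
move=> uu vv lu lv; rewrite /L2norm; congr Num.sqrt.
rewrite /nsq -(sintD _ _ (L2loc_sqr lu) (L2loc_sqr lv)) sint_itv//.
apply: eq_Rintegral => x; rewrite inE/= in_itv/= => xL.
by rewrite uu// vv.
Qed.

Lemma max_within (t : R) : Num.max s 0 @[s --> t] --> within `[0, +oo[%classic (nbhs (Num.max t 0)).
Proof.
move=> A /= [e /= e0 He]; exists e => //= s ts; apply: He => /=; last first.
  by rewrite in_itv/= le_max lexx orbT.
apply: le_lt_trans ts; rewrite /Num.max; case: ifPn => [t0|]; case: ifPn => [s0|]; rewrite -?leNgt.
- by rewrite subrr normr0.
- by move=> s0; rewrite sub0r normrN ger0_norm// distrC ger0_norm; lra.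
- by move=> t0; rewrite subr0 ger0_norm// ger0_norm; lra.
- by [].
Qed.

(** Composition with max(t, 0) turns continuity relative to t >= 0 into continuity on R; each
    component is dominated by the joint squared norm. *)
Lemma solution_curve (h q : R -> R -> R) :
  (forall t, 0 <= t -> L2_seg L (h t) /\ L2_seg L (q t)) ->
  (forall t, 0 <= t -> L2norm L (fun x => h s x - h t x) (fun x => q s x - q t x)
     @[s --> within `[0, +oo[ (nbhs t)] --> (0 : R)) ->
  L2curve L (fun t => h (Num.max t 0) \_ I) /\ L2curve L (fun t => q (Num.max t 0) \_ I).
Proof.
move=> hq2 hqc.
have m0 (t : R) : 0 <= Num.max t 0 by rewrite le_max lexx orbT.
have lh t : L2loc (h (Num.max t 0) \_ I) by apply: L2_seg_restr; have [] := hq2 _ (m0 t).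
have lq t : L2loc (q (Num.max t 0) \_ I) by apply: L2_seg_restr; have [] := hq2 _ (m0 t).
have key t : nsq L (fun x => (h (Num.max s 0) \_ I) x - (h (Num.max t 0) \_ I) x)
    + nsq L (fun x => (q (Num.max s 0) \_ I) x - (q (Num.max t 0) \_ I) x) @[s --> t] --> (0 : R).
  have H : L2norm L (fun x => h (Num.max s 0) x - h (Num.max t 0) x)
      (fun x => q (Num.max s 0) x - q (Num.max t 0) x) @[s --> t] --> (0 : R).
    exact: (cvg_comp _ _ (max_within (t := t)) (hqc _ (m0 t))).
  have := cvgM H H; rewrite mulr0.
  suff E s : nsq L (fun x => (h (Num.max s 0) \_ I) x - (h (Num.max t 0) \_ I) x)
    + nsq L (fun x => (q (Num.max s 0) \_ I) x - (q (Num.max t 0) \_ I) x) =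
    L2norm L (fun x => h (Num.max s 0) x - h (Num.max t 0) x)
      (fun x => q (Num.max s 0) x - q (Num.max t 0) x) *
    L2norm L (fun x => h (Num.max s 0) x - h (Num.max t 0) x)
      (fun x => q (Num.max s 0) x - q (Num.max t 0) x).
    by rewrite (funext E) => H2; exact: H2.
  set A := nsq L _; set B := nsq L _.
  have AB0 : 0 <= A + B by apply: addr_ge0; exact: nsq_ge0.
  have -> : L2norm L (fun x => h (Num.max s 0) x - h (Num.max t 0) x)
      (fun x => q (Num.max s 0) x - q (Num.max t 0) x) = Num.sqrt (A + B).
    apply: L2norm_nsq; try (by move=> x xL; rewrite !restrI//); exact: L2locB.
  by rewrite -expr2 sqr_sqrtr.
split; split => // t.
- apply: (@squeeze_cvgr _ _ _ _ (fun=> 0) _ _ _ _ _ (key t)); last exact: cvg_cst.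
  by apply: nearW => s; rewrite nsq_ge0//= lerDl nsq_ge0.
- apply: (@squeeze_cvgr _ _ _ _ (fun=> 0) _ _ _ _ _ (key t)); last exact: cvg_cst.
  by apply: nearW => s; rewrite nsq_ge0//= lerDr nsq_ge0.
Qed.

Lemma bounded_locint (d : R -> R) (K : R) : measurable_fun (`[0, +oo[ : set R) d ->
  (forall t, 0 <= t -> `|d t| <= K) -> locint (d \_ `[0, +oo[%classic).
Proof.
move=> md dK; apply: (@locint_le _ _ (fun=> K)).
- by apply/(measurable_restrictT _ (measurable_itv _)).
- exact: locint_cst.
- move=> x; rewrite patchE; case: ifPn; first by rewrite inE/= in_itv/= andbT; exact: dK.
  by rewrite normr0 (le_trans (normr_ge0 (d 0)))// dK.
Qed.

Lemma nsq_ae u v : {ae mu, forall x, x \in `[0, L] -> u x = v x} ->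
  L2loc (u \_ I) -> L2loc (v \_ I) -> nsq L (u \_ I) = nsq L (v \_ I).
Proof.
move=> uv lu lv; rewrite /nsq !sint_itv// /Rintegral; congr fine.
apply: ae_eq_integral => //.
- exact: measurable_int (L2loc_sqr lu 0 L).
- exact: measurable_int (L2loc_sqr lv 0 L).
apply: (@filterS _ _ (ae_filter_ringOfSetsType mu) _ _ _ uv) => x uvx Ix.
have xL : 0 <= x <= L by move: Ix; rewrite /= in_itv.
by rewrite !restrI// uvx// in_itv.
Qed.

End Restriction.

(** * Input-to-state stability from an energy estimate *)

Section StabilityFromData.
Context {R : realType} (L : R) (L0 : 0 < L).
Local Notation mu := (@lebesgue_measure R).
Local Notation I := (`[0, L]%classic).
Local Notation clip := (clip L).
Implicit Types (x t : R).

Let L0' : 0 <= L := ltW L0.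

Variables (a b da db ta tb : R -> R) (alh alq : R).
Hypotheses (Ca : C1d L a da) (Cb : C1d L b db).
Hypotheses (cta : continuous (ta \o clip)) (ctb : continuous (tb \o clip)).
Hypothesis a_neq0 : forall x, 0 <= x <= L -> a x != 0.

Let ac := a \o clip.
Let bc := b \o clip.
Let tac := ta \o clip.
Let tbc := tb \o clip.

(** For test functions of x alone the multiplier is a constant [m] and the time derivatives drop
    out; the product rule on [0, L] cancels the derivatives of the coefficients. *)
Lemma weak_time_independent (d h0 q0 : R -> R) (h q : R -> R -> R) :
  L2_solution L a b (fun x => dseg L a x + ta x) (fun x => dseg L b x + tb x) alh alq d h0 q0 h q ->
  L2_seg L h0 -> L2_seg L q0 -> locint (d \_ `[0, +oo[%classic) ->
  forall (phi1 phi2 dphi1 dphi2 : R -> R) (m : R),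
  (forall x, is_derive x 1 phi1 (dphi1 x)) -> (forall x, is_derive x 1 phi2 (dphi2 x)) ->
  continuous dphi1 -> continuous dphi2 ->
  phi1 L + bc L * phi2 L = 0 -> ac 0 * phi2 0 = m * alh -> phi1 0 + bc 0 * phi2 0 = m * alq ->
  forall t, 0 <= t ->
  ip L (h (Num.max t 0) \_ I) phi1 + ip L (q (Num.max t 0) \_ I) phi2
    - (ip L (h0 \_ I) phi1 + ip L (q0 \_ I) phi2) =
  sint (fun s => ip L (h (Num.max s 0) \_ I) (fun x => ac x * dphi2 x - tac x * phi2 x)
     + ip L (q (Num.max s 0) \_ I) (fun x => dphi1 x + bc x * dphi2 x - tbc x * phi2 x)) 0 t
  + m * sint (d \_ `[0, +oo[%classic) 0 t.
Proof.
move=> [hq2 hqc _ sol] h02 q02 ld phi1 phi2 dphi1 dphi2 m D1 D2 cd1 cd2.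
have clip0 : clip 0 = 0 by rewrite clip_id// lexx L0'.
have clipL : clip L = L by rewrite clip_id// lexx L0'.
rewrite /ac /bc /= clip0 clipL => bL b01 b02 t t0.
have [Ck1 E11 E12] := Ck1_space D1 cd1; have [Ck2 E21 E22] := Ck1_space D2 cd2.
set Phi1 := (fun z : R * R => phi1 z.2) in Ck1 E11 E12.
set Phi2 := (fun z : R * R => phi2 z.2) in Ck2 E21 E22.
have adj : adjoint_test L a b alh alq t Phi1 Phi2 (fun=> m) by split.
have := sol t Phi1 Phi2 (fun=> m) t0 adj.
have cp1 := is_derive1_continuous D1; have cp2 := is_derive1_continuous D2.
have lp1 := continuous_L2loc cp1; have lp2 := continuous_L2loc cp2.
have m0 (s : R) : 0 <= s -> Num.max s 0 = s by move=> s0; apply/max_idPl.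
have lh s : 0 <= s -> L2loc (h s \_ I) by move=> s0; apply: L2_seg_restr; have [] := hq2 s s0.
have lq s : 0 <= s -> L2loc (q s \_ I) by move=> s0; apply: L2_seg_restr; have [] := hq2 s s0.
have pair (u v f g : R -> R) : L2loc (u \_ I) -> L2loc (v \_ I) -> continuous f -> continuous g ->
    \int[mu]_(x in I) (u x * f x + v x * g x) = ip L (u \_ I) f + ip L (v \_ I) g.
  move=> lu lv cf cg.
  rewrite /ip -(sintD _ _ (L2loc_mul lu (continuous_L2loc cf)) (L2loc_mul lv (continuous_L2loc cg))).
  rewrite sint_itv//; apply: eq_Rintegral => x; rewrite inE/= in_itv/= => xL.
  by rewrite !restrI.
rewrite (pair (h t) (q t) phi1 phi2 (lh t t0) (lq t t0) cp1 cp2).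
rewrite (pair h0 q0 phi1 phi2 (L2_seg_restr h02) (L2_seg_restr q02) cp1 cp2).
rewrite m0// => ->; congr (_ + _); last first.
  rewrite -sintZ// sint_itv//; apply: eq_Rintegral => s; rewrite inE/= in_itv/= => /andP[s0 _].
  by rewrite patchE mem_set//= in_itv/= s0.
have Cphi2 : C1d L phi2 dphi2.
  split; first by move=> x _; exact: derive_is_dseg.
  by move=> x; apply: (cvg_comp clip dphi2 (clip_cont (x := x) (L := L))); exact: cd2.
have cac := C1d_cont L0 Ca; have cbc := C1d_cont L0 Cb.
have cA : continuous (fun x => ac x * dphi2 x - tac x * phi2 x).
  by move=> x; apply: cvgB; apply: cvgM; [exact: cac|exact: cd2|exact: cta|exact: cp2].
have cB : continuous (fun x => dphi1 x + bc x * dphi2 x - tbc x * phi2 x).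
  move=> x; apply: cvgB; last by apply: cvgM; [exact: ctb|exact: cp2].
  by apply: cvgD; [exact: cd1|apply: cvgM; [exact: cbc|exact: cd2]].
rewrite sint_itv//; apply: eq_Rintegral => s; rewrite inE/= in_itv/= => /andP[s0 _].
rewrite m0// -(pair (h s) (q s) _ _ (lh s s0) (lq s s0) cA cB).
apply: eq_Rintegral => x; rewrite inE/= in_itv/= => xL.
have Ix : I x by rewrite /= in_itv.
rewrite E11 E12 E21 /Phi2 /=.
rewrite (C1d_dseg L0 (C1dM L0 Ca Cphi2) Ix) (C1d_dseg L0 (C1dM L0 Cb Cphi2) Ix).
rewrite (C1d_dseg L0 Ca Ix) (C1d_dseg L0 Cb Ix) /ac /bc /tac /tbc /= !clip_id//.
by ring.
Qed.

Variables (P11 P12 P22 : R -> R) (k0 k1 C nu : R).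
Hypotheses (cP11 : continuous P11) (cP12 : continuous P12) (cP22 : continuous P22).
Hypotheses (k0_gt0 : 0 < k0) (k1_gt0 : 0 < k1) (C0 : 0 <= C) (nu0 : 0 < nu).
Hypothesis P_bounds : forall x u v, 0 <= x <= L ->
  k0 * (u ^+ 2 + v ^+ 2) <= qform (P11 x) (P12 x) (P22 x) u v <= k1 * (u ^+ 2 + v ^+ 2).
Hypothesis energy_le : forall D delta w1 w2 dw1 dw2,
  smooth_solution L ac bc tac tbc alh alq delta w1 w2 dw1 dw2 ->
  (forall t, 0 <= t -> `|delta t| <= D) -> forall t, 0 <= t ->
  energy L P11 P12 P22 w1 w2 t <=
  expR (- (2 * nu) * t) * energy L P11 P12 P22 w1 w2 0 + C * D ^+ 2 / (2 * nu).

Lemma energy_L2_ISS :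
  L2_ISS L a b (fun x => dseg L a x + ta x) (fun x => dseg L b x + tb x) alh alq.
Proof.
(* Square roots of the constants of the squared estimate. Since [C] may be 0, the summand 1 keeps
   the second constant positive. *)
exists (Num.sqrt (k1 / k0)), (Num.sqrt (C / (2 * nu) / k0) + 1), nu.
split; [by rewrite sqrtr_gt0 divr_gt0|by rewrite ltr_wpDl// sqrtr_ge0|by []|].
move=> d h0 q0 h q md [K dK] h02 q02 sol t t0.
have [hq2 hqc hae _] := sol.
set D := sup _.
have dD (s : R) : 0 <= s -> `|d s| <= D.
  move=> s0; apply: ub_le_sup.
    by exists K => _ [r /= + <-]; rewrite in_itv/= andbT; exact: dK.
  by exists s => //=; rewrite in_itv/= s0.
have D0 : 0 <= D by rewrite (le_trans (normr_ge0 (d 0)))// dD.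
have ld := bounded_locint md dK.
have dD' (s : R) : 0 <= s -> `|(d \_ `[0, +oo[%classic) s| <= D.
  by move=> s0; rewrite patchE mem_set ?dD//= in_itv/= s0.
have ca := C1d_cont L0 Ca; have cb := C1d_cont L0 Cb.
have an0 x : ac x != 0 by apply: a_neq0; exact: clip_itv.
have [hC qC] := solution_curve L0 hq2 hqc.
have m0 (s : R) : 0 <= s -> Num.max s 0 = s by move=> s0; apply/max_idPl.
have := @weak_solution_estimate R L L0 ac bc tac tbc alh alq _ _ _ _ _
  ca cb cta ctb an0 hC qC (L2_seg_restr h02) (L2_seg_restr q02) ld
  (weak_time_independent sol h02 q02 ld) P11 P12 P22 k0 k1 C nu D cP11 cP12 cP22
  k0_gt0 k1_gt0 C0 nu0 D0 P_bounds (@energy_le D) dD' t t0.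
rewrite !m0//.
have lr (s : R) : 0 <= s -> L2loc (h s \_ I) /\ L2loc (q s \_ I).
  by move=> s0; have [H1 H2] := hq2 s s0; split; exact: L2_seg_restr.
have norm_t (s : R) : 0 <= s -> L2norm L (h s) (q s) = Num.sqrt (nsq L (h s \_ I) + nsq L (q s \_ I)).
  move=> s0; have [H1 H2] := lr s s0.
  by apply: L2norm_nsq => // x xL; rewrite restrI.
rewrite -norm_t// => /le_trans; apply.
have -> : nsq L (h 0 \_ I) = nsq L (h0 \_ I).
  apply: (nsq_ae L0); [|by have [] := lr 0 (lexx (0 : R))|exact: L2_seg_restr].
  by apply: (@filterS _ _ (ae_filter_ringOfSetsType mu) _ _ _ hae) => x H /H[].
have -> : nsq L (q 0 \_ I) = nsq L (q0 \_ I).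
  apply: (nsq_ae L0); [|by have [] := lr 0 (lexx (0 : R))|exact: L2_seg_restr].
  by apply: (@filterS _ _ (ae_filter_ringOfSetsType mu) _ _ _ hae) => x H /H[].
have -> : L2norm L h0 q0 = Num.sqrt (nsq L (h0 \_ I) + nsq L (q0 \_ I)).
  apply: (L2norm_nsq L0 _ _ (L2_seg_restr h02) (L2_seg_restr q02)) => x xL.
    by rewrite restrI.
  by rewrite restrI.
set N := nsq L _ + nsq L _.
have N0 : 0 <= N by apply: addr_ge0; exact: nsq_ge0.
have kk : 0 <= k1 / k0 by rewrite divr_ge0// ltW.
have cc : 0 <= C / (2 * nu) / k0 by rewrite !divr_ge0// ?mulr_ge0// ltW.
have ee : expR (- (2 * nu) * t) = expR (- nu * t) ^+ 2.
  by rewrite -expRM_natl; congr expR; ring.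
set X := Num.sqrt (k1 / k0) * Num.sqrt N * expR (- nu * t).
set Y := Num.sqrt (C / (2 * nu) / k0) * D.
have X0 : 0 <= X by rewrite !mulr_ge0 ?sqrtr_ge0 ?expR_ge0.
have Y0 : 0 <= Y by rewrite mulr_ge0 ?sqrtr_ge0.
have YD : Y <= (Num.sqrt (C / (2 * nu) / k0) + 1) * D.
  by rewrite (mulrDl _ 1 D) mul1r lerDl.
apply: (@le_trans _ _ (X + Y)); last by rewrite lerD2l.
(* The two contributions are squares, and sqrt(X^2 + Y^2) <= X + Y for nonnegative X and Y. *)
have -> : k1 / k0 * expR (- (2 * nu) * t) * N + C * D ^+ 2 / (2 * nu) / k0 = X ^+ 2 + Y ^+ 2.
  rewrite /X /Y !exprMn !sqr_sqrtr// ee.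
  by move: (expR _ ^+ 2) => E; ring.
have XY : 0 <= X + Y by exact: addr_ge0.
rewrite -[leRHS](ger0_norm XY) -sqrtr_sqr ler_wsqrtr// sqrrD addrAC lerDl.
by rewrite mulrn_wge0// mulr_ge0.
Qed.

End StabilityFromData.

(** * The matrices P, M and S of the system and their positivity *)

Section LyapunovFunction.
Context {R : realType} (L : R) (L0 : 0 < L).
Local Notation I := (`[0, L]%classic).
Local Notation clip := (clip L).
Implicit Types (x t : R).

Let L0' : 0 <= L := ltW L0.

Lemma opp_mx2 (A00 A01 A10 A11 : R) : - mx2 A00 A01 A10 A11 = mx2 (- A00) (- A01) (- A10) (- A11).
Proof. by apply/matrixP => i j; rewrite !mxE; do 2 case: ifP. Qed.

Lemma add_mx2 (A00 A01 A10 A11 B00 B01 B10 B11 : R) :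
  mx2 A00 A01 A10 A11 + mx2 B00 B01 B10 B11 =
  mx2 (A00 + B00) (A01 + B01) (A10 + B10) (A11 + B11).
Proof. by apply/matrixP => i j; rewrite !mxE; do 2 case: ifP. Qed.

Let cadd (f g : R -> R) : continuous f -> continuous g -> continuous (fun x => f x + g x).
Proof. by move=> cf cg x; apply: cvgD; [exact: cf|exact: cg]. Qed.

Let cmul (f g : R -> R) : continuous f -> continuous g -> continuous (fun x => f x * g x).
Proof. by move=> cf cg x; apply: cvgM; [exact: cf|exact: cg]. Qed.

Let copp (f : R -> R) : continuous f -> continuous (fun x => - f x).
Proof. by move=> cf x; apply: cvgN; exact: cf. Qed.

Let ccst (k : R) : continuous (fun _ : R => k).
Proof. by move=> x; exact: cvg_cst. Qed.

Variables (a b da db ta tb : R -> R) (alh alq : R) (p1 p2 : R -> R).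
Hypotheses (Ca : C1d L a da) (Cb : C1d L b db).
Hypotheses (cta : continuous (ta \o clip)) (ctb : continuous (tb \o clip)).
Hypotheses (Cp1 : C1d L p1 (dseg L p1)) (Cp2 : C1d L p2 (dseg L p2)).

Let l1 := lambda1 a b.
Let l2 := lambda2 a b.

Hypothesis hyperbolic : forall x, 0 <= x <= L -> [/\ 0 < b x ^+ 2 + 4 * a x, 0 < l1 x & 0 < l2 x].
Hypothesis g_neq0 : alh + alq * l1 0 != 0.
Hypothesis p_gt0 : forall x, 0 <= x <= L -> 0 < p1 x /\ 0 < p2 x.
Hypothesis bc_left :
  ((alh - alq * l2 0) / (alh + alq * l1 0)) ^+ 2 < p2 0 / p1 0 * (l2 0 / l1 0).
Hypothesis bc_right : (p2 L * l2 L) / (p1 L * l1 L) < 1.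
Hypothesis PD : forall x, 0 <= x <= L ->
  posdef (- dseg_mx L (Mmx a b p1 p2) x + (Bmx L a b ta tb x)^T *m Pmx a b p1 p2 x
                   + Pmx a b p1 p2 x *m Bmx L a b ta tb x).

Let l12_mul x : 0 <= x <= L -> l1 x * l2 x = a x.
Proof.
move=> /hyperbolic [d0 _ _]; rewrite /l1 /l2 /lambda1 /lambda2.
have := sqr_sqrtr (ltW d0); move: (Num.sqrt _) => s sE.
have -> : (b x + s) / 2 * - ((b x - s) / 2) = (s ^+ 2 - b x ^+ 2) / 4 by field.
by rewrite sE; field.
Qed.

Let l12_sub x : l1 x - l2 x = b x.
Proof. by rewrite /l1 /l2 /lambda1 /lambda2; field. Qed.

Let P11 y := p1 y * (l2 y * l2 y) + p2 y * (l1 y * l1 y).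
Let P12 y := p1 y * l2 y - p2 y * l1 y.
Let P22 y := p1 y + p2 y.
Let M11 y := P12 y * a y.
Let M12 y := P11 y + P12 y * b y.
Let M22 y := P12 y + P22 y * b y.

(** Symmetry of M = P A, from a = l1 l2 and b = l1 - l2. The first relation uses the positive
    discriminant, so the identity is stated on [0, L] only. *)
Let M21E y : 0 <= y <= L -> M12 y = P22 y * a y.
Proof.
by move=> yL; rewrite /M12 /P22 /P11 /P12 -l12_sub -(l12_mul yL); ring.
Qed.

Let qP x u v : qform (P11 x) (P12 x) (P22 x) u v =
  p1 x * (l2 x * u + v) ^+ 2 + p2 x * (v - l1 x * u) ^+ 2.
Proof. by rewrite /qform /P11 /P12 /P22; ring. Qed.

(** The forms l2 u + v and v - l1 u are left eigenvectors of A for the eigenvalues l1 and -l2, so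
    multiplying P by A only inserts these factors. *)
Let qM x u v : 0 <= x <= L -> qform (M11 x) (M12 x) (M22 x) u v =
  p1 x * l1 x * (l2 x * u + v) ^+ 2 - p2 x * l2 x * (v - l1 x * u) ^+ 2.
Proof.
by move=> xL; rewrite /qform /M11 /M12 /M22 /P11 /P12 /P22 -l12_sub -(l12_mul xL); ring.
Qed.

Let C1_l1 : exists dl, C1d L l1 dl.
Proof.
eexists; apply: (eq_C1d (p := fun y => 2^-1 * (b y + Num.sqrt (b y * b y + 4 * a y)))).
  by move=> y _; rewrite /l1 /lambda1 expr2 mulrC.
apply: C1dZ => //; apply: C1dD; first exact: Cb.
apply: C1d_sqrt => //; first by apply: C1dD; [apply: C1dM => //; exact: Cb|apply: C1dZ => //; exact: Ca].
by move=> x; rewrite /= in_itv/= => /hyperbolic [+ _ _]; rewrite expr2.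
Qed.

Let C1_l2 : exists dl, C1d L l2 dl.
Proof.
have [dl Cl] := C1_l1; exists (fun y => dl y - db y).
apply: (eq_C1d (p := fun y => l1 y - b y)).
  by move=> y _; rewrite -(l12_sub y); ring.
exact: C1dB.
Qed.

Lemma lyapunov_L2_ISS :
  L2_ISS L a b (fun x => dseg L a x + ta x) (fun x => dseg L b x + tb x) alh alq.
Proof.
have [dl1 Cl1] := C1_l1; have [dl2 Cl2] := C1_l2.
have [dP11 CP11] : exists d, C1d L P11 d.
  by eexists; apply: C1dD; apply: C1dM => //; first [exact: Cp1|exact: Cp2|apply: C1dM => //; first [exact: Cl1|exact: Cl2]].
have [dP12 CP12] : exists d, C1d L P12 d.
  by eexists; apply: C1dB => //; apply: C1dM => //; first [exact: Cp1|exact: Cp2|exact: Cl1|exact: Cl2].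
have [dP22 CP22] : exists d, C1d L P22 d by eexists; apply: C1dD; [exact: Cp1|exact: Cp2].
have [dM11 CM11] : exists d, C1d L M11 d by eexists; apply: C1dM => //; [exact: CP12|exact: Ca].
have [dM12 CM12] : exists d, C1d L M12 d.
  by eexists; apply: C1dD => //; [exact: CP11|apply: C1dM => //; [exact: CP12|exact: Cb]].
have [dM22 CM22] : exists d, C1d L M22 d.
  by eexists; apply: C1dD => //; [exact: CP12|apply: C1dM => //; [exact: CP22|exact: Cb]].
(* The (2,1) entry of [Mmx] is literally P22 a. It is known to agree with [M12] on the segment,
   which suffices to give it the same derivative there. *)
have CM21 : C1d L (fun y => P22 y * a y) dM12.
  by apply: eq_C1d CM12 => y; rewrite /= in_itv/=; exact: M21E.
have a_neq0 x : 0 <= x <= L -> a x != 0.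
  by move=> xL; have [_ h1 h2] := hyperbolic xL; rewrite -(l12_mul xL) gt_eqF// mulr_gt0.
pose c x := da x + ta x; pose e x := db x + tb x.
pose S11 x := - dM11 x + 2 * P12 x * c x.
pose S12 x := - dM12 x + P12 x * e x + P22 x * c x.
pose S22 x := - dM22 x + 2 * P22 x * e x.
have S_pos x u v : 0 <= x <= L -> (u != 0) || (v != 0) -> 0 < qform (S11 x) (S12 x) (S22 x) u v.
  move=> xL uv; have Ix : I x by rewrite /= in_itv.
  have ME : Mmx a b p1 p2 = fun y => mx2 (M11 y) (M12 y) (P22 y * a y) (M22 y).
    apply/funext => y; rewrite /Mmx PmxE mulmx_mx2 -[lambda1 a b]/l1 -[lambda2 a b]/l2.
    rewrite /M11 /M12 /M22 /P11 /P12 /P22.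
    by congr mx2; ring.
  have KE : - dseg_mx L (Mmx a b p1 p2) x + (Bmx L a b ta tb x)^T *m Pmx a b p1 p2 x
                   + Pmx a b p1 p2 x *m Bmx L a b ta tb x =
     mx2 (S11 x) (- dM12 x + c x * P22 x + P12 x * e x) (- dM12 x + e x * P12 x + P22 x * c x) (S22 x).
    rewrite ME dseg_mx2 (C1d_dseg L0 CM11 Ix) (C1d_dseg L0 CM12 Ix) (C1d_dseg L0 CM21 Ix).
    rewrite (C1d_dseg L0 CM22 Ix) PmxE /Bmx tr_mx2 !mulmx_mx2 opp_mx2 !add_mx2.
    rewrite (C1d_dseg L0 Ca Ix) (C1d_dseg L0 Cb Ix) -/(c x) -/(e x).
    rewrite -[lambda1 a b]/l1 -[lambda2 a b]/l2.
    rewrite /S11 /S22 /P12 /P22.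
    by congr mx2; ring.
  have := posdef_qform KE (PD xL) uv; congr (_ < _).
  by congr qform; rewrite /S12; field.
have cc : continuous (c \o clip) by apply: cadd => //; case: Ca.
have ce : continuous (e \o clip) by apply: cadd => //; case: Cb.
have cP11 := C1d_cont L0 CP11; have cP12 := C1d_cont L0 CP12; have cP22 := C1d_cont L0 CP22.
have cS11 : continuous (S11 \o clip).
  apply: cadd; first by apply: copp; case: CM11.
  by apply: cmul => //; apply: cmul => //; exact: ccst.
have cS12 : continuous (S12 \o clip).
  apply: cadd; last exact: cmul.
  by apply: cadd; [apply: copp; case: CM12|exact: cmul].
have cS22 : continuous (S22 \o clip).
  apply: cadd; first by apply: copp; case: CM22.
  by apply: cmul => //; apply: cmul => //; exact: ccst.
have [m m0 Hm] : exists2 m, 0 < m & forall x u v, 0 <= x <= L ->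
    m * (u ^+ 2 + v ^+ 2) <= qform ((S11 \o clip) x) ((S12 \o clip) x) ((S22 \o clip) x) u v.
  apply: qform_lower => // x u v xL uv; rewrite /= !clip_id//; exact: S_pos.
have [k0 k00 Hk0] : exists2 m, 0 < m & forall x u v, 0 <= x <= L ->
    m * (u ^+ 2 + v ^+ 2) <= qform ((P11 \o clip) x) ((P12 \o clip) x) ((P22 \o clip) x) u v.
  apply: qform_lower => // x u v xL uv; rewrite /= !clip_id// qP.
  have [h1 h2] := p_gt0 xL; have [_ h3 h4] := hyperbolic xL.
  have e1 : 0 <= p1 x * (l2 x * u + v) ^+ 2 by rewrite mulr_ge0 ?sqr_ge0// ltW.
  have e2 : 0 <= p2 x * (v - l1 x * u) ^+ 2 by rewrite mulr_ge0 ?sqr_ge0// ltW.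
  rewrite lt_def (addr_ge0 e1 e2) andbT.
  apply: contraTneq uv => E.
  have /eqP z1 : p1 x * (l2 x * u + v) ^+ 2 = 0 by apply/eqP; rewrite eq_le e1 andbT; move: E e2; lra.
  have /eqP z2 : p2 x * (v - l1 x * u) ^+ 2 = 0 by apply/eqP; rewrite eq_le e2 andbT; move: E e1; lra.
  move: z1 z2; rewrite !mulf_eq0 !orbb (gt_eqF h1) (gt_eqF h2)/= => /eqP z1 /eqP z2.
  (* Both characteristic variables vanish, and their difference is (l1 + l2) u. *)
  have zu : (l1 x + l2 x) * u = 0 by lra.
  have u0 : u = 0.
    by move/eqP: zu; rewrite mulf_eq0 gt_eqF ?addr_gt0//= => /eqP.
  have v0 : v = 0 by move: z1; rewrite u0 mulr0 add0r.
  by rewrite u0 v0 eqxx.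
have [k1 k10 Hk1] := qform_upper L cP11 cP12 cP22.
have zL : 0 <= (0 : R) <= L by rewrite lexx L0'.
have LL : 0 <= L <= L by rewrite lexx L0'.
have [C C0 HC] : exists2 C : R, 0 <= C & forall u v,
    qform (M11 0) (M12 0) (M22 0) u v <= C * (alh * u + alq * v) ^+ 2.
  have [h1 h2] := p_gt0 zL; have [_ h3 h4] := hyperbolic zL.
  have [C C0 HC] := boundary_qform h3 h4 h1 h2 g_neq0 bc_left.
  by exists C => // u v; rewrite qM//; exact: HC.
(* On the vector (0, 1) both characteristic variables equal 1, so this entry is p1 l1 - p2 l2 at
   L. *)
have M22L : 0 <= M22 L.
  have -> : M22 L = qform (M11 L) (M12 L) (M22 L) 0 1 by rewrite /qform; ring.
  rewrite qM// !mulr0 add0r subr0 expr1n !mulr1.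
  have [h1 h2] := p_gt0 LL; have [_ h3 h4] := hyperbolic LL.
  by rewrite subr_ge0 ltW//; move: bc_right; rewrite ltr_pdivrMr ?mul1r// mulr_gt0.
(* With this rate, 2 nu times the form of P is at most 2 nu k1 = m times the squared length, hence
   at most the form of S. *)
pose nu := m / (2 * k1).
have nu0 : 0 < nu by rewrite divr_gt0// mulr_gt0.
apply: (@energy_L2_ISS R L L0 a b da db ta tb alh alq Ca Cb cta ctb a_neq0
  (P11 \o clip) (P12 \o clip) (P22 \o clip) k0 k1 C nu) => //.
  by move=> x u v xL; rewrite Hk0//= Hk1.
move=> D delta w1 w2 dw1 dw2 ss deltaD t t0.
have clip0 : clip 0 = 0 by rewrite clip_id.
have clipL : clip L = L by rewrite clip_id.
apply: (@energy_estimate R L L0 (a \o clip) (b \o clip) (ta \o clip) (tb \o clip)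
  (da \o clip) (db \o clip) alh alq (P11 \o clip) (P12 \o clip) (P22 \o clip)
  (M11 \o clip) (M12 \o clip) (M22 \o clip) (dM11 \o clip) (dM12 \o clip) (dM22 \o clip)
  C nu) => //.
- by case: Ca.
- by case: Cb.
- by move=> x; apply: a_neq0; exact: clip_itv.
- exact: (C1d_cont L0 CM11).
- exact: (C1d_cont L0 CM12).
- exact: (C1d_cont L0 CM22).
- by case: CM11.
- by case: CM12.
- by case: CM22.
- by move=> x xL; exact: (C1d_derive Ca xL).
- by move=> x xL; exact: (C1d_derive Cb xL).
- by move=> x xL; exact: (C1d_derive CM11 xL).
- by move=> x xL; exact: (C1d_derive CM12 xL).
- by move=> x xL; exact: (C1d_derive CM22 xL).
- by move=> x; apply: M21E; exact: clip_itv.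
- move=> x u v xL; apply: le_trans (Hm x u v xL).
  have -> : m = 2 * nu * k1 by rewrite /nu; field; rewrite gt_eqF.
  rewrite -[leRHS]mulrA; apply: ler_wpM2l; last exact: Hk1.
  by rewrite mulr_ge0// ltW.
- by rewrite /= clipL.
- by rewrite /= clip0.
- exact: ss.
- exact: deltaD.
Qed.

End LyapunovFunction.

(** * The system linearized at the steady state *)

Theorem theorem3 (R : realType) (L : R) (L_gt0 : 0 < L)
    (f g alpha : R * R -> R)
    (f_C2 : Ck 2 f) (g_C1 : Ck 1 g) (alpha_C1 : Ck 1 alpha)
    (HL Qs : R) (Hs : R -> R)
    (Hs_C1 : C1_seg L Hs)
    (Hs_steady : forall x : R, x \in `[0, L] ->
       dseg L (fun y => f (Hs y, Qs)) x + g (Hs x, Qs) = 0)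
    (Hs_L : Hs L = HL) :
  let a := fun x => D1 f (Hs x, Qs) in
  let b := fun x => D2 f (Hs x, Qs) in
  let ta := fun x => D1 g (Hs x, Qs) in
  let tb := fun x => D2 g (Hs x, Qs) in
  let alh := D1 alpha (Hs 0, Qs) in
  let alq := D2 alpha (Hs 0, Qs) in
  let l1 := lambda1 a b in
  let l2 := lambda2 a b in
  ~ (alh = 0 /\ alq = 0) ->
  (forall x : R, x \in `[0, L] ->
     [/\ 0 < b x ^+ 2 + 4 * a x, 0 < l1 x & 0 < l2 x]) ->
  alh + alq * l1 0 != 0 ->
  (exists p1 p2 : R -> R,
     [/\ C1_seg L p1 /\ C1_seg L p2,
         forall x : R, x \in `[0, L] -> 0 < p1 x /\ 0 < p2 x,
         ((alh - alq * l2 0) / (alh + alq * l1 0)) ^+ 2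
           < p2 0 / p1 0 * (l2 0 / l1 0),
         (p2 L * l2 L) / (p1 L * l1 L) < 1 &
         forall x : R, x \in `[0, L] ->
           posdef (- dseg_mx L (Mmx a b p1 p2) x
                   + (Bmx L a b ta tb x)^T *m Pmx a b p1 p2 x
                   + Pmx a b p1 p2 x *m Bmx L a b ta tb x)]) ->
  L2_ISS L a b (fun x => dseg L a x + ta x) (fun x => dseg L b x + tb x)
    alh alq.
Proof.
move=> a b ta tb alh alq l1 l2 _ hyp g0 [p1 [p2 [[Hp1 Hp2] pp bc0 bcL PD]]].
have [_ _ C1f1 C1f2] := f_C2.
have [_ _ cg1 cg2] := g_C1.
have CH := C1_segP L_gt0 Hs_C1.
have cH := C1d_cont L_gt0 CH.
(* The chain rule along the profile [Hs] makes [a] and [b] of class C^1 on [0, L], because the first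
   partial derivatives of [f] are C^1. *)
have Ca : C1d L a (fun y => D1 (D1 f) (Hs y, Qs) * dseg L Hs y).
  apply: (C1d_comp L_gt0 CH (fun u => Ck1_slice Qs u C1f1)).
  by apply: continuous_slice; case: C1f1.
have Cb : C1d L b (fun y => D1 (D2 f) (Hs y, Qs) * dseg L Hs y).
  apply: (C1d_comp L_gt0 CH (fun u => Ck1_slice Qs u C1f2)).
  by apply: continuous_slice; case: C1f2.
have cg (k : R * R -> R) : continuous k -> continuous ((fun y => k (Hs y, Qs)) \o clip L).
  move=> ck x; have c := @continuous_slice _ k Qs ck.
  exact: (@cvg_comp _ _ _ (Hs \o clip L) (fun y => k (y, Qs)) _ _ _ (cH x) (c _)).
apply: (lyapunov_L2_ISS L_gt0 Ca Cb (cg _ cg1) (cg _ cg2) (C1_segP L_gt0 Hp1) (C1_segP L_gt0 Hp2)) => //.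
all: by move=> x xL; (apply: hyp || apply: pp || apply: PD); rewrite in_itv.
Qed.
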